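(* Let $D\in\mathbb N$ and assume $$\zeta:=\frac{\bar\Delta^4}{\rho^2p^2}\max\Big(D^{14},\ D^7n,\ D^7\rho^2p,\ \rho^2p\,\frac{n}{K^2}\Big)<1.$$ Then, under the sparse clustering prior described in the context, with $x=\mathbf 1_{k_1^*=k_2^*}$, $$MMSE_{\le D}\ \ge\ \frac1K-\frac1{K^2}\left[1+\frac{\zeta}{(1-\sqrt\zeta)^3}\right].$$
   Context: Prior: $n\ge2$, $p,K\ge1$ integers, $\sigma>0$, $\bar\Delta>0$, $\bar s\in(0,p]$, $\rho=\bar s/p$. The following are sampled independently: $k_1^*,\dots,k_n^*$ i.i.d. uniform on $[K]=\{1,\dots,K\}$; $z_1,\dots,z_p$ i.i.d. Bernoulli with parameter $\rho$; $\varepsilon_1,\dots,\varepsilon_n$ i.i.d. uniform on $\{-1,1\}$; $\nu_{k,j}$, $(k,j)\in[K]\times[p]$, i.i.d. $\mathcal N(0,\lambda^2)$ with $\lambda^2=\bar\Delta^2\sigma^2/(\rho p)$. The signal matrix $X\in\mathbb R^{n\times p}$ is $X_{ij}=z_j\,\varepsilon_i\,\nu_{k_i^*,j}$, and the observation is $Y=X+E$, where the $E_{ij}$ are i.i.d. $\mathcal N(0,\sigma^2)$ independent of everything else. $MMSE_{\le D}:=\inf_f\mathbb E[(f(Y)-x)^2]$, the infimum being over all real polynomials $f$ in the entries $(Y_{ij})$ of total degree at most $D$, with expectation under the joint law of $(k^*,z,\varepsilon,\nu,E)$, in which these five families are mutually independent, the $k_i^*$ are i.i.d. uniform on $[K]$,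 the $z_j$ i.i.d. Bernoulli with parameter $\rho$, the $\varepsilon_i$ i.i.d. uniform on $\{-1,1\}$, the $\nu_{k,j}$ i.i.d. $\mathcal N(0,\lambda^2)$ and the $E_{ij}$ i.i.d. $\mathcal N(0,\sigma^2)$. *)

(* Defs.v *)
From HB Require Import structures.
From mathcomp Require Import all_boot all_order all_algebra.
From mathcomp Require Import all_classical all_reals all_analysis.
(* The notations of mpoly clash with those of the analysis library. *)
From mathcomp Require Import -(notations) mpoly.

Set Implicit Arguments.
Unset Strict Implicit.
Unset Printing Implicit Defensive.

Import Order.TTheory GRing.Theory Num.Theory.

Local Open Scope classical_set_scope.
Local Open Scope ring_scope.

Definition mutually_independent (d : measure_display) (T : measurableType d)
    (R : realType) (P : probability T R) (I : finType)
    (F : I -> set (set T)) : Prop :=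
  forall (J : {set I}) (A : I -> set T),
    (forall i, i \in J -> F i (A i)) ->
    P (\bigcap_(i in [set` J]) A i) = (\prod_(i in J) P (A i))%E.

Section sparse_clustering.
Context (d : measure_display) (T : measurableType d) (R : realType).
Context (P : probability T R) (n p K : nat).

(* Labels are numbered 0, ..., K-1 instead of 1, ..., K.  They are functions
   into the ordinals, which carry no measurableType structure in the library
   ('I_K may be empty), with all subsets of 'I_K as events. *)
Variables (k : 'I_n -> T -> 'I_K) (z : 'I_p -> {RV P >-> bool}).
Variables (eps : 'I_n -> {RV P >-> R}) (nu : 'I_K -> 'I_p -> {RV P >-> R}).
Variable (E : 'I_n -> 'I_p -> {RV P >-> R}).

Definition prior_index : finType :=
  ('I_n + 'I_p + 'I_n + ('I_K * 'I_p) + ('I_n * 'I_p))%type.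

Definition prior_events (v : prior_index) : set (set T) :=
  match v with
  | inl (inl (inl (inl i))) => preimage_set_system setT (k i) setT
  | inl (inl (inl (inr j))) => preimage_set_system setT (z j) measurable
  | inl (inl (inr i)) => preimage_set_system setT (eps i) measurable
  | inl (inr (a, j)) => preimage_set_system setT (nu a j) measurable
  | inr (i, j) => preimage_set_system setT (E i j) measurable
  end.

(* The second argument of normal_prob is the standard deviation. *)
Record sparse_clustering_prior (rho lambda sigma : R) : Prop := {
  label_measurable : forall i a, measurable (k i @^-1` [set a]);
  label_uniform : forall i a, P (k i @^-1` [set a]) = (K%:R^-1)%:E;
  z_bernoulli : forall j A, distribution P (z j) A = bernoulli_prob rho A;
  eps_plus : forall i, P (eps i @^-1` [set 1]) = (2^-1)%:E;
  eps_minus : forall i, P (eps i @^-1` [set -1]) = (2^-1)%:E;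
  nu_normal : forall a j V, measurable V ->
    distribution P (nu a j) V = normal_prob 0 lambda V;
  E_normal : forall i j V, measurable V ->
    distribution P (E i j) V = normal_prob 0 sigma V;
  prior_independent : mutually_independent P prior_events
}.

Definition signal (w : T) : 'M[R]_(n, p) :=
  \matrix_(i, j) ((z j w)%:R * eps i w * nu (k i w) j w).

Definition observation (w : T) : 'M[R]_(n, p) :=
  signal w + \matrix_(i, j) E i j w.

End sparse_clustering.

(* The entry Y i j is substituted for the variable of index mxvec_index i j. *)
Definition poly_eval (R : realType) (n p : nat) (f : mpoly (n * p) R)
    (Y : 'M[R]_(n, p)) : R :=
  meval (fun q => mxvec Y 0 q) f.

(* msize is the total degree plus one, and 0 for the zero polynomial. *)
Definition mmse (d : measure_display) (T : measurableType d) (R : realType)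
    (P : probability T R) (n p D : nat) (Y : T -> 'M[R]_(n, p)) (x : T -> R) :
    \bar R :=
  ereal_inf [set ('E_P[fun w => ((poly_eval f (Y w) - x w) ^+ 2)%R])%E |
             f in [set f | (msize f <= D.+1)%N]].

Definition zeta (R : realType) (n p K D : nat) (Delta rho : R) : R :=
  Delta ^+ 4 / (rho ^+ 2 * p%:R ^+ 2) *
  Num.max (D%:R ^+ 14)
    (Num.max (D%:R ^+ 7 * n%:R)
      (Num.max (D%:R ^+ 7 * rho ^+ 2 * p%:R)
               (rho ^+ 2 * p%:R * (n%:R / K%:R ^+ 2)))).

(* Main.v *)
(* Let h = \sum_(|a| <= D) kap_a / a! He_a(E / sigma), where the joint
   cumulants kap_a are defined by E[x X^a] = \sum_(b <= a) C(a, b) kap_b E[X^(a - b)]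
   with X the signal divided by sigma.  By Hermite calculus x - h is orthogonal
   to every polynomial of degree at most D in Y, whence
   E(f - x)^2 >= E x^2 - E h^2 = 1/K - \sum_a kap_a^2 / a!.

   View a as a family of edges (row, column).  Its cumulant vanishes unless the
   edges form one connected graph containing both rows i1 and i2, with even row
   and column degrees.  Unfolding the recursion bounds |kap_a| by a sum over
   assignments of the edges to levels.  Gaussian and Rademacher moments are
   bounded by counting perfect matchings of the edges inside each column or row,
   so that it remains to count level assignments and label colourings that are
   constant along a matching; functions of the rows and columns act on those by
   translation, which gains the inverse of the number of levels, resp. labels,
   per vertex.  The definition of zeta then makes the edge families of size 2 l
   contribute at most K^-2 zeta^l for l > 1, and nothing for l = 1. *)
Require Import Defs.
From HB Require Import structures.
From mathcomp Require Import all_boot all_order all_algebra.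
From mathcomp Require Import ring lra zify.
From mathcomp Require Import boolp.

Set Implicit Arguments.
Unset Strict Implicit.
Unset Printing Implicit Defensive.

Import Order.TTheory GRing.Theory Num.Theory.

Local Open Scope ring_scope.

(** * Matchings and counting *)

(** Multi-indices are traded for families of edges indexed by a finite type. Binomial coefficients
    then count subfamilies, the recursion for the cumulants becomes a sum over subsets, and the sum
    of kap_a^2 / a! in degree L becomes 1 / L! times a sum over L-tuples of edges, whose rows and
    columns are enumerated separately.

    The obstacle is that absolute values in the unfolded recursion lose all cancellations; the price
    is a power of the number of levels N = 2 l + 1. Connectedness keeps it down to N^(y + 1), where
    y = 2 l - m - r for a family with m rows and r columns.

    The exponent 7 in zeta is 2 + 3 + 2: per unit of y, the squared cumulant costs D^2 for the
    matchings, D^3 for the levels, since (D + 1)^2 <= D^3, and D^2 for the weights used to enumerate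
    tuples. The rows i1 and i2 are prescribed, so only m - 2 rows cost a factor n; this frees D^14,
    which pays for all that is left over. *)

Fixpoint gauss_moment (n : nat) : nat :=
  match n with
  | 0 => 1
  | 1 => 0
  | m.+2 => m.+1 * gauss_moment m
  end.

Lemma gauss_momentS n : gauss_moment n.+1 = (n * gauss_moment n.-1)%N.
Proof. by case: n. Qed.

Section Matchings.
Variables (A : finType).

Definition fiber (S : {set A}) (Q : eqType) (f : A -> Q) (q : Q) : {set A} :=
  [set s in S | f s == q].

(** As [gauss_moment n] is both the n-th moment of a standard Gaussian and the number of perfect
    matchings of n points, this is the moment of a product of independent Gaussians, one per value
    of [f], and the number of perfect matchings of [S] inside the fibres of [f]. *)
Definition fiber_moment (S : {set A}) (Q : finType) (f : A -> Q) : nat :=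
  \prod_q gauss_moment #|fiber S f q|.

Definition matching (S : {set A}) (J : eqType) (v : A -> J) (f : A -> A) :=
  forall s, s \in S -> [/\ f s \in S, v (f s) = v s, f (f s) = s & f s != s].

Lemma fiber_moment0 (Q : finType) (f : A -> Q) : fiber_moment set0 f = 1%N.
Proof.
rewrite /fiber_moment big1// => q _; rewrite (_ : fiber _ _ _ = set0) ?cards0//.
by apply/setP => s; rewrite !inE.
Qed.

(** The index [t] is the partner of [s0]; what remains is matched freely. *)
Lemma fiber_moment_rec (Q : finType) (f : A -> Q) (S : {set A}) s0 : s0 \in S ->
  fiber_moment S f =
  (\sum_(t in S :\ s0 | f t == f s0) fiber_moment (S :\ s0 :\ t) f)%N.
Proof.
move=> s0S.
pose rest := (\prod_(q | q != f s0) gauss_moment #|fiber S f q|)%N.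
set m := #|fiber (S :\ s0) f (f s0)|.
have cS : #|fiber S f (f s0)| = m.+1.
  rewrite (cardsD1 s0) inE s0S eqxx /= add1n; congr _.+1.
  by apply: eq_card => s; rewrite !inE andbA.
transitivity (m * (gauss_moment m.-1 * rest))%N.
  by rewrite /fiber_moment (bigD1 (f s0))//= cS gauss_momentS mulnA.
rewrite (eq_bigr (fun=> gauss_moment m.-1 * rest)%N); last first.
  move=> t /andP[tS /eqP ft]; rewrite /fiber_moment (bigD1 (f s0))//=.
  congr (gauss_moment _ * _)%N.
    move: tS; rewrite !inE => /andP[ts0 tS].
    rewrite /m [in RHS](cardsD1 t) !inE ts0 tS ft eqxx add1n /=.
    by apply: eq_card => s; rewrite !inE -!andbA.
  apply: eq_bigr => q qs0; congr gauss_moment; apply: eq_card => s; rewrite !inE.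
  have qs0' : (f s0 == q) = false by rewrite eq_sym (negbTE qs0).
  case: eqP => [->|_] /=; first by rewrite ft qs0' !andbF.
  by case: eqP => [->|_] //=; rewrite qs0' !andbF.
rewrite sum_nat_const; congr (_ * _)%N; rewrite /m.
by apply: eq_card => s; rewrite inE [RHS]unfold_in inE.
Qed.

(* Wick: the moment counts the matchings inside the fibres, and it is enough
   to bound the sum of h for each matching of the fibres of v separately. *)
Lemma fiber_moment_sum_le (R : realDomainType) (Om J C : finType)
    (v : A -> J) (c : Om -> A -> C) (S : {set A}) (h : Om -> R) (B : R) :
  (forall f, matching S v f ->
     \sum_(w | [forall s in S, c w (f s) == c w s]) h w <= B) ->
  \sum_w h w * (fiber_moment S (fun s => (c w s, v s)))%:R <=
  (fiber_moment S v)%:R * B.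
Proof.
have [n] := ubnP #|S|; elim: n S h => // n IH S h ltn HB.
have [S0|/set0Pn [s0 s0S]] := eqVneq S set0.
  (* On the empty family any map is a matching, here the identity, and the constraint on [w] is
     void. *)
  have := HB id; rewrite S0 fiber_moment0 mul1r => /(_ _) h0.
  under eq_bigr do rewrite fiber_moment0 mulr1.
  rewrite (eq_bigl (fun w => [forall s in S, c w (id s) == c w s])).
    by rewrite S0; apply: h0 => s; rewrite inE.
  by move=> w; apply/esym/forallP => s; rewrite eqxx implybT.
have step w : (fiber_moment S (fun s => (c w s, v s)))%:R =
    \sum_(t in S :\ s0 | v t == v s0)
     ((c w t == c w s0)%:R * (fiber_moment (S :\ s0 :\ t) (fun s => (c w s, v s)))%:R) :> R.
  rewrite (fiber_moment_rec _ s0S) natr_sum.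
  rewrite [LHS](eq_bigl (fun t => (t \in S :\ s0) && (v t == v s0) && (c w t == c w s0))).
    rewrite [LHS]big_mkcondr; apply: eq_bigr => t _.
    by case: eqP; rewrite ?mul1r ?mul0r.
  by move=> t; rewrite xpair_eqE -andbA [(c w t == _) && _]andbC.
under eq_bigr do rewrite step mulr_sumr.
rewrite exchange_big /= (fiber_moment_rec v s0S) natr_sum mulr_suml.
apply: ler_sum => t /andP[tS /eqP vt].
under eq_bigr do rewrite mulrA.
have {tS}[ts0 tS] : t != s0 /\ t \in S by move: tS; rewrite !inE => /andP[].
apply: IH => [|f mf].
  move: ltn; rewrite (cardsD1 s0) s0S (cardsD1 t) !inE ts0 tS /=; lia.
(* The pair [s0], [t] extends a matching of the rest. The condition that [c w] agrees on the two has
   become part of the weight given to the induction hypothesis. *)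
pose g s := if s == s0 then t else if s == t then s0 else f s.
have mg : matching S v g.
  move=> s sS; rewrite /g; have [->|ss0] := eqVneq s s0.
    by rewrite (negbTE ts0) eqxx.
  have [->|st] := eqVneq s t; first by rewrite eqxx eq_sym.
  have [] := mf s; first by rewrite !inE st ss0.
  rewrite !inE => /andP[ft /andP[fs0 fS]] vf ff fs.
  by rewrite (negbTE ft) (negbTE fs0).
apply: le_trans (HB g mg); rewrite big_mkcond [leRHS]big_mkcond/=.
rewrite le_eqVlt; apply/orP; left; apply/eqP/eq_bigr => w _.
have [ct|ct] := eqVneq (c w t) (c w s0); last first.
  rewrite mulr0 if_same; case: ifP => // /'forall_in_eqP /(_ s0).
  by rewrite /g eqxx => /(_ s0S) e; rewrite e eqxx in ct.
rewrite mulr1; congr (if _ then _ else _).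
apply/'forall_in_eqP/'forall_in_eqP => H s.
  move=> sS; rewrite /g; have [->//|ss0] := eqVneq s s0.
  by have [->//|st] := eqVneq s t; apply: H; rewrite !inE st ss0.
rewrite !inE => /andP[st /andP[ss0 sS]].
by have := H s sS; rewrite /g (negbTE st) (negbTE ss0).
Qed.

End Matchings.

(** * Connected edge families and counting by translations *)

Section Connectivity.
Variables (A Rw Cl : finType) (u : A -> Rw) (v : A -> Cl) (i1 i2 : Rw).

(* Both rows lie in one connected component of the bipartite graph with edges
   [u s -- v s], and this component contains every edge. *)
Definition linked := forall (Rs : {set Rw}) (Cs : {set Cl}),
  (forall s, (u s \in Rs) = (v s \in Cs)) -> i1 \in Rs ->
  i2 \in Rs /\ forall s, u s \in Rs.

Hypothesis lk : linked.

(** The level sets of [f] and [h] at the value [f i1] are closed under the edges and contain [i1],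
    hence everything that an edge meets. *)
Lemma linked_const (X : eqType) (f : Rw -> X) (h : Cl -> X) :
  (forall s, f (u s) = h (v s)) -> forall s, f (u s) = f i1 /\ h (v s) = f i1.
Proof.
move=> fh s; have [|//|_ H] := lk (Rs := [set r | f r == f i1]) (Cs := [set c | h c == f i1]).
- by move=> t; rewrite !inE fh.
- by rewrite inE.
- by have := H s; rewrite inE => /eqP e; rewrite -fh.
Qed.

(** One edge is picked from each pair, the one enumerated first. Data that are constant along the
    matching are determined by their values on this half, which is how a matching saves half of the
    degrees of freedom. *)
Lemma matching_half (J : eqType) (w : A -> J) (f : A -> A) :
  matching [set: A] w f -> exists Q : {set A},
  (#|Q| = #|A| %/ 2)%N /\ forall s, s \in Q \/ f s \in Q.
Proof.
move=> mf; have ff s : f (f s) = s by have [] := mf s (in_setT s).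
have fs s : f s != s by have [] := mf s (in_setT s).
pose Q := [set s | (enum_rank s < enum_rank (f s))%N].
have QC s : (f s \in Q) = (s \notin Q).
  rewrite !inE ff -leqNgt [RHS]leq_eqVlt; case: eqP => //= e0.
  have e := enum_rank_inj (ord_inj e0).
  by have := fs s; rewrite e eqxx.
exists Q; split; last by move=> s; rewrite QC; case: (s \in Q); [left|right].
have -> : #|A| = (#|Q| + #|Q|)%N.
  rewrite -(cardsC Q); congr (_ + _)%N.
  rewrite -(card_imset Q (can_inj ff)); apply: eq_card => s.
  rewrite inE -QC; apply/idP/imsetP => [h|[t tQ ->]]; last by rewrite ff.
  by exists (f s); rewrite ?ff.
by lia.
Qed.

Variable Z : finZmodType.

(** Functions on the vertices met by an edge, or on half of the edges, are represented by functions
    on the whole type that vanish elsewhere. This avoids subtypes and keeps the count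
    [#|Z| ^ #|Q|]. *)
Let supp (X : finType) (Q : {set X}) : {set {ffun X -> Z}} :=
  [set f | f \in pffun_on 0 Q predT].

Let card_supp (X : finType) (Q : {set X}) : #|supp Q| = (#|Z| ^ #|Q|)%N.
Proof. by rewrite cardsE card_pffun_on. Qed.

Let suppP (X : finType) (Q : {set X}) (f : {ffun X -> Z}) :
  reflect (forall x, x \notin Q -> f x = 0) (f \in supp Q).
Proof.
rewrite inE; apply: (iffP pffun_onP) => [[/supportP H _] //|H].
by split => //; exact/supportP.
Qed.

Let cut (Q : {set A}) (g : A -> Z) : {ffun A -> Z} :=
  [ffun s => if s \in Q then g s else 0].

Let cutP (Q : {set A}) (g : A -> Z) : cut Q g \in supp Q.
Proof. by apply/suppP => s sQ; rewrite ffunE (negbTE sQ). Qed.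

Let card_le (X Y : finType) (D : {set X}) (E : {set Y}) (g : X -> Y) :
  {in D &, injective g} -> (forall x, x \in D -> g x \in E) -> (#|D| <= #|E|)%N.
Proof.
move=> gi gE; rewrite -(card_in_imset gi); apply/subset_leq_card/subsetP.
by move=> _ /imsetP[x xD ->]; exact: gE.
Qed.

(** Both differences equal one constant on the vertices met by an edge, and this constant is zero at
    [i1]; the supports settle the other vertices. Recording the value at [i1] costs the single extra
    factor [#|Z|] in the counts below. *)
Lemma linked_zero (f f' : {ffun Rw -> Z}) (h h' : {ffun Cl -> Z}) :
  f \in supp (u @: A) -> f' \in supp (u @: A) ->
  h \in supp (v @: A) -> h' \in supp (v @: A) -> f i1 = f' i1 ->
  (forall s, f (u s) - f' (u s) = h (v s) - h' (v s)) -> f = f' /\ h = h'.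
Proof.
move=> /suppP sf /suppP sf' /suppP sh /suppP sh' e H.
have C := linked_const (f := fun r => f r - f' r) (h := fun c => h c - h' c) H.
split; apply/ffunP => x.
  have [/imsetP[s _ ->]|xu] := boolP (x \in u @: A); last by rewrite sf ?sf'.
  by apply/eqP; rewrite -subr_eq0 (C s).1 e subrr.
have [/imsetP[s _ ->]|xu] := boolP (x \in v @: A); last by rewrite sh ?sh'.
by apply/eqP; rewrite -subr_eq0 (C s).2 e subrr.
Qed.

Let sub_swap (x a y b : Z) : x - a = y - b -> a - b = x - y.
Proof.
move=> e; have -> : x = a + (y - b) by rewrite -e addrC subrK.
by rewrite -addrA [y - b - y]addrC addKr.
Qed.

(* (L, a, b) is determined by a i1, by L - a \o u on half of the edges and by
   L - b \o v on half of the edges. *)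
Lemma card_levels_le (f g : A -> A) :
  matching [set: A] v f -> matching [set: A] u g ->
  (#|[set L : {ffun A -> Z} | [forall s, (L (f s) == L s) && (L (g s) == L s)]]| *
   #|Z| ^ (#|u @: A| + #|v @: A|) <= #|Z| * #|Z| ^ (#|A| %/ 2 * 2))%N.
Proof.
move=> mf mg; have [Qf [cf Hf]] := matching_half mf; have [Qg [cg Hg]] := matching_half mg.
set Lev := [set L : {ffun A -> Z} | _].
have LevP L s : L \in Lev -> L (f s) = L s /\ L (g s) = L s.
  by rewrite inE => /forallP/(_ s)/andP[/eqP ? /eqP ?].
have vf s : v (f s) = v s by have [] := mf s (in_setT s).
have ug s : u (g s) = u s by have [] := mg s (in_setT s).
pose Phi (x : {ffun A -> Z} * ({ffun Rw -> Z} * {ffun Cl -> Z})) :=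
  (x.2.1 i1, (cut Qg (fun s => x.1 s - x.2.1 (u s)), cut Qf (fun s => x.1 s - x.2.2 (v s)))).
have := @card_le _ _ (setX Lev (setX (supp (u @: A)) (supp (v @: A))))
  (setX [set: Z] (setX (supp Qg) (supp Qf))) Phi.
rewrite !cardsX !card_supp cardsT cf cg expnD muln2 -addnn expnD; apply; last first.
  by move=> x _; rewrite !in_setX in_setT !cutP.
move=> [L [a b]] [L' [a' b']]; rewrite !in_setX /=.
move=> /and3P[LL sa sb] /and3P[LL' sa' sb'] [] e1 /ffunP e2 /ffunP e3.
(* Neither the level nor the row changes along [g], so equality on half of the edges spreads to all
   of them. *)
have Ha s : L s - a (u s) = L' s - a' (u s).
  have aux t : t \in Qg -> L t - a (u t) = L' t - a' (u t).
    by move=> tQ; have := e2 t; rewrite !ffunE tQ.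
  have [/aux//|/aux] := Hg s.
  by rewrite (LevP L s LL).2 (LevP L' s LL').2 ug.
have Hb s : L s - b (v s) = L' s - b' (v s).
  have aux t : t \in Qf -> L t - b (v t) = L' t - b' (v t).
    by move=> tQ; have := e3 t; rewrite !ffunE tQ.
  have [/aux//|/aux] := Hf s.
  by rewrite (LevP L s LL).1 (LevP L' s LL').1 vf.
have [|ea eb] := linked_zero sa sa' sb sb' e1.
  by move=> s; rewrite (sub_swap (Ha s)) (sub_swap (Hb s)).
rewrite ea eb; congr (_, _); apply/ffunP => s.
by apply: (addIr (- a' (u s))); rewrite -Ha ea.
Qed.

(** The triple (k, a, b) is determined by [a i1], by the colouring [k - a], and by
    [k (L s) (u s) - b (v s)] on half of the edges. Since [a] is subtracted at every level, it is
    absorbed in a free colouring, and only the columns call for a matching. *)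
Lemma card_colourings_le (Lv : finType) (L : A -> Lv) (f : A -> A) :
  matching [set: A] v f -> (forall s, L (f s) = L s) ->
  (#|[set k : {ffun Lv -> {ffun Rw -> Z}} |
       [forall s, k (L s) (u (f s)) == k (L s) (u s)]]| *
   #|Z| ^ (#|u @: A| + #|v @: A|) <=
   #|Z| * ((#|Z| ^ #|Rw|) ^ #|Lv| * #|Z| ^ (#|A| %/ 2)))%N.
Proof.
move=> mf Lf; have [Q [cQ HQ]] := matching_half mf.
set Col := [set k : {ffun Lv -> {ffun Rw -> Z}} | _].
have ColP k s : k \in Col -> k (L s) (u (f s)) = k (L s) (u s).
  by rewrite inE => /forallP/(_ s)/eqP.
have vf s : v (f s) = v s by have [] := mf s (in_setT s).
pose Phi (x : {ffun Lv -> {ffun Rw -> Z}} * ({ffun Rw -> Z} * {ffun Cl -> Z})) :=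
  (x.2.1 i1, ([ffun i => [ffun r => x.1 i r - x.2.1 r]],
              cut Q (fun s => x.1 (L s) (u s) - x.2.2 (v s)))).
have := @card_le _ _ (setX Col (setX (supp (u @: A)) (supp (v @: A))))
  (setX [set: Z] (setX [set: {ffun Lv -> {ffun Rw -> Z}}] (supp Q))) Phi.
rewrite !cardsX !card_supp !cardsT !card_ffun cQ expnD; apply; last first.
  by move=> x _; rewrite !in_setX !in_setT cutP.
move=> [k [a b]] [k' [a' b']]; rewrite !in_setX /=.
move=> /and3P[kk sa sb] /and3P[kk' sa' sb'] [] e1 /ffunP e2 /ffunP e3.
have Ha i r : k i r - a r = k' i r - a' r.
  by have /ffunP/(_ r) := e2 i; rewrite !ffunE.
have Hb s : k (L s) (u s) - b (v s) = k' (L s) (u s) - b' (v s).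
  have aux t : t \in Q -> k (L t) (u t) - b (v t) = k' (L t) (u t) - b' (v t).
    by move=> tQ; have := e3 t; rewrite !ffunE tQ.
  have [/aux//|/aux] := HQ s.
  by rewrite Lf vf (ColP _ _ kk) (ColP _ _ kk').
have [|ea eb] := linked_zero sa sa' sb sb' e1.
  by move=> s; rewrite (sub_swap (Ha (L s) (u s))) (sub_swap (Hb s)).
rewrite ea eb; congr (_, _); apply/ffunP => i; apply/ffunP => r.
by apply: (addIr (- a' r)); rewrite -Ha ea.
Qed.

End Connectivity.

(** * Multi-indices and cumulants *)

Section FiniteSums.
Variable R : numDomainType.

Lemma sum_image_le (X Y : finType) (P : pred X) (Q : pred Y) (g : X -> Y) (F : Y -> R) :
  {in P &, injective g} -> (forall x, P x -> Q (g x)) -> (forall y, Q y -> 0 <= F y) ->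
  \sum_(x | P x) F (g x) <= \sum_(y | Q y) F y.
Proof.
move=> gi PQ F0.
have gi' : {in [set x | P x] &, injective g}.
  by move=> x y; rewrite !inE; exact: gi.
rewrite (eq_bigl (fun x => x \in [set x | P x])); last by move=> x; rewrite inE.
rewrite -(big_imset F gi') /= [leRHS](bigID (mem (g @: [set x | P x]))) /=.
rewrite (eq_bigl (fun y => Q y && (y \in g @: [set x | P x]))).
  by rewrite lerDl sumr_ge0// => y /andP[/F0].
move=> y; case: imsetP => [[x]|]; rewrite ?andbF//.
by rewrite inE => /PQ Qx ->; rewrite Qx.
Qed.

Lemma sum_cover_le (X Y : finType) (P : pred X) (Q : pred Y) (g : X -> Y) (F : Y -> R) :
  (forall y, Q y -> exists2 x, P x & g x = y) -> (forall x, P x -> 0 <= F (g x)) ->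
  \sum_(y | Q y) F y <= \sum_(x | P x) F (g x).
Proof.
move=> cov F0.
have [f fP] : exists f : Y -> option X, forall y, Q y -> exists x, [/\ f y = Some x, P x & g x = y].
  exists (fun y => [pick x | P x && (g x == y)]) => y /cov [x Px gx].
  case: pickP => [x' /andP[Px' /eqP gx']|/(_ x)]; first by exists x'.
  by rewrite Px gx eqxx.
rewrite [leRHS](eq_bigl (fun x => x \in [set x | P x])); last by move=> x; rewrite inE.
rewrite (partition_big_imset g) /=.
apply: (@le_trans _ _ (\sum_(y in g @: [set x | P x]) F y)).
  rewrite (eq_bigl (fun y => (y \in g @: [set x | P x]) && Q y)).
    rewrite big_mkcondr; apply: ler_sum => y /imsetP[x].
    by rewrite inE => Px ->; case: ifP => // _; exact: F0.
  move=> y; rewrite andbC; case Qy: (Q y) => //=.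
  have [x [_ Px gx]] := fP y Qy; apply/esym/imsetP; exists x => //.
  by rewrite inE.
apply: ler_sum => y /imsetP[x]; rewrite inE => Px ->.
rewrite (bigD1 x) ?inE ?Px ?eqxx//= lerDl sumr_ge0// => x' /andP[].
by rewrite inE => /andP[/F0].
Qed.

End FiniteSums.

Lemma sum_powersetD1 (R : nmodType) (A : finType) (S : {set A}) s0 (F : {set A} -> R) :
  s0 \in S ->
  \sum_(T : {set A} | T \subset S) F T =
  \sum_(T : {set A} | T \subset S :\ s0) (F T + F (s0 |: T)).
Proof.
move=> s0S; rewrite big_split /= (bigID (fun T : {set A} => s0 \in T)) /= addrC.
congr (_ + _).
  apply: eq_bigl => T; rewrite subsetD1 //.
rewrite (reindex_onto (fun T => s0 |: T) (fun T => T :\ s0)) /=; last first.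
  by move=> T /andP[_ h]; rewrite setD1K.
apply: eq_bigl => T; rewrite subUset sub1set s0S setU11 /= andbT subsetD1.
congr (_ && _); apply/eqP/idP => [<-|h]; last by rewrite setU1K.
by rewrite !inE eqxx.
Qed.

Section Counts.
Variables (A I : finType) (e : A -> I).

Definition counts (S : {set A}) : {ffun I -> nat} := [ffun i => #|fiber S e i|].

Lemma card_fiberD1 (S : {set A}) s0 i : s0 \in S ->
  #|fiber S e i| = ((e s0 == i) + #|fiber (S :\ s0) e i|)%N.
Proof.
move=> s0S; rewrite (cardsD1 s0) !inE s0S /=; congr (_ + _)%N.
by apply: eq_card => s; rewrite !inE andbA.
Qed.

Lemma card_fiberU1 (S : {set A}) s0 i : s0 \notin S ->
  #|fiber (s0 |: S) e i| = ((e s0 == i) + #|fiber S e i|)%N.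
Proof. by move=> s0S; rewrite (card_fiberD1 _ (setU11 s0 S)) setU1K. Qed.

Lemma sum_card_fiber (S : {set A}) : (\sum_i #|fiber S e i| = #|S|)%N.
Proof.
rewrite -sum1_card (partition_big e xpredT) //=; apply: eq_bigr => i _.
by rewrite -sum1_card; apply: eq_bigl => s; rewrite inE.
Qed.

Lemma countsB (S T : {set A}) i : T \subset S ->
  counts (S :\: T) i = (counts S i - counts T i)%N.
Proof.
move=> TS; rewrite !ffunE; have -> : fiber (S :\: T) e i = fiber S e i :\: fiber T e i.
  by apply/setP => s; rewrite !inE; case: (e s == i); rewrite ?andbF ?andbT.
rewrite cardsD; congr (_ - #|_ : {set _}|)%N; apply/setIidPr.
by apply/subsetP => s; rewrite !inE => /andP[/(subsetP TS) -> ->].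
Qed.

(** Pascal's rule at the entry [e s0], according to whether a subset contains [s0]. This is what
    makes the binomial coefficients of multi-indices a count of subfamilies. *)
Lemma card_subsets_counts (S : {set A}) (b : I -> nat) :
  #|[set T : {set A} | (T \subset S) && [forall i, counts T i == b i]]| =
  (\prod_i 'C(counts S i, b i))%N.
Proof.
have [n] := ubnP #|S|; elim: n S b => // n IH S b ltn.
have [S0|/set0Pn [s0 s0S]] := eqVneq S set0.
  have c0 i : counts S i = 0%N.
    rewrite ffunE S0; apply/eqP; rewrite cards_eq0; apply/eqP/setP => s.
    by rewrite !inE.
  have [/forallP b0|/forallPn [i bi]] := boolP [forall i, b i == 0%N].
    rewrite big1; last by move=> i _; rewrite c0 (eqP (b0 i)).
    rewrite (_ : [set _ | _] = [set set0]) ?cards1//.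
    apply/setP => T; rewrite !inE S0 subset0; case: eqP => //= ->.
    by apply/forallP => i; rewrite -S0 c0 eq_sym b0.
  rewrite (bigD1 i)//= c0 bin0n (negbTE bi) mul0n; apply/eqP; rewrite cards_eq0.
  apply/eqP/setP => T; rewrite !inE S0 subset0; case: eqP => //= ->.
  by apply/negP => /forallP/(_ i); rewrite -S0 c0 eq_sym (negbTE bi).
rewrite -sum1dep_card big_mkcondr (sum_powersetD1 _ s0S).
(* If [b i0] is zero the subtraction is truncated; the factor [0 < b i0] below removes that case. *)
set i0 := e s0; pose b' i := (b i - (i0 == i))%N.
have lt' : (#|S :\ s0| < n)%N by move: ltn; rewrite (cardsD1 s0) s0S.
rewrite big_split /= -!big_mkcondr !sum1dep_card (IH _ b lt').
have e2 : #|[set T : {set A} | (T \subset S :\ s0) && [forall i, counts (s0 |: T) i == b i]]|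
   = ((0 < b i0) * \prod_i 'C(counts (S :\ s0) i, b' i))%N.
  rewrite -(IH _ b' lt'); have [b0|b0] := ltnP 0 (b i0); last first.
    rewrite mul0n; apply/eqP; rewrite cards_eq0; apply/eqP/setP => T; rewrite !inE.
    case: (boolP (T \subset _)) => //; rewrite subsetD1 => /andP[_ sT].
    apply/negP => /forallP/(_ i0); rewrite !ffunE card_fiberU1// eqxx.
    by move: b0; case: (b i0).
  rewrite mul1n; apply: eq_card => T; rewrite !inE.
  case: (boolP (T \subset _)) => //; rewrite subsetD1 => /andP[_ sT] /=.
  apply: eq_forallb => i; rewrite !ffunE card_fiberU1// /b' -/i0.
  case: (eqVneq i0 i) => [ii|]; last by rewrite add0n subn0.
  by move: b0; rewrite ii; case: (b i) => // m _; rewrite add1n subn1 eqSS.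
rewrite e2 (bigD1 i0)//= (bigD1 i0 (P := xpredT))//= [RHS](bigD1 i0)//=.
have rest (c : I -> nat) : (forall i, i != i0 -> c i = b i) ->
    (\prod_(i | i != i0) 'C(counts (S :\ s0) i, c i) =
     \prod_(i | i != i0) 'C(counts S i, b i))%N.
  move=> cb; apply: eq_bigr => i ii0; rewrite cb// !ffunE (card_fiberD1 _ s0S) -/i0.
  by rewrite eq_sym (negbTE ii0).
rewrite rest// (rest b'); last by move=> i ii0; rewrite /b' eq_sym (negbTE ii0) subn0.
rewrite (mulnA (0 < b i0)%N); etransitivity; first by apply: esym; exact: mulnDl.
congr (_ * _)%N.
rewrite [in RHS]ffunE (card_fiberD1 _ s0S) -/i0 eqxx add1n /b' eqxx ffunE.
by case: (b i0) => [|m]; rewrite ?bin0 ?mul0n//= mul1n subn1 binS.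
Qed.

End Counts.

Section MultiIndices.
Variables (I : finType) (D : nat).

(** Sums over multi-indices range over a finite type with coordinates at most [D], which contains
    all those of total degree at most [D]; cumulants remain functions of unbounded multi-indices. *)
Definition mi_val (b : {ffun I -> 'I_D.+1}) : {ffun I -> nat} := [ffun i => b i : nat].

Lemma mi_val_inj : injective mi_val.
Proof.
move=> b c /ffunP bc; apply/ffunP => i; apply/val_inj.
by have := bc i; rewrite !ffunE.
Qed.

Definition mi_of (a : {ffun I -> nat}) : {ffun I -> 'I_D.+1} := [ffun i => inord (a i)].

Lemma mi_ofK (a : {ffun I -> nat}) : (forall i, (a i <= D)%N) -> mi_val (mi_of a) = a.
Proof. by move=> aD; apply/ffunP => i; rewrite !ffunE inordK ?ltnS. Qed.

Lemma sum_leq_coord (a : {ffun I -> nat}) n : (\sum_i a i <= n)%N -> forall i, (a i <= n)%N.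
Proof. by move=> an i; apply: leq_trans an; rewrite (bigD1 i)//= leq_addr. Qed.

Lemma sum_subsets_counts (R : nzRingType) (A : finType) (e : A -> I) (S : {set A})
    (phi : {ffun I -> nat} -> R) : (#|S| <= D)%N ->
  \sum_(T : {set A} | T \subset S) phi (counts e T) =
  \sum_(b : {ffun I -> 'I_D.+1}) (\prod_i 'C(counts e S i, b i))%:R * phi (mi_val b).
Proof.
move=> SD; have cle (T : {set A}) : T \subset S -> forall i, (counts e T i <= D)%N.
  move=> TS; apply: sum_leq_coord; apply: leq_trans SD.
  under eq_bigr do rewrite ffunE.
  by rewrite sum_card_fiber subset_leq_card.
rewrite (partition_big (fun T => mi_of (counts e T)) xpredT) //=.
apply: eq_bigr => b _; rewrite -card_subsets_counts.
rewrite (eq_bigl (fun T => T \in [set T : {set A} | (T \subset S) && [forall i, counts e T i == b i]])).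
  rewrite (eq_bigr (fun=> phi (mi_val b))) ?sumr_const ?mulr_natl// => T.
  rewrite inE => /andP[_ /forallP Tb]; congr phi; apply/ffunP => i.
  by rewrite [RHS]ffunE; exact/eqP.
move=> T; rewrite inE; case: (boolP (T \subset S)) => //= TS.
apply/eqP/forallP => [<- i|Tb].
  by rewrite [in eqbRHS]ffunE inordK ?ltnS ?cle.
apply: mi_val_inj; rewrite mi_ofK; last exact: cle.
by apply/ffunP => i; rewrite [RHS]ffunE; exact/eqP.
Qed.

Lemma counts_tnth L (t : L.-tuple I) i : counts (tnth t) [set: 'I_L] i = count_mem i t.
Proof.
rewrite ffunE -sum1_card -sum1_count big_tuple; apply: eq_bigl => s.
by rewrite !inE.
Qed.

(** The multinomial coefficient, by induction: removing the first entry [i] of a tuple lowers [b i]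
    by one. *)
Lemma card_tuples_counts L (b : I -> nat) : (\sum_i b i = L)%N ->
  (#|[set t : L.-tuple I | [forall i, count_mem i t == b i]]| * \prod_i (b i)`! = L`!)%N.
Proof.
elim: L b => [|L IH] b bL.
  have b0 i : b i = 0%N by move/eqP: bL; rewrite sum_nat_eq0 => /forallP/(_ i)/eqP.
  rewrite big1 => [|i _]; last by rewrite b0.
  rewrite muln1 (_ : [set _ | _] = [set: 0.-tuple I]) ?cardsT ?card_tuple//.
  by apply/setP => t; rewrite !inE tuple0; apply/forallP => i; rewrite b0.
pose b' i j := (b j - (i == j))%N.
have cE : #|[set t : L.+1.-tuple I | [forall i, count_mem i t == b i]]| =
   (\sum_i (0 < b i) * #|[set t : L.-tuple I | [forall j, count_mem j t == b' i j]]|)%N.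
  rewrite -sum1_card (partition_big (fun t => thead t) xpredT) //=.
  apply: eq_bigr => i _; rewrite sum1dep_card.
  have [bi|bi] := ltnP 0 (b i); last first.
    rewrite mul0n; apply/eqP; rewrite cards_eq0; apply/eqP/setP => t; rewrite !inE.
    apply/negP => /andP[/forallP/(_ i) + /eqP ti].
    by rewrite (tuple_eta t) ti /= eqxx; move: bi; case: (b i).
  rewrite mul1n -(card_imset _ (f := fun t : L.-tuple I => [tuple of i :: t])); last first.
    by move=> t t' /(congr1 val) [] /val_inj.
  apply: eq_card => t; rewrite inE; apply/idP/imsetP.
    move=> /andP[]; rewrite inE => /forallP tb /eqP ti; exists [tuple of behead t].
      rewrite inE; apply/forallP => j; have := tb j; rewrite {1}(tuple_eta t) ti /= /b'.
      case: (eqVneq i j) => [<-|]; last by rewrite add0n subn0.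
      by move: bi; case: (b i) => // m _; rewrite add1n subn1 eqSS.
    by rewrite {1}(tuple_eta t) ti.
  move=> [t' + ->]; rewrite !inE theadE eqxx andbT => /forallP tb; apply/forallP => j /=.
  rewrite (eqP (tb j)) /b'.
  case: (eqVneq i j) => [<-|]; last by rewrite add0n subn0.
  by rewrite add1n subn1 prednK.
rewrite cE big_distrl /= factS -bL big_distrl /=; apply: eq_bigr => i _.
have [bi|bi] := ltnP 0 (b i); last by move: bi; case: (b i).
rewrite mul1n -(IH (b' i)); last first.
  apply/eqP; rewrite -eqSS -bL (bigD1 i)//= [in eqbRHS](bigD1 i)//= /b' eqxx subn1.
  rewrite -addSn prednK// eqn_add2l; apply/eqP/eq_bigr => j ji.
  by rewrite eq_sym (negbTE ji) subn0.
rewrite mulnCA; congr (_ * _)%N.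
rewrite (bigD1 i)//= [in RHS](bigD1 i)//= mulnA /b' eqxx subn1; congr (_ * _)%N.
  by move: bi; case: (b i).
by apply: eq_bigr => j ji; rewrite eq_sym (negbTE ji) subn0.
Qed.

(** A multi-index a of degree L is realised by L! / a! tuples, so the weights 1 / a! turn into a
    uniform weight on ordered families. *)
Lemma sum_tuples_counts (R : numFieldType) L (F : {ffun I -> nat} -> R) : (L <= D)%N ->
  \sum_(b : {ffun I -> 'I_D.+1} | (\sum_i b i == L)%N) F (mi_val b) / (\prod_i (b i)`!)%:R =
  (L`!)%:R^-1 * \sum_(t : L.-tuple I) F (counts (tnth t) [set: 'I_L]).
Proof.
move=> LD; have cle (t : L.-tuple I) i : (counts (tnth t) [set: 'I_L] i <= D)%N.
  by rewrite counts_tnth (leq_trans (count_size _ _))// size_tuple.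
rewrite (partition_big (fun t => mi_of (counts (tnth t) [set: 'I_L]))
  (fun b : {ffun I -> 'I_D.+1} => (\sum_i b i == L)%N)) /=; last first.
  move=> t _; rewrite -[X in _ == X](size_tuple t) -sum1_size [eqbRHS](partition_big id xpredT)//=.
  apply/eqP/eq_bigr => i _; rewrite ffunE inordK ?ltnS// counts_tnth -sum1_count.
  by apply: eq_bigl.
rewrite mulr_sumr; apply: eq_bigr => b /eqP bL.
rewrite (eq_bigl (fun t => t \in [set t : L.-tuple I | [forall i, count_mem i t == b i]])).
  rewrite (eq_bigr (fun=> F (mi_val b))); last first.
    move=> t; rewrite inE => /forallP tb; congr F; apply/ffunP => i.
    by rewrite counts_tnth [RHS]ffunE; exact/eqP.
  rewrite sumr_const -[F _ *+ _]mulr_natr mulrCA; congr (_ * _).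
  have e := card_tuples_counts bL; rewrite -e natrM invfM -mulrA mulrCA mulVf ?mulr1//.
  rewrite pnatr_eq0; apply: contraTneq (fact_gt0 L) => c0.
  by rewrite -e c0 mul0n.
move=> t; rewrite inE; apply/eqP/forallP => [<- i|tb].
  by rewrite [in eqbRHS]ffunE inordK ?ltnS// counts_tnth.
apply: mi_val_inj; rewrite mi_ofK//; apply/ffunP => i.
by rewrite counts_tnth [RHS]ffunE; exact/eqP.
Qed.

(** The system is triangular with diagonal coefficient [mom 0 = 1], so it is solved degree by
    degree. *)
Lemma cumulant_exists (R : nzRingType) (mom xmom : {ffun I -> nat} -> R) :
  mom [ffun=> 0%N] = 1 ->
  exists kap : {ffun I -> nat} -> R, forall a : {ffun I -> nat}, (\sum_i a i <= D)%N ->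
    xmom a = \sum_(b : {ffun I -> 'I_D.+1}) (\prod_i 'C(a i, b i))%:R *
      (kap (mi_val b) * mom [ffun i => (a i - b i)%N]).
Proof.
move=> mom0; suff: forall n, (n <= D.+1)%N -> exists kap : {ffun I -> nat} -> R,
    forall a : {ffun I -> nat}, (\sum_i a i < n)%N ->
    xmom a = \sum_(b : {ffun I -> 'I_D.+1}) (\prod_i 'C(a i, b i))%:R *
      (kap (mi_val b) * mom [ffun i => (a i - b i)%N]).
  by move=> /(_ D.+1 (leqnn _)).
elim=> [_|n IH nD]; first by exists (fun=> 0).
have [kap Hk] := IH (ltnW nD).
pose term (kap : {ffun I -> nat} -> R) (a : {ffun I -> nat}) (b : {ffun I -> 'I_D.+1}) :=
  (\prod_i 'C(a i, b i))%:R * (kap (mi_val b) * mom [ffun i => (a i - b i)%N]).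
pose kap' (a : {ffun I -> nat}) := if (\sum_i a i == n)%N then
   xmom a - \sum_(b | mi_val b != a) term kap a b else kap a.
(* A multi-index [b] other than [a] either exceeds [a] somewhere, and then its binomial coefficient
   vanishes, or it has degree below [n], where [kap'] agrees with [kap]. *)
have small (a : {ffun I -> nat}) (b : {ffun I -> 'I_D.+1}) :
    (\sum_i a i <= n)%N -> mi_val b != a -> term kap' a b = term kap a b.
  move=> an ba; rewrite /term; have [/forallP le|/forallPn [i bi]] := boolP [forall i, b i <= a i]%N.
    congr (_ * (_ * _)); rewrite /kap' ifF//; apply/negbTE.
    apply: contraNneq ba => bn; apply/eqP/ffunP => i; rewrite ffunE.
    have : (\sum_j (a j - b j) = 0)%N.
      rewrite sumnB; last by move=> j _; exact: le.
      by move: bn; under eq_bigr do rewrite ffunE; move=> ->; apply/eqP; rewrite subn_eq0.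
    move/eqP; rewrite sum_nat_eq0 => /forallP/(_ i) /=; rewrite subn_eq0 => ab.
    by apply/eqP; rewrite eqn_leq le.
  by rewrite (bigD1 i)//= bin_small ?mul0n ?mul0r// ltnNge.
exists kap' => a; rewrite ltnS => an; rewrite -/(term _ _ _).
have [lt|ge] := ltnP (\sum_i a i)%N n.
  rewrite Hk//; apply: eq_bigr => b _; have [e|ne] := eqVneq (mi_val b) a.
    by rewrite /kap' e ifF// ltn_eqF.
  by rewrite -[RHS]/(term kap' a b) small.
have aN : (\sum_i a i = n)%N by apply/eqP; rewrite eqn_leq an.
have aD i : (a i <= D)%N by apply: sum_leq_coord; rewrite aN -ltnS.
rewrite (bigD1 (mi_of a))//= mi_ofK//.
rewrite (eq_bigl (fun b => mi_val b != a)); last first.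
  by move=> b; rewrite -[in RHS](mi_ofK aD) (inj_eq mi_val_inj).
rewrite [X in _ + X](eq_bigr (term kap a)); last by move=> b ba; rewrite -/(term kap' a b) small.
rewrite big1 => [|i _]; last by rewrite ffunE inordK ?ltnS// binn.
rewrite mul1r (_ : [ffun i => _] = [ffun=> 0%N]).
  by rewrite mom0 mulr1 /kap' aN eqxx subrK.
by apply/ffunP => i; rewrite !ffunE inordK ?ltnS// subnn.
Qed.

End MultiIndices.

(** * Joint cumulants indexed by subfamilies *)

Section SetCumulants.
Variables (R : realDomainType) (A : finType) (a b k : {set A} -> R).
Hypothesis a0 : a set0 = 1.
Hypothesis kE : forall S, b S = \sum_(T : {set A} | T \subset S) k T * a (S :\: T).

(** Joint cumulants vanish across independent groups: by induction, the proper subfamilies of [T]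
    that meet [S1] contribute nothing, while those that avoid [S1] already sum up to [b T]. *)
Lemma cumulant_eq0 (S1 : {set A}) :
  (forall T, a T = a (T :&: S1) * a (T :\: S1)) ->
  (forall T, b T = a (T :&: S1) * b (T :\: S1)) ->
  forall T, T :&: S1 != set0 -> k T = 0.
Proof.
move=> Ha Hb T; have [n] := ubnP #|T|; elim: n T => // n IH T ltn TS.
have := kE T; rewrite (bigD1 T)//= setDv a0 mulr1 => e.
suff e2 : \sum_(T' : {set A} | (T' \subset T) && (T' != T)) k T' * a (T :\: T') = b T.
  by move: e; rewrite e2 => /eqP; rewrite -subr_eq subrr eq_sym => /eqP.
rewrite (bigID (fun T' => T' :&: S1 == set0)) /= addrC big1 ?add0r; last first.
  move=> T' /andP[/andP[TT T'T] T'S]; rewrite IH ?mul0r//.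
  rewrite (leq_trans _ (_ : #|T| <= n)%N)//; apply: proper_card.
  by rewrite properEneq T'T TT.
rewrite Hb kE mulr_sumr; apply: eq_big => T'.
  apply/andP/idP => [[/andP[TT _] TS']|TT].
    by rewrite subsetD TT -setI_eq0.
  move: TT; rewrite subsetD -setI_eq0 => /andP[TT TS'].
  rewrite TT TS'; split=> //; apply: contraNneq TS => <-; exact: TS'.
move=> /andP[/andP[TT _] /eqP TS']; rewrite mulrCA; congr (_ * _); rewrite Ha.
have dis s : s \in T' -> s \notin S1.
  by move=> sT; apply/negP => sS; have /setP/(_ s) := TS'; rewrite !inE sT sS.
congr (a _ * a _); apply/setP => s; rewrite !inE.
  by case: (boolP (s \in T')) => //= /dis /negbTE ->; rewrite andbF.
by rewrite andbCA.
Qed.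

Hypothesis a_ge0 : forall S, 0 <= a S.
Hypothesis b_ge0 : forall S, 0 <= b S.

Let Lv := 'I_#|A|.+1.
Let term (L : {ffun A -> Lv}) (S : {set A}) :=
  b (fiber S L ord0) * \prod_(i | i != ord0) a (fiber S L i).
(** Off [S] the level is pinned to 0, so that each assignment of levels to the edges of [S] is
    counted once. *)
Let valid n (S : {set A}) (L : {ffun A -> Lv}) :=
  [forall s, (L s <= n)%N && ((s \notin S) ==> (L s == ord0))].

Let term_ge0 L S : 0 <= term L S.
Proof. by rewrite mulr_ge0// prodr_ge0. Qed.

Let b_le n S : b S <= \sum_(L | valid n S L) term L S.
Proof.
have v0 : valid n S [ffun=> ord0] by apply/forallP => s; rewrite !ffunE eqxx implybT.
rewrite (bigD1 [ffun=> ord0])//= -[leLHS]addr0 lerD ?sumr_ge0//.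
rewrite /term big1 ?mulr1 => [|i i0].
  by rewrite le_eqVlt; apply/orP; left; apply/eqP; congr b; apply/setP => s; rewrite !inE ffunE eqxx andbT.
rewrite (_ : fiber _ _ _ = set0)//; apply/setP => s.
by rewrite !inE ffunE eq_sym (negbTE i0) andbF.
Qed.

(** The edges of [S :\: T] receive the fresh level [n.+1], which no valid assignment on [T] uses.
    Hence [T] can be read off from the new assignment, distinct pairs give distinct assignments, and
    the remaining terms are nonnegative. *)
Let step n (S : {set A}) : (n < #|A|)%N ->
  \sum_(T : {set A} | T \subset S) (\sum_(L | valid n T L) term L T) * a (S :\: T)
  <= \sum_(L | valid n.+1 S L) term L S.
Proof.
move=> nA; pose top : Lv := inord n.+1.
have topE : top = n.+1 :> nat by rewrite inordK.
pose g (x : {set A} * {ffun A -> Lv}) : {ffun A -> Lv} :=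
  [ffun s => if s \in S :\: x.1 then top else x.2 s].
pose P (x : {set A} * {ffun A -> Lv}) := (x.1 \subset S) && valid n x.1 x.2.
have validP T L s : valid n T L -> (L s <= n)%N /\ (s \notin T -> L s = ord0).
  by move=> /forallP/(_ s)/andP[? /implyP H]; split => // /H/eqP.
have top_neq T L s : valid n T L -> L s != top.
  by move=> /(@validP T L s) [h _]; rewrite -val_eqE /= topE neq_ltn ltnS h.
have top0 : top != ord0 by rewrite -val_eqE /= topE.
under eq_bigr do rewrite mulr_suml.
rewrite pair_big_dep /= -/(P _).
rewrite (eq_bigr (fun x => term (g x) S)).
  apply: sum_image_le => [x y|[T L] /andP[/= TS vL]|L _]; last exact: term_ge0.
    rewrite !unfold_in => /andP[xS vx] /andP[yS vy] /ffunP gxy.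
    have e1 : x.1 = y.1.
      have aux (z z' : {set A} * {ffun A -> Lv}) s : g z =1 g z' -> valid n z'.1 z'.2 ->
          z.1 \subset S -> z'.1 \subset S -> s \in z'.1 -> s \in z.1.
        move=> gzz vz' zS z'S sz'; apply: contraTT isT => sz.
        have := gzz s; rewrite !ffunE !inE sz sz' (subsetP z'S)//= => /esym/eqP.
        by rewrite (negbTE (@top_neq _ _ s vz')).
      by apply/setP => s; apply/idP/idP; apply: aux.
    case: x y e1 gxy vx vy xS yS => [T L] [T' L'] /= <- gxy vL vL' TS _; congr pair.
    apply/ffunP => s; have := gxy s; rewrite !ffunE /= inE.
    case: (boolP (s \in T)) => //= sT; case: (s \in S) => // _.
    by rewrite (@validP _ _ s vL).2// (@validP _ _ s vL').2.
  apply/forallP => s; rewrite /g !ffunE /= inE; have [h1 h2] := @validP _ _ s vL.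
  case: (boolP (s \in S)) => sS; rewrite ?andbF ?andbT //=.
    by case: (boolP (s \in T)) => /= _; rewrite ?topE// leqW.
  by rewrite h2 ?eqxx//; apply: contra sS; exact: subsetP.
move=> [T L] /andP[/= TS vL]; rewrite /term -mulrA.
have fE i : i != top -> fiber S (g (T, L)) i = fiber T L i.
  move=> it; apply/setP => s; rewrite !inE ffunE /= inE.
  have [sT|sT] /= := boolP (s \in T); first by rewrite (subsetP TS).
  have [sS|//] /= := boolP (s \in S); by rewrite eq_sym (negbTE it).
have ftop : fiber S (g (T, L)) top = S :\: T.
  apply/setP => s; rewrite !inE ffunE /= inE andbC.
  have [sT|sT] /= := boolP (s \in T).
    by rewrite (negbTE (@top_neq _ _ s vL)).
  by have [sS|sS] /= := boolP (s \in S); rewrite ?eqxx ?andbT ?andbF.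
rewrite fE 1?eq_sym//; congr (_ * _).
rewrite (bigD1 top)//= [in RHS](bigD1 top)//= ftop.
rewrite (_ : fiber T L top = set0) ?a0 ?mul1r; last first.
  by apply/setP => s; rewrite !inE (negbTE (@top_neq _ _ s vL)) andbF.
rewrite mulrC; congr (_ * _); apply: eq_bigr => i /andP[_ it]; by rewrite fE.
Qed.

(* The edges of level 0 stay with the target; the level i > 0 of an edge is
   the step of the unfolded recursion at which it is split off. *)
Lemma cumulant_le :
  `|k setT| <= \sum_(L : {ffun A -> 'I_#|A|.+1})
     b (fiber setT L ord0) * \prod_(i | i != ord0) a (fiber setT L i).
Proof.
(* Each unfolding passes to a proper subset, so one number [n] can bound both the size of [S] and
   the levels in use. *)
suff H n (S : {set A}) : (n <= #|A|)%N -> (#|S| <= n)%N -> `|k S| <= \sum_(L | valid n S L) term L S.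
  have := H #|A| [set: A]; rewrite cardsT => /(_ (leqnn _) (leqnn _)) h; apply: le_trans h _.
  rewrite big_mkcond; apply: ler_sum => L _; case: ifP => // _; exact: term_ge0.
elim: n S => [|n IH] S nA Sn.
  move: Sn; rewrite leqn0 cards_eq0 => /eqP ->; apply: le_trans (b_le 0 set0).
  have := kE set0; rewrite (bigD1 set0)//= setDv a0 mulr1 big1 ?addr0 => [<-|T].
    by rewrite ger0_norm.
  by rewrite subset0 andbN.
apply: le_trans (step S nA).
have -> : k S = b S - \sum_(T : {set A} | (T \subset S) && (T != S)) k T * a (S :\: T).
  by rewrite [in RHS]kE (bigD1 S)//= setDv a0 mulr1 addrK.
(* The recursion runs over proper subsets only; the term [T = S] of [step] makes room for [b S]. *)
apply: le_trans (ler_normB _ _) _; rewrite [leRHS](bigD1 S)//= setDv a0 mulr1 ger0_norm//.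
rewrite lerD ?b_le// (le_trans (ler_norm_sum _ _ _))// ler_sum// => T /andP[TS TnS].
rewrite normrM (ger0_norm (a_ge0 _)) ler_wpM2r// IH ?(ltnW nA)//.
by rewrite -ltnS (leq_trans _ Sn)// proper_card// properEneq TnS.
Qed.

End SetCumulants.

Lemma fiber_moment_relabel (A Q : finType) (S : {set A}) (f : A -> Q) (h : Q -> Q) :
  injective h -> fiber_moment S (fun s => h (f s)) = fiber_moment S f.
Proof.
move=> hi; rewrite /fiber_moment (reindex_inj hi) /=; apply: eq_bigr => q _.
by congr gauss_moment; apply: eq_card => s; rewrite !inE (inj_eq hi).
Qed.

Lemma fiber_moment_ext (A Q : finType) (S : {set A}) (f g : A -> Q) :
  {in S, f =1 g} -> fiber_moment S f = fiber_moment S g.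
Proof.
move=> fg; apply: eq_bigr => q _; congr gauss_moment; apply: eq_card => s.
by rewrite !inE; case: (boolP (s \in S)) => //= /fg ->.
Qed.

(** * Moments of the signal and their factorisation over components *)

Section ModelMoments.
Variables (R : realFieldType) (A Rw Cl : finType) (Z : finZmodType).
Variables (u : A -> Rw) (v : A -> Cl) (lam rho : R).
Hypothesis rho_ge0 : 0 <= rho.
Hypothesis lam_ge0 : 0 <= lam.

(* The family s |-> (u s, v s) lists entries of the signal divided by sigma,
   lam is lambda / sigma, and [model_moment phi S] is the expectation of phi(k)
   times the product of the entries in S.  The labels carry a group structure
   because the counting lemmas translate them. *)
Definition label_weight (S : {set A}) (c : {ffun Rw -> Z}) : R :=
  (fiber_moment S (fun s => (c (u s), v s)))%:R.

Definition model_moment (phi : {ffun Rw -> Z} -> R) (S : {set A}) : R :=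
  lam ^+ #|S| * rho ^+ #|v @: S| * [forall r, ~~ odd #|fiber S u r|]%:R *
  ((#|{ffun Rw -> Z}|%:R)^-1 * \sum_c phi c * label_weight S c).

Let q0 : (#|{ffun Rw -> Z}|%:R : R) != 0.
Proof. by rewrite pnatr_eq0 -lt0n; apply/card_gt0P; exists 0. Qed.

Lemma model_moment_set0 phi :
  model_moment phi set0 = #|{ffun Rw -> Z}|%:R^-1 * \sum_c phi c.
Proof.
rewrite /model_moment cards0 imset0 cards0 !expr0 !mul1r.
rewrite (_ : [forall r, _]) ?mul1r; last first.
  apply/forallP => r; rewrite (_ : fiber _ _ _ = set0) ?cards0//.
  by apply/setP => s; rewrite !inE.
by under eq_bigr do rewrite /label_weight fiber_moment0 mulr1.
Qed.

Lemma model_moment_ge0 phi S : (forall c, 0 <= phi c) -> 0 <= model_moment phi S.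
Proof.
move=> phi0; rewrite !mulr_ge0 ?exprn_ge0 ?ler0n ?invr_ge0// sumr_ge0// => c _.
by rewrite mulr_ge0 ?ler0n.
Qed.

Variables (Rs : {set Rw}) (Cs : {set Cl}).
Hypothesis closed : forall s, (u s \in Rs) = (v s \in Cs).

(** Translating the labels of the rows in [Rs] by [z] moves all labels in a column of [Cs] together
    and those in other columns not at all. The weights are unchanged, whereas the event becomes
    [c i1 + z == c i2]; averaging over [z] leaves [1 / #|Z|]. *)
Lemma model_moment_shift i1 i2 S : i1 \in Rs -> i2 \notin Rs ->
  model_moment (fun c => (c i1 == c i2)%:R) S =
  model_moment (fun=> 1) S * #|Z|%:R^-1.
Proof.
move=> r1 r2; rewrite /model_moment -!mulrA; do 4![congr (_ * _)].
pose sh (z : Z) (c : {ffun Rw -> Z}) : {ffun Rw -> Z} :=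
  [ffun r => if r \in Rs then c r + z else c r].
have shi z : injective (sh z).
  move=> c c' /ffunP e; apply/ffunP => r; have := e r; rewrite !ffunE.
  by case: ifP => // _ /addIr.
have wsh z c : label_weight S (sh z c) = label_weight S c.
  congr _%:R; pose h (x : Z * Cl) := (if x.2 \in Cs then x.1 + z else x.1, x.2).
  have hi : injective h.
    by move=> [x j] [y j'] [+ e]; rewrite e; case: ifP => // _; [move/addIr->|move->].
  rewrite -[RHS](fiber_moment_relabel _ _ hi); apply: fiber_moment_ext => s _.
  by rewrite /h /= ffunE closed.
have E z : \sum_(c : {ffun Rw -> Z}) (c i1 == c i2)%:R * label_weight S c =
    \sum_(c : {ffun Rw -> Z}) (c i1 + z == c i2)%:R * label_weight S c.
  rewrite (reindex_inj (shi z)) /=; apply: eq_bigr => c _.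
  by rewrite wsh !ffunE r1 (negbTE r2).
have Z0 : (#|Z|%:R : R) != 0 by rewrite pnatr_eq0 -lt0n; apply/card_gt0P; exists 0.
apply: (mulIf Z0); rewrite divfK// mulr_natr -sumr_const.
rewrite (eq_bigr (fun z => \sum_(c : {ffun Rw -> Z}) (c i1 + z == c i2)%:R * label_weight S c)).
  rewrite exchange_big /=; apply: eq_bigr => c _.
  rewrite -mulr_suml (bigD1 (c i2 - c i1))//= [c i1 + _]addrC subrK eqxx big1 ?addr0// => z zc.
  by rewrite [c i1 + z]addrC -[c i1]opprK subr_eq (negbTE zc).
by move=> z _; exact: E.
Qed.

Let S1 := [set s | u s \notin Rs].

Lemma label_weight_split S c :
  label_weight S c = label_weight (S :&: S1) c * label_weight (S :\: S1) c.
Proof.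
rewrite -natrM; congr _%:R; rewrite -big_split; apply: eq_bigr => -[a j] _ /=.
have [jC|jC] := boolP (j \in Cs).
  rewrite (_ : fiber (S :&: S1) _ _ = set0) ?cards0 ?mul1n.
    congr gauss_moment; apply: eq_card => s; rewrite !inE negbK xpair_eqE.
    case: (v s =P j) => [vj|]; last by rewrite !andbF.
    by rewrite closed vj jC.
  apply/setP => s; rewrite !inE xpair_eqE; case: (v s =P j) => [vj|]; last by rewrite !andbF.
  by rewrite closed vj jC /= andbF.
rewrite (_ : fiber (S :\: S1) _ _ = set0) ?cards0 ?muln1.
  congr gauss_moment; apply: eq_card => s; rewrite !inE xpair_eqE.
  case: (v s =P j) => [vj|]; last by rewrite !andbF.
  by rewrite closed vj (negbTE jC) /= !andbT.
apply/setP => s; rewrite !inE xpair_eqE negbK; case: (v s =P j) => [vj|]; last by rewrite !andbF.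
by rewrite closed vj (negbTE jC).
Qed.

(** Edges inside and outside [Rs] share neither rows nor columns, so every factor splits. For the
    label average, exchanging the values on [Rs] between two colourings turns the product of two
    sums into a single sum, repeated once per colouring. *)
Lemma model_moment_split phi S :
  (forall c c' : {ffun Rw -> Z}, {in Rs, c =1 c'} -> phi c = phi c') ->
  model_moment phi S = model_moment (fun=> 1) (S :&: S1) * model_moment phi (S :\: S1).
Proof.
move=> phiE.
have w1 T (c c' : {ffun Rw -> Z}) : {in ~: Rs, c =1 c'} ->
    label_weight (T :&: S1) c = label_weight (T :&: S1) c'.
  move=> cc; congr _%:R; apply: fiber_moment_ext => s; rewrite !inE => /andP[_ h].
  by rewrite cc// inE.
have w2 T (c c' : {ffun Rw -> Z}) : {in Rs, c =1 c'} ->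
    label_weight (T :\: S1) c = label_weight (T :\: S1) c'.
  move=> cc; congr _%:R; apply: fiber_moment_ext => s; rewrite !inE negbK => /andP[h _].
  by rewrite cc.
pose mix (c c' : {ffun Rw -> Z}) : {ffun Rw -> Z} :=
  [ffun r => if r \in Rs then c' r else c r].
have key : #|{ffun Rw -> Z}|%:R * \sum_c phi c * label_weight S c =
    (\sum_c 1 * label_weight (S :&: S1) c) * (\sum_c phi c * label_weight (S :\: S1) c).
  rewrite mulr_suml; under [RHS]eq_bigr do rewrite mulr_sumr.
  rewrite mulr_natl -sumr_const exchange_big /=.
  rewrite pair_big [RHS]pair_big /=.
  pose swap (x : {ffun Rw -> Z} * {ffun Rw -> Z}) := (mix x.1 x.2, mix x.2 x.1).
  have swapK : involutive swap.
    move=> [c c']; rewrite /swap /=; congr pair; apply/ffunP => r;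
      by rewrite !ffunE; case: (r \in Rs).
  rewrite [RHS](reindex_inj (inv_inj swapK)) /=; apply: eq_bigr => -[c c'] _ /=.
  have e1 : label_weight (S :&: S1) (mix c c') = label_weight (S :&: S1) c.
    by apply: w1 => r; rewrite inE ffunE => /negbTE ->.
  have e2 : label_weight (S :\: S1) (mix c' c) = label_weight (S :\: S1) c.
    by apply: w2 => r rR; rewrite ffunE rR.
  have e3 : phi (mix c' c) = phi c by apply: phiE => r rR; rewrite ffunE rR.
  by rewrite e1 e2 e3 mul1r mulrCA -label_weight_split.
have even : [forall r, ~~ odd #|fiber S u r|] =
    [forall r, ~~ odd #|fiber (S :&: S1) u r|] && [forall r, ~~ odd #|fiber (S :\: S1) u r|].
  have f1 r : r \in Rs -> fiber S u r = fiber (S :\: S1) u r /\ fiber (S :&: S1) u r = set0.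
    move=> rR; split; apply/setP => s; rewrite !inE ?negbK;
    by case: (u s =P r) => [->|]; rewrite ?rR ?andbF// ?andbT.
  have f2 r : r \notin Rs -> fiber S u r = fiber (S :&: S1) u r /\ fiber (S :\: S1) u r = set0.
    move=> rR; split; apply/setP => s; rewrite !inE ?negbK;
    by case: (u s =P r) => [->|]; rewrite ?rR ?(negbTE rR) ?andbF// ?andbT.
  apply/forallP/andP => [H|[/forallP H1 /forallP H2] r].
    split; apply/forallP => r; have := H r; have [rR|rR] := boolP (r \in Rs).
    - by rewrite (f1 r rR).2 cards0.
    - by rewrite (f2 r rR).1.
    - by rewrite (f1 r rR).1.
    - by rewrite (f2 r rR).2 cards0.
  have [rR|rR] := boolP (r \in Rs); first by rewrite (f1 r rR).1.
  by rewrite (f2 r rR).1.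
have cv : #|v @: S| = (#|v @: (S :&: S1)| + #|v @: (S :\: S1)|)%N.
  rewrite -[in LHS](setID S S1) imsetU cardsU
    (_ : (v @: (S :&: S1)) :&: (v @: (S :\: S1)) = set0) ?cards0 ?subn0//.
  apply/setP => j; rewrite !inE; apply/negP => /andP[/imsetP[s] + ->] /imsetP[t].
  by rewrite !inE negbK => /andP[_ +] /andP[+ _] e; rewrite !closed e => /negbTE ->.
rewrite /model_moment cv -{1}(cardsID S1 S) !exprD even -mulnb natrM.
have -> : #|{ffun Rw -> Z}|%:R^-1 * \sum_c phi c * label_weight S c =
    (#|{ffun Rw -> Z}|%:R^-1 * \sum_c 1 * label_weight (S :&: S1) c) *
    (#|{ffun Rw -> Z}|%:R^-1 * \sum_c phi c * label_weight (S :\: S1) c).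
  by rewrite mulrACA -key; field.
ring.
Qed.

End ModelMoments.

Lemma gauss_moment_even n : ~~ odd n -> (0 < gauss_moment n)%N.
Proof.
have [k] := ubnP n; elim: k n => // k IH [|[|n]] //= nk; rewrite negbK => on.
by rewrite muln_gt0 IH// ltnW.
Qed.

Lemma gauss_moment_odd n : odd n -> gauss_moment n = 0%N.
Proof.
have [k] := ubnP n; elim: k n => // k IH [|[|n]] //= nk; rewrite negbK => on.
by rewrite IH ?muln0// ltnW.
Qed.

Lemma fiber_moment_prod (A Q1 Q2 : finType) (S : {set A}) (f : A -> Q1) (g : Q1 -> A -> Q2) :
  (\prod_x fiber_moment (fiber S f x) (g x))%N =
  fiber_moment S (fun s => (f s, g (f s) s)).
Proof.
rewrite /fiber_moment pair_big /=; apply: eq_bigr => -[x y] _ /=.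
congr gauss_moment; apply: eq_card => s; rewrite !inE xpair_eqE -andbA.
by case: (f s =P x) => [->|]; rewrite ?andbF.
Qed.

(** * Bound for a single cumulant *)

Section CumulantBound.
Variables (R : realFieldType) (A Rw Cl : finType) (Z : finZmodType).
Variables (u : A -> Rw) (v : A -> Cl) (lam rho : R) (i1 i2 : Rw).
Hypotheses (rho_ge0 : 0 <= rho) (rho_le1 : rho <= 1) (lam_ge0 : 0 <= lam).
Hypothesis i12 : i1 != i2.

Definition same_label (c : {ffun Rw -> Z}) : R := (c i1 == c i2)%:R.
Local Notation mom := (model_moment u v lam rho (fun _ : {ffun Rw -> Z} => 1)).
Local Notation xmom := (model_moment u v lam rho same_label).

Lemma mean_same_label :
  \sum_c same_label c = #|{ffun Rw -> Z}|%:R / #|Z|%:R.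
Proof.
(* Without edges the row [i1] alone is closed, and translating its label gives the mean. *)
have := @model_moment_shift R void Rw Rw Z (fun x => match x with end) (fun x => match x with end)
  1 1 [set i1] [set i1] (fun x => match x with end) i1 i2 set0.
rewrite !model_moment_set0 !inE eqxx eq_sym => /(_ isT i12).
have q0 : (#|{ffun Rw -> Z}|%:R : R) != 0.
  by rewrite pnatr_eq0 -lt0n; apply/card_gt0P; exists 0.
rewrite sumr_const -[_ *+ _]/(_%:R) mulVf// mul1r => <-.
by rewrite mulVKf.
Qed.

Variable k : {set A} -> R.
Hypothesis kE : forall S, xmom S = \sum_(T : {set A} | T \subset S) k T * mom (S :\: T).

Lemma mom_set0 : mom set0 = 1.
Proof.
rewrite model_moment_set0 sumr_const mulVf// pnatr_eq0 -lt0n.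
by apply/card_gt0P; exists 0.
Qed.

(** A closed pair [Rs], [Cs] witnesses the failure. If it contains [i2], some edges lie outside and
    split off as [S1]. Otherwise the labels of [i1] and [i2] can be translated relative to each
    other, the target is uncorrelated with every subfamily, and [S1] is the whole family. *)
Lemma cumulant_not_linked : (0 < #|A|)%N -> ~ linked u v i1 i2 -> k setT = 0.
Proof.
move=> A0 nl.
suff [S1 [S10 H1 H2]] : exists S1 : {set A}, [/\ S1 != set0,
    forall T, mom T = mom (T :&: S1) * mom (T :\: S1) &
    forall T, xmom T = mom (T :&: S1) * xmom (T :\: S1)].
  by apply: (cumulant_eq0 mom_set0 kE H1 H2); rewrite setTI.
have [/existsP [[Rs Cs]] /= /and3P[/forallP cl r1 H]|/existsPn H] :=
  boolP [exists x : {set Rw} * {set Cl}, [&& [forall s, (u s \in x.1) == (v s \in x.2)],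
    i1 \in x.1 & ~~ ((i2 \in x.1) && [forall s, u s \in x.1])]]; last first.
  exfalso; apply: nl => Rs Cs cl r1; have := H (Rs, Cs); rewrite /= r1 /=.
  have -> /= : [forall s, (u s \in Rs) == (v s \in Cs)] by apply/forallP => s; rewrite cl.
  by rewrite negbK => /andP[-> /forallP].
have {}cl s : (u s \in Rs) = (v s \in Cs) by exact/eqP.
have [r2|r2] := boolP (i2 \in Rs).
  move: H; rewrite r2 /= => /forallPn [s us]; exists [set s | u s \notin Rs]; split.
  - by apply/set0Pn; exists s; rewrite inE.
  - by move=> T; apply: (model_moment_split _ _ cl).
  - move=> T; apply: (model_moment_split _ _ cl) => c c' cc.
    by rewrite /same_label !cc.
exists setT; split.
- by rewrite -card_gt0 cardsT.
- by move=> T; rewrite setIT setDT mom_set0 mulr1.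
move=> T; rewrite setIT setDT (@model_moment_shift R A Rw Cl Z u v lam rho Rs Cs cl i1 i2 T r1 r2); congr (_ * _).
rewrite model_moment_set0 mean_same_label mulKf// pnatr_eq0 -lt0n.
by apply/card_gt0P; exists 0.
Qed.

Hypothesis lk : linked u v i1 i2.
Let N := #|A|.+1.
Let Lv := 'I_N.
Let Q : R := #|{ffun Rw -> Z}|%:R.
Let q : R := #|Z|%:R.
Let m := #|u @: A|.
Let r := #|v @: A|.

Let Q_gt0 : 0 < Q. Proof. by rewrite ltr0n; apply/card_gt0P; exists 0. Qed.
Let q_gt0 : 0 < q. Proof. by rewrite ltr0n; apply/card_gt0P; exists 0. Qed.

Let col (L : {ffun A -> Lv}) (c : {ffun Lv -> {ffun Rw -> Z}}) :=
  fiber_moment setT (fun s => ((L s, c (L s) (u s)), v s)).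
Let row (L : {ffun A -> Lv}) := fiber_moment setT (fun s => (L s, u s)).

(** One colouring per level merges the product over levels into a single sum. The parity condition
    on rows is relaxed to a Gaussian moment, which is at least 1 when all degrees are even, so that
    rows admit matchings just as columns do. *)
Let level_le (L : {ffun A -> Lv}) :
  xmom (fiber setT L ord0) * \prod_(i | i != ord0) mom (fiber setT L i) <=
  lam ^+ #|A| * rho ^+ r * Q ^- N *
    \sum_(c : {ffun Lv -> {ffun Rw -> Z}}) same_label (c ord0) * (row L)%:R * (col L c)%:R.
Proof.
pose psi (i : Lv) c := if i == ord0 then same_label c else 1.
rewrite (_ : _ * _ = \prod_(i : Lv) model_moment u v lam rho (psi i) (fiber setT L i)); last first.
  rewrite [RHS](bigD1 ord0)//= /psi eqxx; congr (_ * _).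
  by apply: eq_bigr => i /negbTE ->.
rewrite /model_moment !big_split /= -!expr_sum.
rewrite sum_card_fiber cardsT.
have -> : \prod_(i : Lv) Q^-1 = Q ^- N by rewrite prodr_const card_ord exprVn.
(* A column contributes [rho] at every level where it occurs; one occurrence is kept, as
   [rho <= 1]. *)
have rs : (r <= \sum_(i : Lv) #|v @: fiber setT L i|)%N.
  rewrite /r (_ : v @: A = \bigcup_(i : Lv) (v @: fiber setT L i)).
    elim/big_rec2: _ => [|i x T _ le]; first by rewrite cards0.
    by rewrite (leq_trans (leq_card_setU _ _).1)// leq_add2l.
  apply/setP => j; apply/imsetP/bigcupP => [[s _ ->]|[i _ /imsetP[s _ ->]]]; last by exists s.
  by exists (L s) => //; apply/imsetP; exists s => //; rewrite !inE eqxx.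
have P2 : rho ^+ (\sum_(i : Lv) #|v @: fiber setT L i|) <= rho ^+ r.
  by rewrite ler_wiXn2l.
have P3 : \prod_(i : Lv) [forall t, ~~ odd #|fiber (fiber setT L i) u t|]%:R <= (row L)%:R :> R.
  rewrite /row -(fiber_moment_prod setT L (fun=> u)) natr_prod; apply: ler_prod => i _; rewrite ler0n ler_nat /=.
  case: forallP => // ev; rewrite /fiber_moment prodn_gt0// => t.
  by rewrite gauss_moment_even.
have P30 : 0 <= \prod_(i : Lv) [forall t, ~~ odd #|fiber (fiber setT L i) u t|]%:R :> R.
  by apply: prodr_ge0 => i _; rewrite ler0n.
rewrite bigA_distr_bigA /=.
have -> : \sum_(c : {ffun Lv -> {ffun Rw -> Z}})
     \prod_i (psi i (c i) * label_weight R u v (fiber setT L i) (c i)) =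
   \sum_(c : {ffun Lv -> {ffun Rw -> Z}}) same_label (c ord0) * (col L c)%:R.
  apply: eq_bigr => c _; rewrite big_split /= (bigD1 ord0)//= big1 ?mulr1; last first.
    by move=> i /negbTE; rewrite /psi => ->.
  rewrite {1}/psi eqxx; congr (_ * _); rewrite /label_weight -natr_prod; congr _%:R.
  rewrite (fiber_moment_prod _ L (fun i s => (c i (u s), v s))).
  rewrite /col; pose h (x : Lv * (Z * Cl)) := ((x.1, x.2.1), x.2.2).
  rewrite /fiber_moment (reindex h) /=; last first.
    by exists (fun x : (Lv * Z) * Cl => (x.1.1, (x.1.2, x.2))) => [[? []]|[[]]].
  apply: eq_bigr => -[i [z j]] _; congr gauss_moment; apply: eq_card => s.
  by rewrite !inE /h /= !xpair_eqE andbA.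
pose X := \sum_(c : {ffun Lv -> {ffun Rw -> Z}}) same_label (c ord0) * (col L c)%:R.
rewrite -/X; have X0 : 0 <= X by apply: sumr_ge0 => c _; rewrite mulr_ge0 ?ler0n.
have -> : \sum_(c : {ffun Lv -> {ffun Rw -> Z}}) same_label (c ord0) * (row L)%:R * (col L c)%:R
    = (row L)%:R * X.
  by rewrite mulr_sumr; apply: eq_bigr => c _; rewrite mulrCA mulrA.
have Qi : 0 <= Q ^- N by rewrite invr_ge0 exprn_ge0// ltW.
rewrite -!mulrA ler_wpM2l ?exprn_ge0//.
apply: ler_pM => //; rewrite ?exprn_ge0// ?mulr_ge0//.
rewrite mulrCA ler_wpM2l// ler_wpM2r//.
Qed.

Section Aux.
Variables (X : R).
Hypothesis X_ge0 : 0 <= X.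
Hypothesis colourings_le : forall (f : A -> A) (L : {ffun A -> Lv}),
  matching setT v f -> (forall s, L (f s) = L s) ->
  \sum_(c : {ffun Lv -> {ffun Rw -> Z}} | [forall s, c (L s) (u (f s)) == c (L s) (u s)])
    same_label (c ord0) <= X * Q ^+ N.

Let n_levels_le (f g : A -> A) : matching setT v f -> matching setT u g ->
  #|[set L : {ffun A -> Lv} | [forall s, (L (f s) == L s) && (L (g s) == L s)]]|%:R <=
  N%:R ^+ #|A|.+1 / N%:R ^+ (m + r) :> R.
Proof.
move=> mf mg; rewrite ler_pdivlMr ?exprn_gt0 ?ltr0n// -!natrX -natrM ler_nat.
have := card_levels_le lk 'I_N mf mg; rewrite card_ord => h; apply: leq_trans h _.
by rewrite -expnS leq_pexp2l// ltnS leq_divM.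
Qed.

(** Matchings are extracted twice: along the columns, preserving level and label, and then along the
    rows, preserving the level. The levels are counted against both matchings, the labels against
    the column matching alone, through [X]. *)
Lemma cumulant_bound_aux :
  `|k setT| <= lam ^+ #|A| * rho ^+ r *
    ((fiber_moment setT v)%:R * ((fiber_moment setT u)%:R *
      (N%:R ^+ #|A|.+1 / N%:R ^+ (m + r) * X))).
Proof.
have a0 S : 0 <= mom S by exact: model_moment_ge0.
have b0 S : 0 <= xmom S by apply: model_moment_ge0 => // c; rewrite ler0n.
apply: le_trans (cumulant_le mom_set0 kE a0 b0) _.
apply: le_trans (ler_sum _ (fun L _ => level_le L)) _.
rewrite -mulr_sumr -[X in _ <= X * _]mulr1 -!mulrA !ler_wpM2l ?exprn_ge0//.
rewrite mul1r ler_pdivrMl ?exprn_gt0//.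
rewrite pair_big /=.
pose h (w : {ffun A -> Lv} * {ffun Lv -> {ffun Rw -> Z}}) := same_label (w.2 ord0) * (row w.1)%:R.
pose c (w : {ffun A -> Lv} * {ffun Lv -> {ffun Rw -> Z}}) s := (w.1 s, w.2 (w.1 s) (u s)).
rewrite [leRHS](_ : _ = (fiber_moment [set: A] v)%:R * ((fiber_moment [set: A] u)%:R *
     (N%:R ^+ #|A|.+1 / N%:R ^+ (m + r) * (X * Q ^+ N)))); last by ring.
apply: (fiber_moment_sum_le (c := c) (h := h)) => f mf.
rewrite big_mkcond /=.
(* The constraint of the column matching moves into the weight before the row moment is expanded. *)
pose h' w := if [forall s in setT, c w (f s) == c w s] then same_label (w.2 ord0) else 0.
rewrite (eq_bigr (fun w => h' w * (row w.1)%:R)); last first.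
  by move=> w _; rewrite /h' /h; case: ifP; rewrite ?mul0r.
apply: (@fiber_moment_sum_le _ R _ _ _ u (fun (w : {ffun A -> Lv} * {ffun Lv -> {ffun Rw -> Z}}) s => w.1 s)
  setT h') => g mg.
set Lev := [set L : {ffun A -> Lv} | [forall s, (L (f s) == L s) && (L (g s) == L s)]].
apply: (@le_trans _ _ (\sum_(L in Lev) X * Q ^+ N)); last first.
  by rewrite sumr_const -[(X * Q ^+ N) *+ _]mulr_natl ler_wpM2r ?n_levels_le// mulr_ge0// exprn_ge0// ltW.
apply: (@le_trans _ _ (\sum_(L in Lev)
   \sum_(c : {ffun Lv -> {ffun Rw -> Z}} | [forall s, c (L s) (u (f s)) == c (L s) (u s)])
    same_label (c ord0))); last first.
  apply: ler_sum => L; rewrite inE => /forallP LL; apply: colourings_le => // s.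
  by have /andP[/eqP] := LL s.
rewrite pair_big_dep /= big_mkcond [leRHS]big_mkcond /=; apply: ler_sum => -[L k'] _ /=.
have s0 : 0 <= same_label (k' ord0) by rewrite ler0n.
case: ifP => [/forallP Lg|_]; last by case: ifP.
rewrite /h' /c; case: ifP => [/forallP /= Lf|_]; last by case: ifP.
rewrite ifT//; apply/andP; split; last first.
  by apply/forallP => s; have := Lf s; rewrite inE /= xpair_eqE => /andP[/eqP ->].
rewrite inE; apply/forallP => s; have := Lf s; have := Lg s; rewrite !inE /=.
by rewrite xpair_eqE => -> /andP[-> _].
Qed.

End Aux.

(** There are two estimates of the label average: forget the matching and keep the target, whose
    mean is [1 / q], or forget the target and count the colourings that are constant along the
    matching. The latter gains for families with many vertices. *)
Theorem cumulant_bound :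
  `|k setT| <= lam ^+ #|A| * rho ^+ r *
    ((fiber_moment setT v)%:R * ((fiber_moment setT u)%:R *
      (N%:R ^+ #|A|.+1 / N%:R ^+ (m + r) *
        Num.min q^-1 (q ^+ (#|A| %/ 2).+1 / q ^+ (m + r))))).
Proof.
have s01 c : 0 <= same_label c <= 1 by rewrite ler0n lern1 leq_b1.
rewrite minElt; case: ifP => _; (apply: cumulant_bound_aux; last move=> f L mf Lf).
- by rewrite invr_ge0 ltW.
- apply: (@le_trans _ _ (\sum_(c : {ffun Lv -> {ffun Rw -> Z}}) same_label (c ord0))).
    rewrite big_mkcond; apply: ler_sum => c _; case: ifP => // _; by have /andP[] := s01 (c ord0).
  pose psi (i : Lv) c := if i == ord0 then same_label c else 1.
  have -> : \sum_(c : {ffun Lv -> {ffun Rw -> Z}}) same_label (c ord0) =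
      \prod_(i : Lv) \sum_(c : {ffun Rw -> Z}) psi i c.
    rewrite bigA_distr_bigA; apply: eq_bigr => c _.
    by rewrite (bigD1 ord0)//= big1 ?mulr1 /psi ?eqxx// => i /negbTE ->.
  rewrite (bigD1 ord0)//= {1}/psi eqxx mean_same_label.
  rewrite (eq_bigr (fun=> Q)); last by move=> i /negbTE i0; rewrite /psi i0 sumr_const.
  by rewrite prodr_const cardC1 card_ord -/Q -/q [Q ^+ N]exprS mulrA [q^-1 * Q]mulrC.
- by rewrite divr_ge0 ?exprn_ge0// ltW.
- apply: (@le_trans _ _ #|[set c : {ffun Lv -> {ffun Rw -> Z}} |
     [forall s, c (L s) (u (f s)) == c (L s) (u s)]]|%:R).
    rewrite -sum1_card natr_sum; under [leRHS]eq_bigl do rewrite inE.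
    by apply: ler_sum => c _; have /andP[] := s01 (c ord0).
  rewrite mulrAC ler_pdivlMr ?exprn_gt0//.
  have := card_colourings_le lk Z mf Lf; rewrite -card_ffun card_ord.
  rewrite -(ler_nat R) !natrM !natrX => h; apply: le_trans h _.
  by rewrite -/q -/Q exprS mulrA mulrAC.
Qed.

End CumulantBound.

(** * Summing over edge families *)

Definition even_tuple (B : finType) n (t : n.-tuple B) := [forall b, ~~ odd (count_mem b t)].

Section EvenTuples.
Variables (R : realFieldType) (B : finType) (wt : B -> R) (dl c : R).
Hypotheses (wt_ge0 : forall b, 0 <= wt b) (dl_ge0 : 0 <= dl).
Hypothesis wt_le : \sum_b wt b <= c.

(** In an even tuple of length 2 l at most l values occur; each one short of l costs a factor
    [dl]. *)
Definition tuple_weight l n (t : n.-tuple B) : R :=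
  \prod_(b | b \in t) wt b * dl ^+ (l - #|[set b | b \in t]|).

Lemma tuple_weight_ge0 l n (t : n.-tuple B) : 0 <= tuple_weight l t.
Proof. by rewrite mulr_ge0 ?exprn_ge0// prodr_ge0. Qed.

Lemma card_even_tuple l (t : l.*2.-tuple B) : even_tuple t ->
  (#|[set b | b \in t]| <= l)%N.
Proof.
move=> /forallP te; rewrite -leq_double -[X in (_ <= X)%N](size_tuple t).
rewrite -sum1_size [X in (_ <= X)%N](partition_big id xpredT)//=.
rewrite -mul2n -sum1_card big_distrr /= muln1 big_mkcond; apply: leq_sum => b _.
rewrite inE; case: ifP => // bt; have := te b; rewrite -sum1_count /=.
have : (0 < count_mem b t)%N by rewrite -has_count has_pred1.
by rewrite -sum1_count; case: (\sum_(_ <- _ | _) _)%N => [|[]].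
Qed.

Fact ins_subproof l (a : B) j (t : l.-tuple B) :
  size (a :: take j t ++ a :: drop j t) == l.+2.
Proof.
by rewrite /= size_cat /= addnS -size_cat cat_take_drop size_tuple.
Qed.

Let ins l (a : B) (j : 'I_l.+1) (t : l.-tuple B) : l.+2.-tuple B :=
  Tuple (ins_subproof a j t).

Let count_ins l a (j : 'I_l.+1) (t : l.-tuple B) b :
  count_mem b (ins a j t) = ((a == b).*2 + count_mem b t)%N.
Proof.
rewrite /= count_cat /= -[in RHS](cat_take_drop j t) count_cat.
by case: (a == b); lia.
Qed.

(* Induction on l: remove the first entry a together with its next occurrence.
   Either a still occurs in the rest, which costs a factor dl, or it was new,
   which costs wt a. *)
Lemma sum_even_tuples l :
  \sum_(t : l.*2.-tuple B | even_tuple t) tuple_weight l t <=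
  (gauss_moment l.*2)%:R * (c + l%:R * dl) ^+ l.
Proof.
have c0 : 0 <= c by apply: le_trans wt_le; apply: sumr_ge0.
elim: l => [|l IH].
  rewrite expr0 mulr1 (eq_bigr (fun=> 1)); last first.
    move=> t _; rewrite /tuple_weight tuple0 big_pred0 ?mul1r ?sub0n//.
  rewrite sumr_const ler_nat (leq_trans (max_card _))// card_tuple expn0.
  by [].
pose F (t : l.+1.*2.-tuple B) := tuple_weight l.+1 t.
pose g (x : (B * 'I_l.*2.+1) * l.*2.-tuple B) : l.+1.*2.-tuple B := ins x.1.1 x.1.2 x.2.
apply: (@le_trans _ _ (\sum_(x : (B * 'I_l.*2.+1) * l.*2.-tuple B | even_tuple x.2) F (g x))).
  apply: sum_cover_le => [t te|x _]; last exact: tuple_weight_ge0.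
  move: te => /forallP te.
  have [a [s tE]] : exists a s, tval t = a :: s.
    by have := size_tuple t; case: (tval t) => [|a s] // _; exists a, s.
  have szs : size s = l.*2.+1 by have := size_tuple t; rewrite tE => -[].
  have as_ : a \in s.
    have := te a; rewrite tE /= eqxx; apply: contraR => /count_memPn ->.
    by [].
  have jl : (index a s < l.*2.+1)%N by rewrite -szs index_mem.
  have szr : size (rem a s) == l.*2 by rewrite size_rem// szs.
  have sE : take (index a s) (rem a s) ++ a :: drop (index a s) (rem a s) = s.
    have i0 := index_mem a s; rewrite as_ in i0.
    rewrite remE take_cat size_take i0 ltnn subnn take0 cats0.
    rewrite drop_cat size_take i0 ltnn subnn drop0.
    by rewrite -[in RHS](cat_take_drop (index a s) s) (drop_nth a)// nth_index.
  have gE : g ((a, Ordinal jl), Tuple szr) = t.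
    by apply: val_inj; rewrite /= sE tE.
  exists ((a, Ordinal jl), Tuple szr) => //.
  apply/forallP => b; have := te b; rewrite -gE /g count_ins oddD odd_double.
  by [].
rewrite -(pair_big xpredT (fun t : l.*2.-tuple B => even_tuple t) (fun x t => F (g (x, t)))) /=.
rewrite -(pair_big xpredT xpredT (fun a j => \sum_(t : l.*2.-tuple B | even_tuple t) F (g ((a, j), t)))) /=.
have FE a j t : even_tuple t -> F (g ((a, j), t)) =
    (if a \in t then dl else wt a) * tuple_weight l t.
  move=> te; rewrite /F /tuple_weight.
  have memE b : (b \in g ((a, j), t)) = (b == a) || (b \in t).
    rewrite -!has_pred1 !has_count /g count_ins eq_sym.
    by case: (b == a).
  have le := card_even_tuple te.
  case: ifP => [at_|at_].
    have mE b : (b \in g ((a, j), t)) = (b \in t).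
      by rewrite memE; case: eqP => // ->; rewrite at_.
    rewrite (eq_bigl _ _ mE) (_ : [set b | b \in g ((a, j), t)] = [set b | b \in t]); last first.
      by apply/setP => b; rewrite !in_set mE.
    by rewrite subSn// exprS mulrCA.
  rewrite (eq_bigl _ _ memE) (bigD1 a) ?eqxx//= (eq_bigl (fun b => b \in t)); last first.
    by move=> b; case: (eqVneq b a) => [->|_]; rewrite ?at_ ?andbT.
  rewrite (_ : [set b | b \in g ((a, j), t)] = a |: [set b | b \in t]); last first.
    by apply/setP => b; rewrite !in_set memE in_set1.
  by rewrite cardsU1 inE at_ add1n subSS mulrA.
(* The summand does not depend on the position [j]; the [l.*2.+1] positions supply the new factor of
   the Gaussian moment. *)
rewrite (eq_bigr (fun a => l.*2.+1%:R * \sum_(t : l.*2.-tuple B | even_tuple t)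
    (if a \in t then dl else wt a) * tuple_weight l t)); last first.
  move=> a _; rewrite (eq_bigr (fun=> \sum_(t : l.*2.-tuple B | even_tuple t)
    (if a \in t then dl else wt a) * tuple_weight l t)).
    by rewrite sumr_const card_ord mulr_natl.
  by move=> j _; apply: eq_bigr => t te; rewrite FE.
rewrite -mulr_sumr exchange_big /= natrM -mulrA ler_wpM2l//.
set d := c + l.+1%:R * dl; set d0 := c + l%:R * dl.
have d00 : 0 <= d0 by rewrite addr_ge0// mulr_ge0.
have d0d : d0 <= d by rewrite lerD2l ler_wpM2r// ler_nat.
apply: (@le_trans _ _ (d0 * \sum_(t : l.*2.-tuple B | even_tuple t) tuple_weight l t)).
  rewrite mulr_sumr; apply: ler_sum => t te; rewrite -mulr_suml.
  rewrite ler_wpM2r ?tuple_weight_ge0// (bigID (fun a => a \in t)) /= addrC lerD//.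
    apply: le_trans wt_le; rewrite [leRHS](bigID (fun a => a \in t)) /= addrC.
    rewrite -[leLHS]addr0 lerD ?sumr_ge0//.
    by rewrite le_eqVlt; apply/orP; left; apply/eqP; apply: eq_bigr => a /negbTE ->.
  rewrite (eq_bigr (fun=> dl)) => [|a ->//].
  rewrite sumr_const -[dl *+ _]mulr_natl ler_wpM2r// ler_nat.
  by have := card_even_tuple te; rewrite cardsE.
apply: (@le_trans _ _ (d0 * ((gauss_moment l.*2)%:R * d0 ^+ l))); first by rewrite ler_wpM2l.
rewrite mulrCA ler_wpM2l// -exprS; apply: lerXn2r => //; rewrite nnegrE//.
exact: le_trans d0d.
Qed.

End EvenTuples.

(** For even d the moment is a product of d / 2 odd factors, the smallest of which is 1 and the
    others at most [D]. Each nonempty fibre thus saves one factor [D], and so does each vertex in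
    [fiber_moment_le_pow]. *)
Lemma gauss_moment_le_pow D d : (d <= D)%N ->
  (gauss_moment d * D ^ (0 < d) <= D ^ (d %/ 2))%N.
Proof.
have [k] := ubnP d; elim: k d => // k IH [|[|d]] //= dk dD.
rewrite (_ : d.+2 %/ 2 = (d %/ 2).+1)%N; last by lia.
have := IH d (ltn_trans (ltnSn d) dk).
case: d dD {dk IH} => [|d] dD h; first by rewrite !mul1n.
by rewrite -mulnA [leqRHS]expnS leq_mul// ?h//; lia.
Qed.

Lemma fiber_moment_le_pow (A Q : finType) (f : A -> Q) D l :
  #|A| = l.*2 -> (l.*2 <= D)%N ->
  (fiber_moment setT f * D ^ #|f @: A| <= D ^ l)%N.
Proof.
move=> Al lD; have fD q : (#|fiber setT f q| <= D)%N.
  by rewrite (leq_trans (max_card _))// Al.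
rewrite (_ : #|f @: A| = \sum_q (0 < #|fiber setT f q|))%N; last first.
  rewrite -sum1_card big_mkcond; apply: eq_bigr => q _.
  case: imsetP => [[s _ ->]|H].
    case: card_gt0P => // H'; case: H'; exists s; by rewrite !inE eqxx.
  case: card_gt0P => // -[s]; rewrite !inE => /eqP fs.
  by case: H; exists s.
rewrite expn_sum -big_split /=.
case D0 : D => [|D'].
  have A0 : #|A| = 0%N by move: lD; rewrite D0 leqn0 Al => /eqP.
  have l0 : l = 0%N by move: Al; rewrite A0; case: (l).
  rewrite l0 big1// => q _; have : (#|fiber setT f q| <= 0)%N.
    by rewrite -A0 max_card.
  by rewrite leqn0 => /eqP ->.
rewrite -D0; apply: (@leq_trans (\prod_q D ^ (#|fiber setT f q| %/ 2)))%N.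
  by apply: leq_prod => q _; exact: gauss_moment_le_pow.
rewrite -expn_sum leq_pexp2l ?D0// -leq_double.
apply: (@leq_trans (\sum_q #|fiber setT f q|)); last by rewrite sum_card_fiber cardsT Al.
rewrite -mul2n big_distrr /=; apply: leq_sum => q _; lia.
Qed.

(** Enumerating rows and enumerating columns produce one Gaussian moment each; the division by the
    factorial of the length absorbs both. *)
Lemma gauss_moment_sqr_le l : (gauss_moment l.*2 ^ 2 <= (l.*2)`!)%N.
Proof.
elim: l => // l IH; rewrite doubleS /= expnMn !factS.
rewrite mulnA; apply: leq_mul => //; lia.
Qed.

(** * How the four terms of zeta are spent *)

Section Budget.
Variable R : realFieldType.

Lemma pow1D_le2 (x : R) l : 0 <= x -> l%:R * x <= 2^-1 -> (1 + x) ^+ l <= 2.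
Proof.
(* Bernoulli's inequality in product form; the second factor is at least one half. *)
move=> x0 lx; suff H : (1 + x) ^+ l * (1 - l%:R * x) <= 1.
  have h0 : 0 <= (1 + x) ^+ l by rewrite exprn_ge0// addr_ge0.
  nra.
elim: l lx => [|l IH] lx; first by rewrite expr0 mul0r subr0 mulr1.
have lx' : l%:R * x <= 2^-1 by move: lx; rewrite -natr1 mulrDl; lra.
have := IH lx'; apply: le_trans; rewrite exprSr -mulrA ler_wpM2l//.
  by rewrite exprn_ge0// addr_ge0.
rewrite -natr1; have l0 : 0 <= l%:R :> R by rewrite ler0n.
nra.
Qed.

Variables (n p K D : nat) (th rho ze : R).
Hypotheses (th_ge0 : 0 <= th) (rho_ge0 : 0 <= rho) (K_gt0 : (0 < K)%N).
Hypotheses (ze1 : th * D%:R ^+ 14 <= ze) (ze2 : th * (D%:R ^+ 7 * n%:R) <= ze)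
  (ze3 : th * (D%:R ^+ 7 * rho ^+ 2 * p%:R) <= ze)
  (ze4 : th * (rho ^+ 2 * p%:R * (n%:R / K%:R ^+ 2)) <= ze).

(** The l factors [th] are distributed over the four bounds. If m + r <= l, then m of them go to
    [ze2], r to [ze3] and the others to [ze1], the label factor being at most 1. Otherwise put t = m
    + r - l: now l - r go to [ze2], l - m to [ze3] and t to [ze4], for which the squared label
    factor supplies K^(-2 t). In both cases the powers of [D] add up to 7 (2 l - m - r). *)
Lemma budget l m r : (m <= l)%N -> (r <= l)%N ->
  th ^+ l * rho ^+ (2 * r) * n%:R ^+ m * p%:R ^+ r * D%:R ^+ (7 * (l.*2 - m - r)) *
  (Num.min 1 (K%:R ^+ l / K%:R ^+ (m + r))) ^+ 2 <= ze ^+ l.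
Proof.
move=> ml rl; have K0 : 0 < K%:R :> R by rewrite ltr0n.
have pow x i : 0 <= x -> x <= ze -> 0 <= x ^+ i <= ze ^+ i.
  move=> x0 xz; rewrite exprn_ge0//= lerXn2r// nnegrE//; exact: le_trans xz.
have D0 : 0 <= D%:R :> R by [].
have n0 : 0 <= n%:R :> R by []. have p0 : 0 <= p%:R :> R by [].
have w0 : 0 <= rho ^+ 2 * p%:R by rewrite mulr_ge0// exprn_ge0.
set X := Num.min _ _.
have X0 : 0 <= X by rewrite le_min ler01 divr_ge0// exprn_ge0// ltW.
have z1 : 0 <= th * D%:R ^+ 14 by rewrite mulr_ge0// exprn_ge0.
have z2 : 0 <= th * (D%:R ^+ 7 * n%:R) by rewrite !mulr_ge0// exprn_ge0.
have z3 : 0 <= th * (D%:R ^+ 7 * rho ^+ 2 * p%:R) by rewrite !mulr_ge0// exprn_ge0.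
have z4 : 0 <= th * (rho ^+ 2 * p%:R * (n%:R / K%:R ^+ 2)).
  by rewrite mulr_ge0// mulr_ge0// divr_ge0// exprn_ge0// ltW.
have [le|lt] := leqP (m + r) l.
  have [a1 b1] := andP (pow _ (l - m - r)%N z1 ze1).
  have [a2 b2] := andP (pow _ m z2 ze2).
  have [a3 b3] := andP (pow _ r z3 ze3).
  have -> : ze ^+ l = ze ^+ m * ze ^+ r * ze ^+ (l - m - r).
    by rewrite -!exprD; congr (_ ^+ _); clear -le ml rl; lia.
  apply: (@le_trans _ _ ((th * (D%:R ^+ 7 * n%:R)) ^+ m * (th * (D%:R ^+ 7 * rho ^+ 2 * p%:R)) ^+ r *
     (th * D%:R ^+ 14) ^+ (l - m - r))); last by rewrite !ler_pM// mulr_ge0.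
  have -> : (th * (D%:R ^+ 7 * n%:R)) ^+ m * (th * (D%:R ^+ 7 * rho ^+ 2 * p%:R)) ^+ r *
     (th * D%:R ^+ 14) ^+ (l - m - r) =
     th ^+ l * rho ^+ (2 * r) * n%:R ^+ m * p%:R ^+ r * D%:R ^+ (7 * (l.*2 - m - r)).
    have -> : th ^+ l = th ^+ m * th ^+ r * th ^+ (l - m - r).
      by rewrite -!exprD; congr (_ ^+ _); clear -le ml rl; lia.
    have -> : (7 * (l.*2 - m - r) = 7 * m + 7 * r + 14 * (l - m - r))%N by clear -le ml rl; lia.
    by rewrite !exprMn !exprD; ring.
  rewrite -[leRHS]mulr1 ler_wpM2l//; last by rewrite exprn_ile1// ge_min lexx.
  by rewrite !mulr_ge0 ?exprn_ge0.
pose t := (m + r - l)%N.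
have XK : X <= (K%:R ^+ t)^-1.
  rewrite ge_min; apply/orP; right; rewrite (_ : (m + r = l + t)%N); last by rewrite /t; clear -lt ml rl; lia.
  by rewrite exprD invfM mulVKf// expf_neq0// gt_eqF.
have [a1 b1] := andP (pow _ t z4 ze4).
have [a2 b2] := andP (pow _ (l - r)%N z2 ze2).
have [a3 b3] := andP (pow _ (l - m)%N z3 ze3).
have -> : ze ^+ l = ze ^+ (l - r) * ze ^+ (l - m) * ze ^+ t.
  by rewrite -!exprD; congr (_ ^+ _); rewrite /t; clear -lt ml rl; lia.
apply: (@le_trans _ _ ((th * (D%:R ^+ 7 * n%:R)) ^+ (l - r) *
   (th * (D%:R ^+ 7 * rho ^+ 2 * p%:R)) ^+ (l - m) *
   (th * (rho ^+ 2 * p%:R * (n%:R / K%:R ^+ 2))) ^+ t)); last by rewrite !ler_pM// mulr_ge0.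
have -> : (th * (D%:R ^+ 7 * n%:R)) ^+ (l - r) *
   (th * (D%:R ^+ 7 * rho ^+ 2 * p%:R)) ^+ (l - m) *
   (th * (rho ^+ 2 * p%:R * (n%:R / K%:R ^+ 2))) ^+ t =
   th ^+ l * rho ^+ (2 * r) * n%:R ^+ m * p%:R ^+ r * D%:R ^+ (7 * (l.*2 - m - r)) *
   ((K%:R ^+ t)^-1) ^+ 2.
  have -> : th ^+ l = th ^+ (l - r) * th ^+ (l - m) * th ^+ t.
    by rewrite -!exprD; congr (_ ^+ _); rewrite /t; clear -lt ml rl; lia.
  have -> : (7 * (l.*2 - m - r) = 7 * (l - r) + 7 * (l - m))%N by clear -lt ml rl; lia.
  have -> : n%:R ^+ m = n%:R ^+ (l - r) * n%:R ^+ t :> R.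
    by rewrite -exprD; congr (_ ^+ _); rewrite /t; clear -lt ml rl; lia.
  have -> : p%:R ^+ r = p%:R ^+ (l - m) * p%:R ^+ t :> R.
    by rewrite -exprD; congr (_ ^+ _); rewrite /t; clear -lt ml rl; lia.
  have -> : rho ^+ (2 * r) = (rho ^+ 2) ^+ (l - m) * (rho ^+ 2) ^+ t.
    by rewrite -exprD -exprM; congr (_ ^+ _); rewrite /t; clear -lt ml rl; lia.
  have -> : (K%:R ^+ t)^-1 ^+ 2 = ((K%:R ^+ 2)^-1) ^+ t :> R.
    by rewrite !exprVn -!exprM mulnC.
  rewrite exprD !exprM !exprMn; ring.
by rewrite ler_wpM2l ?lerXn2r ?nnegrE// ?invr_ge0 ?exprn_ge0// !mulr_ge0 ?exprn_ge0.
Qed.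

End Budget.

Lemma linked_rows (A Rw Cl : finType) (u : A -> Rw) (v : A -> Cl) i1 i2 :
  i1 != i2 -> linked u v i1 i2 -> i1 \in u @: A /\ i2 \in u @: A.
Proof.
move=> i12 lk; split; apply/negP => /negP ni.
  have cl s : (u s \in [set i1]) = (v s \in set0).
    by rewrite !inE; apply: contraNF ni => /eqP <-; exact: imset_f.
  by have [] := lk _ _ cl; rewrite !inE ?eqxx// eq_sym (negbTE i12).
have cl s : (u s \in ~: [set i2]) = (v s \in setT).
  by rewrite !inE; apply: contraNneq ni => <-; exact: imset_f.
by have [] := lk _ _ cl; rewrite !inE ?eqxx.
Qed.

Lemma fiber_moment_neq0 (A Q : finType) (f : A -> Q) q :
  fiber_moment setT f != 0%N -> ~~ odd #|fiber setT f q|.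
Proof.
apply: contraNN => od; apply/eqP; rewrite /fiber_moment (bigD1 q)//=.
by rewrite gauss_moment_odd.
Qed.

(** * Squared cumulants of a given degree *)

Section LevelSum.
Variables (R : realFieldType) (Rw Cl : finType) (Z : finZmodType) (i1 i2 : Rw).
Variables (lam rho ze : R) (D : nat).
Hypotheses (rho_ge0 : 0 <= rho) (rho_le1 : rho <= 1) (lam_ge0 : 0 <= lam).
Hypotheses (i12 : i1 != i2).
Let n := #|Rw|.
Let p := #|Cl|.
Let K := #|Z|.
Hypotheses (ze1 : lam ^+ 4 * D%:R ^+ 14 <= ze) (ze2 : lam ^+ 4 * (D%:R ^+ 7 * n%:R) <= ze)
  (ze3 : lam ^+ 4 * (D%:R ^+ 7 * rho ^+ 2 * p%:R) <= ze)
  (ze4 : lam ^+ 4 * (rho ^+ 2 * p%:R * (n%:R / K%:R ^+ 2)) <= ze).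

(* A nonzero cumulant always involves both i1 and i2, which may therefore
   weigh more than the other rows. *)
Definition row_weight (b : Rw) : R :=
  if (b == i1) || (b == i2) then D%:R ^- 2 else n%:R^-1.

Let K_gt0 : (0 < K)%N. Proof. by apply/card_gt0P; exists 0. Qed.
Let n_gt0 : (0 < n)%N. Proof. by apply/card_gt0P; exists i1. Qed.

Lemma prod_row_weight (S : {set Rw}) : i1 \in S -> i2 \in S ->
  \prod_(b in S) row_weight b = D%:R ^- 4 * n%:R ^- (#|S| - 2).
Proof.
move=> h1 h2; rewrite (bigD1 i1)//= (bigD1 i2)/=; last by rewrite h2 eq_sym.
rewrite {1 2}/row_weight !eqxx orbT /= mulrA -invfM -exprD; congr (_ * _).
rewrite (eq_bigr (fun=> n%:R^-1)); last first.
  by move=> b /andP[/andP[_ b1] b2]; rewrite /row_weight (negbTE b1) (negbTE b2).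
rewrite prodr_const exprVn; congr (_ ^- _).
rewrite (cardsD1 i1) h1 (cardsD1 i2) !inE h2 eq_sym i12 /= !add1n subn2 /=.
by apply: eq_card => b; rewrite unfold_in /= !inE; case: (b \in S); rewrite ?andbF// !andbT andbC.
Qed.

Section OneFamily.
Variables (A : finType) (u : A -> Rw) (v : A -> Cl) (l : nat).
Hypotheses (Al : #|A| = l.*2) (lD : (l.*2 <= D)%N).
Variable k : {set A} -> R.
Hypothesis kE : forall S, model_moment u v lam rho (@same_label R Rw Z i1 i2) S =
  \sum_(T : {set A} | T \subset S)
    k T * model_moment u v lam rho (fun _ : {ffun Rw -> Z} => 1) (S :\: T).
Hypothesis lk : linked u v i1 i2.
Hypotheses (ue : fiber_moment setT u != 0%N) (ve : fiber_moment setT v != 0%N).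
Let m := #|u @: A|.
Let r := #|v @: A|.

Let card_even (Q : finType) (f : A -> Q) : fiber_moment setT f != 0%N -> (#|f @: A| <= l)%N.
Proof.
move=> fe; rewrite -leq_double -Al -cardsT -(sum_card_fiber f) -mul2n -sum1_card big_distrr /=.
rewrite muln1 big_mkcond; apply: leq_sum => q _; case: ifP => // /imsetP[s _ ->].
have := fiber_moment_neq0 (f s) fe.
have : (0 < #|fiber setT f (f s)|)%N by apply/card_gt0P; exists s; rewrite !inE eqxx.
by case: #|_| => [|[]].
Qed.

(** Every vertex that occurs has positive even degree, hence at least two of the 2 l edges, and both
    [i1] and [i2] occur. In particular l is at least 2, so degree 2 contributes nothing. *)
Lemma family_size : (2 <= m <= l)%N /\ (r <= l)%N.
Proof.
split; last exact: card_even ve.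
rewrite (card_even ue) andbT; have [h1 h2] := linked_rows i12 lk.
by rewrite /m (cardsD1 i1) h1 (cardsD1 i2) !inE h2 eq_sym i12.
Qed.

(** The target power of [D] is that of [budget] for m - 2 rows, namely 7 (y + 2). Beyond 7 y, the
    extra 14 consists of 3 for the surplus factor [N ^+ 2], 4 for the weights of [i1] and [i2], and
    the explicit [D%:R ^- 7], kept to absorb constants later. *)
Lemma cumulant_sqr_le :
  k setT ^+ 2 <= K%:R ^- 2 * ze ^+ l * D%:R ^- 7 *
    ((\prod_(b in u @: A) row_weight b * (D%:R ^- 2) ^+ (l - m)) *
     (\prod_(b in v @: A) p%:R^-1 * (D%:R ^- 2) ^+ (l - r))).
Proof.
have [/andP[m2 ml] rl] := family_size; have [h1 h2] := linked_rows i12 lk.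
rewrite prod_row_weight// prodr_const exprVn -/m -/r.
have D4 : (4 <= D)%N by clear -m2 ml lD; lia.
have D0 : 0 < D%:R :> R by rewrite ltr0n; clear -D4; lia.
have n0 : 0 < n%:R :> R by rewrite ltr0n.
have K0 : 0 < K%:R :> R by rewrite ltr0n.
have p0 : 0 < p%:R :> R.
  rewrite ltr0n; have := h1 => /imsetP[s _ _]; apply/card_gt0P; by exists (v s).
pose y := (l.*2 - m - r)%N.
have yE : y = (l - m + (l - r))%N by rewrite /y; clear -m2 ml rl lD; lia.
have Mle : (fiber_moment setT v * fiber_moment setT u <= D ^ y)%N.
  have Dpos : (0 < D ^ (m + r))%N by rewrite expn_gt0; clear -D4; lia.
  rewrite -(leq_pmul2r Dpos) -expnD (_ : y + (m + r) = l + l)%N; last by rewrite /y; clear -m2 ml rl lD; lia.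
  rewrite [X in (_ * D ^ X)%N]addnC !expnD mulnACA.
  by rewrite leq_mul// fiber_moment_le_pow.
pose Mc := fiber_moment setT v; pose Mr := fiber_moment setT u.
rewrite -/Mc -/Mr in Mle.
(* Taking [1 / K] out of the minimum lowers the exponent m + r by two, which is the shape of
   [budget] for m - 2 rows. *)
pose X : R := Num.min 1 (K%:R ^+ l / K%:R ^+ ((m - 2) + r)).
have X0 : 0 <= X by rewrite le_min ler01 divr_ge0// exprn_ge0// ltW.
have minE : Num.min K%:R^-1 (K%:R ^+ (#|A| %/ 2).+1 / K%:R ^+ (m + r)) = K%:R^-1 * X.
  rewrite /X minr_pMr ?invr_ge0 ?ler0n// mulr1; congr Num.min.
  rewrite Al (_ : l.*2 %/ 2 = l)%N; last by clear -m2; lia.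
  rewrite (_ : (m + r = (m - 2 + r).+2)%N); last by clear -m2; lia.
  by rewrite !exprS; field; rewrite expf_neq0// gt_eqF.
have := cumulant_bound rho_ge0 rho_le1 lam_ge0 i12 kE lk.
rewrite -/m -/r minE -/Mc -/Mr Al.
have -> : l.*2.+1%:R ^+ l.*2.+1 / l.*2.+1%:R ^+ (m + r) = l.*2.+1%:R ^+ y.+1 :> R.
  have -> : l.*2.+1 = (y.+1 + (m + r))%N by rewrite /y; clear -m2 ml rl lD; lia.
  by rewrite [in X in X / _]exprD mulfK// expf_neq0// pnatr_eq0.
set N : R := l.*2.+1%:R.
rewrite -(ler_sqr _) ?nnegrE ?normr_ge0//; last first.
  by rewrite !mulr_ge0 ?exprn_ge0 ?invr_ge0.
rewrite real_normK ?num_real// => bound; apply: le_trans bound _.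
(* [N] is at most D + 1, and (D + 1)^2 <= D^3 because D >= 4. *)
have N3 : N ^+ 2 <= D%:R ^+ 3.
  rewrite /N -!natrX ler_nat (leq_trans (_ : _ <= D.+1 ^ 2)%N)//.
    by rewrite leq_exp2r.
  by clear -D4; nia.
have MleR : (Mc%:R * Mr%:R) ^+ 2 <= D%:R ^+ (2 * y) :> R.
  by rewrite -natrM -!natrX ler_nat (mulnC 2%N y) expnM leq_exp2r.
have NleR : N ^+ (2 * y.+1) <= D%:R ^+ (3 * y.+1).
  by rewrite !exprM lerXn2r// nnegrE exprn_ge0.
have ze_ge0 : 0 <= ze by apply: le_trans ze1; rewrite mulr_ge0 ?exprn_ge0// ltW.
have B := budget (D := D) (n := n) (p := p) (exprn_ge0 4 lam_ge0) rho_ge0 K_gt0 ze1 ze2 ze3 ze4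
  (leq_trans (leq_subr 2 m) ml) rl.
rewrite -/X in B.
have yB : (l.*2 - (m - 2) - r = y + 2)%N by rewrite /y; clear -m2 ml rl lD; lia.
rewrite yB in B.
have E1 : (lam ^+ l.*2 * rho ^+ r * (Mc%:R * (Mr%:R * (N ^+ y.+1 * (K%:R^-1 * X))))) ^+ 2 =
   K%:R ^- 2 * (((lam ^+ 4) ^+ l * rho ^+ (2 * r) * X ^+ 2) *
      ((Mc%:R * Mr%:R) ^+ 2 * N ^+ (2 * y.+1))).
  rewrite -exprM (_ : 4 * l = l.*2 * 2)%N; last by clear -m2; lia.
  rewrite (mulnC 2 r) (mulnC 2 y.+1) !exprMn -!exprM exprVn; ring.
rewrite E1; apply: (@le_trans _ _ (K%:R ^- 2 * (((lam ^+ 4) ^+ l * rho ^+ (2 * r) * X ^+ 2) *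
      (D%:R ^+ (2 * y) * D%:R ^+ (3 * y.+1))))).
  rewrite ler_wpM2l ?invr_ge0 ?exprn_ge0//; apply: ler_wpM2l.
    by rewrite !mulr_ge0 ?exprn_ge0.
  apply: ler_pM => //; first exact: sqr_ge0.
  by rewrite exprn_ge0 // /N ler0n.
rewrite -!mulrA ler_wpM2l ?invr_ge0 ?exprn_ge0//.
have P0 : 0 < n%:R ^+ (m - 2) * p%:R ^+ r * D%:R ^+ (2 * y + 11) :> R.
  by rewrite !mulr_gt0// exprn_gt0.
rewrite -(ler_pM2r P0).
rewrite [leRHS](_ : _ = ze ^+ l); last first.
  have -> : D%:R ^+ (2 * y + 11) = D%:R ^+ 7 * D%:R ^+ 4 * ((D%:R ^+ 2) ^+ (l - m) * (D%:R ^+ 2) ^+ (l - r)) :> R.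
    by rewrite -!exprM -!exprD yE; congr (_ ^+ _); clear; lia.
  rewrite !exprVn; field.
  by rewrite !expf_neq0 ?gt_eqF ?exprn_gt0.
apply: le_trans B; rewrite le_eqVlt; apply/orP; left; apply/eqP.
have -> : (7 * (y + 2) = (2 * y) + (3 * y.+1) + (2 * y + 11))%N by clear; lia.
rewrite !exprD; ring.
Qed.

End OneFamily.
End LevelSum.

Section LevelSumTuples.
Variables (R : realFieldType) (Rw Cl : finType) (Z : finZmodType) (i1 i2 : Rw).
Variables (lam rho ze : R) (D : nat).
Hypotheses (rho_ge0 : 0 <= rho) (rho_le1 : rho <= 1) (lam_ge0 : 0 <= lam).
Hypotheses (i12 : i1 != i2).
Let n := #|Rw|.
Let p := #|Cl|.
Let K := #|Z|.
Hypotheses (ze1 : lam ^+ 4 * D%:R ^+ 14 <= ze) (ze2 : lam ^+ 4 * (D%:R ^+ 7 * n%:R) <= ze)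
  (ze3 : lam ^+ 4 * (D%:R ^+ 7 * rho ^+ 2 * p%:R) <= ze)
  (ze4 : lam ^+ 4 * (rho ^+ 2 * p%:R * (n%:R / K%:R ^+ 2)) <= ze).

Definition row_of L (e : L.-tuple (Rw * Cl)) (s : 'I_L) : Rw := (tnth e s).1.
Definition col_of L (e : L.-tuple (Rw * Cl)) (s : 'I_L) : Cl := (tnth e s).2.

Variables (L : nat) (k : L.-tuple (Rw * Cl) -> {set 'I_L} -> R).
Hypotheses (L_gt0 : (0 < L)%N) (LD : (L <= D)%N).
Hypothesis kE : forall e S,
  model_moment (row_of e) (col_of e) lam rho (@same_label R Rw Z i1 i2) S =
  \sum_(T : {set 'I_L} | T \subset S) k e T *
    model_moment (row_of e) (col_of e) lam rho (fun _ : {ffun Rw -> Z} => 1) (S :\: T).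

(** The fibre moments are factors of the bound on a cumulant, so a vertex of odd degree makes the
    cumulant vanish. *)
Lemma cumulant_neq0 e : k e setT != 0 -> [/\ linked (row_of e) (col_of e) i1 i2,
  fiber_moment setT (row_of e) != 0%N & fiber_moment setT (col_of e) != 0%N].
Proof.
move=> k0; have lk : linked (row_of e) (col_of e) i1 i2.
  apply: contrapT => nl; move/eqP: k0; apply.
  by apply: (cumulant_not_linked i12 (kE e)) => //; rewrite card_ord.
have := cumulant_bound rho_ge0 rho_le1 lam_ge0 i12 (kE e) lk.
move=> h; split=> //; apply: contraNneq k0 => m0; move: h; rewrite m0.
  by rewrite mul0r !mulr0 normr_le0.
by rewrite mul0r mulr0 normr_le0.
Qed.

Let n_gt0 : (0 < n)%N. Proof. by apply/card_gt0P; exists i1. Qed.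

Lemma odd_level_sum : odd L -> \sum_e k e setT ^+ 2 = 0.
Proof.
move=> oL; apply: big1 => e _; apply/eqP; rewrite sqrf_eq0; apply: contraLR oL.
move=> /cumulant_neq0 [_ ue _]; rewrite -[L]card_ord -cardsT -(sum_card_fiber (row_of e)).
elim/big_rec: _ => // b x _ nx; rewrite oddD (negbTE nx).
by rewrite (negbTE (fiber_moment_neq0 b ue)).
Qed.

Lemma card_fiber_row (e : L.-tuple (Rw * Cl)) b :
  #|fiber setT (row_of e) b| = count_mem b [tuple of map fst e].
Proof.
rewrite -counts_tnth ffunE; apply: eq_card => s.
by rewrite !inE tnth_map.
Qed.

Lemma card_fiber_col (e : L.-tuple (Rw * Cl)) b :
  #|fiber setT (col_of e) b| = count_mem b [tuple of map snd e].
Proof.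
rewrite -counts_tnth ffunE; apply: eq_card => s.
by rewrite !inE tnth_map.
Qed.

Lemma imset_row (e : L.-tuple (Rw * Cl)) b :
  (b \in row_of e @: 'I_L) = (b \in [tuple of map fst e]).
Proof.
apply/imsetP/tnthP => -[s].
  by move=> _ ->; exists s; rewrite tnth_map.
by move=> ->; exists s => //; rewrite tnth_map.
Qed.

Lemma imset_col (e : L.-tuple (Rw * Cl)) b :
  (b \in col_of e @: 'I_L) = (b \in [tuple of map snd e]).
Proof.
apply/imsetP/tnthP => -[s].
  by move=> _ ->; exists s; rewrite tnth_map.
by move=> ->; exists s => //; rewrite tnth_map.
Qed.

(** The bound on a squared cumulant is a row weight times a column weight, and a tuple of edges is a
    pair of tuples, so the two sums are taken separately. Each is at most twice a Gaussian moment: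
    the factor 4 is absorbed by [D%:R ^- 7], the two moments by the factorial of [L]. *)
Lemma level_sum_le l : L = l.*2 ->
  (L`!)%:R^-1 * \sum_e k e setT ^+ 2 <= (1 < l)%:R * (K%:R ^- 2 * ze ^+ l).
Proof.
move=> Ll; have ze_ge0 : 0 <= ze by apply: le_trans ze1; rewrite mulr_ge0 ?exprn_ge0.
have AL : #|'I_L| = l.*2 by rewrite card_ord.
have lD : (l.*2 <= D)%N by rewrite -Ll.
have [l2|l1] := ltnP 1 l; last first.
  rewrite mul0r big1 ?mulr0// => e _; apply/eqP; rewrite sqrf_eq0; apply: contraTT l1.
  move=> /cumulant_neq0 [lk ue ve]; rewrite -ltnNge.
  have [/andP[h1 h2] _] := family_size i12 AL lk ue ve.
  exact: leq_trans h1 h2.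
rewrite mul1r; pose dl : R := D%:R ^- 2.
have D4 : (4 <= D)%N by clear -l2 lD; lia.
have D0 : 0 < D%:R :> R by rewrite ltr0n; clear -D4; lia.
have dl0 : 0 <= dl by rewrite invr_ge0 exprn_ge0// ltW.
pose C := K%:R ^- 2 * ze ^+ l * D%:R ^- 7.
have C0 : 0 <= C by rewrite !mulr_ge0 ?invr_ge0 ?exprn_ge0// ltW.
pose G (t : L.-tuple Rw) := tuple_weight (row_weight R i1 i2 D) dl l t.
pose H (t : L.-tuple Cl) := tuple_weight (fun=> p%:R^-1 : R) dl l t.
have rw0 b : 0 <= row_weight R i1 i2 D b.
  by rewrite /row_weight; case: ifP => _; rewrite ?invr_ge0 ?exprn_ge0// ltW.
have G0 t : 0 <= G t by exact: tuple_weight_ge0.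
have H0 t : 0 <= H t by apply: tuple_weight_ge0 => // b; rewrite invr_ge0.
pose ev (x : L.-tuple Rw * L.-tuple Cl) := even_tuple x.1 && even_tuple x.2.
pose sp (e : L.-tuple (Rw * Cl)) := ([tuple of map fst e], [tuple of map snd e]).
have b1 : \sum_e k e setT ^+ 2 <= \sum_(x | ev x) C * (G x.1 * H x.2).
  apply: (@le_trans _ _ (\sum_(e | ev (sp e)) C * (G (sp e).1 * H (sp e).2))).
    rewrite [leRHS]big_mkcond /=; apply: ler_sum => e _.
    have [k0|k0] := eqVneq (k e setT) 0.
      by rewrite k0 expr0n /=; case: ifP => // _; apply: mulr_ge0 => //; exact: mulr_ge0.
    have [lk ue ve] := cumulant_neq0 k0.
    rewrite ifT; last first.
      apply/andP; split; apply/forallP => b.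
        by rewrite -card_fiber_row (fiber_moment_neq0 b ue).
      by rewrite -card_fiber_col (fiber_moment_neq0 b ve).
    have h := cumulant_sqr_le rho_ge0 rho_le1 lam_ge0 i12 ze1 ze2 ze3 ze4 AL lD (kE e) lk ue ve.
    apply: le_trans h _; rewrite le_eqVlt; apply/orP; left; apply/eqP.
    rewrite /C /G /H /tuple_weight; congr (_ * (_ * _)).
      rewrite (eq_bigl _ _ (imset_row e)); congr (_ * _ ^+ (_ - _)).
      by apply: eq_card => b; rewrite imset_row in_set.
    rewrite (eq_bigl _ _ (imset_col e)); congr (_ * _ ^+ (_ - _)).
    by apply: eq_card => b; rewrite imset_col in_set.
  apply: (sum_image_le (g := sp) (F := fun x => C * (G x.1 * H x.2))) => //.
    move=> e e' _ _ [] e1 e2.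
    apply: val_inj; rewrite /= -[LHS](zip_unzip e) -[RHS](zip_unzip e').
    by rewrite /unzip1 /unzip2 e1 e2.
  by move=> x _; apply: mulr_ge0 => //; exact: mulr_ge0.
have b2 : \sum_(x | ev x) C * (G x.1 * H x.2) =
   C * ((\sum_(t | even_tuple t) G t) * (\sum_(t | even_tuple t) H t)).
  rewrite -mulr_sumr; congr (_ * _).
  rewrite mulr_suml; under [RHS]eq_bigr do rewrite mulr_sumr.
  by rewrite pair_big.
have lR : l%:R <= D%:R / 2 :> R.
  by rewrite ler_pdivlMr// -natrM ler_nat; clear -lD; lia.
have e4 : 4^-1 <= 2^-1 :> R by lra.
have D4R : 4 <= D%:R :> R by rewrite (ler_nat R 4).
have dlD : dl * (D%:R * D%:R) = 1 by rewrite /dl -expr2 mulVf// expf_neq0// gt_eqF.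
have dlD1 : dl * D%:R <= 4^-1.
  have -> : dl * D%:R = D%:R^-1 by rewrite /dl; field; rewrite gt_eqF.
  by rewrite lef_pV2 ?posrE.
have l0 : 0 <= l%:R :> R by [].
have ll : l%:R * l%:R * dl <= 4^-1.
  apply: (@le_trans _ _ (D%:R / 2 * (D%:R / 2) * dl)); first by rewrite ler_wpM2r// ler_pM.
  have -> : D%:R / 2 * (D%:R / 2) * dl = dl * (D%:R * D%:R) / 4.
    by move: (dl) => x; field.
  by rewrite dlD; lra.
have ld : l%:R * dl <= 8^-1.
  apply: (@le_trans _ _ (D%:R / 2 * dl)); first by rewrite ler_wpM2r.
  by rewrite mulrAC (mulrC _ dl); lra.
have SG : \sum_(t | even_tuple t) G t <= (gauss_moment l.*2)%:R * 2.
  (* The generic rows weigh at most 1 in total, while [i1] and [i2] weigh [dl] each. *)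
  have wle : \sum_b row_weight R i1 i2 D b <= 1 + 2 * dl.
    rewrite (bigD1 i1)//= (bigD1 i2)/=; last by rewrite eq_sym.
    rewrite {1 2}/row_weight !eqxx orbT -/dl addrA addrC lerD//; last by lra.
    apply: (@le_trans _ _ (\sum_(b : Rw) n%:R^-1)).
      rewrite big_mkcond; apply: ler_sum => b _; case: ifP => [/andP[h1 h2]|_].
        by rewrite /row_weight (negbTE h1) (negbTE h2).
      by rewrite invr_ge0.
    by rewrite sumr_const -[_ *+ _]mulr_natl mulfV// pnatr_eq0 -lt0n.
  have h := sum_even_tuples rw0 dl0 wle l.
  rewrite /G Ll; apply: le_trans h _; rewrite ler_wpM2l//.
  rewrite -addrA; apply: pow1D_le2; first by rewrite addr_ge0// mulr_ge0.
  (* Both l times 2 [dl] and l^2 times [dl] are at most 1/4, by [ld] and [ll]. *)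
  by rewrite mulrDr mulrA; nra.
have p_sum : \sum_(b : Cl) p%:R^-1 <= 1 :> R.
  rewrite sumr_const -[_ *+ _]mulr_natl; have [->|p0] := eqVneq (#|Cl|%:R : R) 0.
    by rewrite mul0r.
  by rewrite mulfV.
have SH : \sum_(t | even_tuple t) H t <= (gauss_moment l.*2)%:R * 2.
  have p0 (b : Cl) : 0 <= p%:R^-1 :> R by rewrite invr_ge0.
  have h := sum_even_tuples p0 dl0 p_sum l.
  rewrite /H Ll; apply: le_trans h _; rewrite ler_wpM2l//.
  apply: pow1D_le2; first by rewrite mulr_ge0.
  rewrite mulrA; exact: le_trans ll e4.
have fact0 : 0 < (L`!)%:R :> R by rewrite ltr0n fact_gt0.
rewrite ler_pdivrMl//; apply: le_trans b1 _; rewrite b2.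
apply: (@le_trans _ _ (C * (((gauss_moment l.*2)%:R * 2) * ((gauss_moment l.*2)%:R * 2)))).
  by rewrite ler_wpM2l// ler_pM// sumr_ge0.
have gle : (gauss_moment l.*2)%:R ^+ 2 <= (L`!)%:R :> R.
  by rewrite -natrX ler_nat Ll gauss_moment_sqr_le.
have D7 : D%:R ^- 7 * 4 <= 1 :> R.
  rewrite ler_pdivrMl ?exprn_gt0// mulr1 -[leLHS]expr1.
  apply: (@le_trans _ _ (D%:R ^+ 1)); first by rewrite !expr1.
  by rewrite ler_weXn2l//; lra.
rewrite (_ : C * _ = K%:R ^- 2 * ze ^+ l * ((D%:R ^- 7 * 4) * (gauss_moment l.*2)%:R ^+ 2)); last first.
  by rewrite /C; ring.
rewrite [leRHS]mulrC ler_wpM2l ?mulr_ge0 ?invr_ge0 ?exprn_ge0//.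
by rewrite -[leRHS]mul1r ler_pM// ?exprn_ge0// mulr_ge0// invr_ge0 exprn_ge0// ltW.
Qed.

End LevelSumTuples.

(** * Summation over the degrees *)

Section GeometricBound.
Variable R : rcfType.

(** The even degrees form a geometric series that starts at ze^2, hence is at most ze^2 / (1 - ze).
    With s the square root of ze this reads s^4 / (1 - s^2), which is below s^2 / (1 - s)^3. *)
Lemma even_geometric_sum (c ze : R) D (f : nat -> R) : 0 <= c -> 0 <= ze -> ze < 1 ->
  f 0%N <= c -> (forall L, odd L -> (L <= D)%N -> f L <= 0) ->
  (forall l, (0 < l)%N -> (l.*2 <= D)%N -> f l.*2 <= (1 < l)%:R * (c * ze ^+ l)) ->
  \sum_(L < D.+1) f L <= c * (1 + ze / (1 - Num.sqrt ze) ^+ 3).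
Proof.
move=> c0 z0 z1 f0 fo fe.
pose T m : R := \sum_(l < m.+1) (1 < l)%:R * ze ^+ l.
(* The telescoped series, an equality for m > 0. The factor [0 < m] suppresses the last term at m =
   0, where nothing has been summed yet. *)
have TE m : T m * (1 - ze) + (0 < m)%:R * ze ^+ m.+1 <= ze ^+ 2.
  elim: m => [|m IH].
    by rewrite /T big_ord1 mul0r !mul0r addr0 exprn_ge0.
  rewrite /T big_ord_recr /= -/(T m); move: IH.
  case: m => [|m]; last by rewrite /= !mul1r !exprS; nra.
  by rewrite /T big_ord1 !mul0r !add0r => _; lra.
have H d : (d <= D)%N -> \sum_(L < d.+1) f L <= c * (1 + T d./2).
  elim: d => [|d IH] dD.
    by rewrite big_ord1 /T big_ord1 mul0r addr0 mulr1.
  rewrite big_ord_recr /=; have := IH (ltnW dD).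
  have [od|ed] := boolP (odd d).
    have dE : d.+1 = ((d./2).+1).*2 by rewrite -[in LHS](odd_double_half d) od.
    have := fe (d./2).+1 isT; rewrite -dE => /(_ dD) h1 h2.
    rewrite uphalf_half od add1n.
    have -> : T (d./2).+1 = T d./2 + (1 < (d./2).+1)%:R * ze ^+ (d./2).+1.
      by rewrite /T big_ord_recr.
    apply: le_trans (lerD h2 h1) _; rewrite le_eqVlt; apply/orP; left; apply/eqP; ring.
  rewrite uphalf_half (negbTE ed) add0n => h.
  by have := fo d.+1; rewrite /= ed => /(_ isT dD) h2; lra.
apply: le_trans (H D (leqnn D)) _; rewrite ler_wpM2l// lerD2l.
set s := Num.sqrt ze; have zs : ze = s ^+ 2 by rewrite sqr_sqrtr.
have s0 : 0 <= s by exact: sqrtr_ge0.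
have s1 : s < 1 by rewrite -(ltr_pXn2r (n := 2))// ?nnegrE// -zs expr1n.
have := TE D./2; set t := T _.
have : 0 <= (0 < D./2)%:R * ze ^+ (D./2).+1 by rewrite mulr_ge0 ?exprn_ge0.
move=> h1 h2; have {h1 h2} h : t * (1 - ze) <= ze ^+ 2 by lra.
rewrite ler_pdivlMr ?exprn_gt0 ?subr_gt0//.
have u1 : 0 <= (1 - s) ^+ 3 by rewrite exprn_ge0// subr_ge0 ltW.
have u2 : 0 < 1 - ze by rewrite subr_gt0.
rewrite -(ler_pM2r u2) mulrAC; apply: le_trans (ler_wpM2r u1 h) _.
rewrite zs; set v := 1 - s; have -> : s = 1 - v by rewrite /v; lra.
have v0 : 0 < v by rewrite /v; lra.
have v1 : v <= 1 by rewrite /v; lra.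
have -> : 1 - (1 - v) ^+ 2 = v * (2 - v) by ring.
rewrite expr2 -mulrA; apply: ler_wpM2l; first exact: sqr_ge0.
have -> : (1 - v) ^+ 2 * v ^+ 3 = v * ((1 - v) ^+ 2 * v ^+ 2) by ring.
rewrite ler_pM2l//.
have a1 : (1 - v) ^+ 2 <= 1 by rewrite expr_le1//; lra.
have a2 : v ^+ 2 <= 1 by rewrite expr_le1//; lra.
have a3 : 0 <= v ^+ 2 by exact: sqr_ge0.
have : (1 - v) ^+ 2 * v ^+ 2 <= 1 * v ^+ 2 by rewrite ler_wpM2r.
lra.
Qed.

End GeometricBound.

(** Both sides sum the products of [a], [k] and [g] over the splittings of [A] into three parts.
    With [a] the signal moments, [k] the cumulants and [g] the noise moments, it equates the moments
    of the proxy and of the target. *)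
Lemma convolution_swap (R : comNzRingType) (A : finType) (a b k g : {set A} -> R) :
  (forall S, b S = \sum_(T : {set A} | T \subset S) k T * a (S :\: T)) ->
  \sum_(S : {set A}) a S * \sum_(T : {set A} | T \subset ~: S) k T * g (~: S :\: T) =
  \sum_(S : {set A}) b S * g (~: S).
Proof.
move=> bE; under [RHS]eq_bigr do rewrite bE mulr_suml.
under [LHS]eq_bigr do rewrite mulr_sumr.
rewrite [LHS](exchange_big_dep xpredT) //= [RHS](exchange_big_dep xpredT) //=.
apply: eq_bigr => T _; rewrite [RHS](reindex_onto (fun S => T :|: S) (fun S => S :\: T)) /=.
  have dis S : T \subset ~: S -> (T :|: S) :\: T = S.
    move=> /subsetP TS; apply/setP => s; rewrite !inE; case: (boolP (s \in T)) => //= sT.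
    by have := TS s sT; rewrite inE => /negbTE ->.
  apply: eq_big => S.
    rewrite subsetUl /=; apply/idP/eqP => [/dis//|<-].
    by apply/subsetP => s sT; rewrite !inE sT.
  move=> TS; rewrite mulrCA mulrA; congr (_ * _ * g _); last by rewrite setCU setDE setIC.
  by rewrite dis.
move=> S TS; apply/setP => s; rewrite !inE.
by case: (boolP (s \in T)) => //= /(subsetP TS) ->.
Qed.

(* From here on set0, setT, ... denote classical sets. *)
From mathcomp Require Import all_classical all_reals all_analysis.
From mathcomp Require Import measurable_realfun simple_functions.
From mathcomp Require Import -(notations) mpoly.

Import numFieldNormedType.Exports.

Local Open Scope classical_set_scope.
Local Open Scope ring_scope.

(** * Independence and Gaussian integrals *)

Section WeightedTransfer.
Local Open Scope ereal_scope.
Context d (T : measurableType d) d' (U : measurableType d') (R : realType).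
Variables (mu : {measure set T -> \bar R}) (nu : {measure set U -> \bar R}).
Import HBNNSimple.

(** Extension from indicators to nonnegative functions by monotone approximation. The weight [w]
    will be the product of the other factors when independence is exploited, and a density when a
    law is integrated. *)
Lemma weighted_transfer (w : T -> R) (V : T -> U) (c : R) (phi : U -> \bar R) :
  measurable_fun [set: T] w -> (forall t, (0 <= w t)%R) ->
  measurable_fun [set: T] V -> (0 <= c)%R ->
  (forall B, measurable B ->
     \int[mu]_t ((w t)%:E * (\1_(V @^-1` B) t)%:E) = c%:E * nu B) ->
  measurable_fun [set: U] phi -> (forall y, 0 <= phi y) ->
  \int[mu]_t ((w t)%:E * phi (V t)) = c%:E * \int[nu]_y phi y.
Proof.
move=> mw w0 mV c0 H mphi phi0.
pose h := nnsfun_approx measurableT mphi.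
have cvgh y : (EFin \o h n) y @[n --> \oo] --> phi y.
  by apply: cvg_nnsfun_approx.
have ndh y : {homo (fun n => h n y) : a b / (a <= b)%N >-> (a <= b)%R}.
  by move=> a b ab; exact/lefP/nd_nnsfun_approx.
have -> : \int[nu]_y phi y = lim (\int[nu]_y (EFin \o h n) y @[n --> \oo]).
  rewrite -monotone_convergence//.
  - by apply: eq_integral => y _; apply/esym/cvg_lim => //; exact: cvgh.
  - by move=> n; apply/measurable_EFinP; exact/measurable_funP.
  - by move=> n x _ //=; rewrite lee_fin.
  - by move=> x _ a b ab; rewrite lee_fin; exact: ndh.
have mVh n : measurable_fun [set: T] (fun t => (h n (V t))%:E).
  by apply/measurable_EFinP; apply: measurableT_comp => //.
have -> : \int[mu]_t ((w t)%:E * phi (V t)) =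
    lim (\int[mu]_t ((w t)%:E * (h n (V t))%:E) @[n --> \oo]).
  rewrite -monotone_convergence//.
  - apply: eq_integral => y _; apply/esym/cvg_lim => //; apply: cvgeZl => //.
    exact: cvgh.
  - by move=> n; apply: emeasurable_funM => //; exact/measurable_EFinP.
  - by move=> n x _ //=; rewrite mule_ge0 ?lee_fin.
  - move=> x _ a b ab; rewrite lee_wpmul2l ?lee_fin //; exact: ndh.
have suf n : \int[mu]_t ((w t)%:E * (h n (V t))%:E) =
    c%:E * \int[nu]_y (EFin \o h n) y.
  have hE y : (h n y)%:E = \sum_(z \in range (h n)) (z * \1_(h n @^-1` [set z]) y)%:E.
    by rewrite /= {1}fimfunE -fsumEFin.
  under [in RHS]eq_integral do rewrite /comp hE.
  rewrite ge0_integral_fsum//; last 2 first.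
  - move=> z; apply/measurable_EFinP; apply: measurable_funM => //.
  - by move=> m y Ey; exact: nnfun_muleindic_ge0.
  rewrite ge0_mule_fsumr; last first.
    by move=> z; apply: integral_ge0 => y _; exact: nnfun_muleindic_ge0.
  transitivity (\int[mu]_t (\sum_(z \in range (h n))
      ((w t)%:E * (z * \1_(h n @^-1` [set z]) (V t))%:E))).
    apply: eq_integral => t _; rewrite hE ge0_mule_fsumr//.
    by move=> z; exact: nnfun_muleindic_ge0.
  have mi z : measurable_fun [set: T]
     (fun t => (w t)%:E * (\1_(h n @^-1` [set z]) (V t))%:E).
    apply: emeasurable_funM; first exact/measurable_EFinP.
    apply/measurable_EFinP; apply: (measurableT_comp _ mV) => //.
  rewrite ge0_integral_fsum//; last 2 first.
  - move=> z.
    rewrite (_ : (fun _ => _) = (fun t => z%:E * ((w t)%:E * (\1_(h n @^-1` [set z]) (V t))%:E))).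
      by apply: measurable_funeM.
    by apply/funext => t; rewrite EFinM muleCA.
  - by move=> z t _; rewrite mule_ge0 ?lee_fin//; exact: nnfun_muleindic_ge0.
  apply: eq_fsbigr => z rz.
  have z0 : (0 <= z)%R.
    have /set_mem rz' := rz. case: rz' => y0 _ hyz. by rewrite -hyz.
  under eq_integral do rewrite EFinM muleCA.
  under [in RHS]eq_integral do rewrite EFinM.
  rewrite [LHS]ge0_integralZl//; last by move=> t _; rewrite mule_ge0 ?lee_fin.
  rewrite [in RHS]ge0_integralZl//; last by apply/measurable_EFinP.
  rewrite muleCA; congr (_ * _).
  by rewrite (H (h n @^-1` [set z])) // integral_indic// setIT.
under eq_fun do rewrite suf.
apply/cvg_lim => //; apply: cvgeZl => //.
apply: ereal_nondecreasing_is_cvgn => a b ab.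
apply: ge0_le_integral => //.
- by move=> y _; rewrite lee_fin.
- by apply/measurable_EFinP; exact/measurable_funP.
- by apply/measurable_EFinP; exact/measurable_funP.
- by move=> y _; rewrite lee_fin; exact: ndh.
Qed.
End WeightedTransfer.

Section HasExpectation.
Context d (T : measurableType d) (R : realType) (mu : {measure set T -> \bar R}).

(** Integrability and value travel together, so that linear combinations create no side
    conditions. *)
Definition has_integral (X : T -> R) (r : R) :=
  mu.-integrable [set: T] (EFin \o X) /\ (\int[mu]_t (X t)%:E = r%:E)%E.

Lemma has_integral_eq X Y r s :
  X =1 Y -> r = s -> has_integral X r -> has_integral Y s.
Proof. by move=> /funext -> ->. Qed.

Lemma has_integral0 : has_integral (fun=> 0) 0.
Proof. by split; [exact: integrable0 | rewrite integral0]. Qed.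

Lemma has_integralD X Y r s : has_integral X r -> has_integral Y s ->
  has_integral (fun t => X t + Y t) (r + s).
Proof.
move=> [iX eX] [iY eY]; split.
  rewrite (_ : _ \o _ = (EFin \o X) \+ (EFin \o Y))%E; last exact/funext.
  exact: integrableD.
by rewrite integralD_EFin// eX eY.
Qed.

Lemma has_integralZ a X r : has_integral X r ->
  has_integral (fun t => a * X t) (a * r).
Proof.
move=> [iX eX]; split.
  rewrite (_ : _ \o _ = (fun t => a%:E * (EFin \o X) t))%E; last exact/funext.
  exact: integrableZl.
under eq_integral do rewrite EFinM.
by rewrite integralZl// eX.
Qed.

Lemma has_integralB X Y r s : has_integral X r -> has_integral Y s ->
  has_integral (fun t => X t - Y t) (r - s).
Proof.
move=> hX /(has_integralZ (-1)) hY; have := has_integralD hX hY.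
by apply: has_integral_eq => [t|]; rewrite mulN1r.
Qed.

Lemma has_integral_sum (I : Type) (s : seq I) (Q : pred I) X r :
  (forall i, Q i -> has_integral (X i) (r i)) ->
  has_integral (fun t => \sum_(i <- s | Q i) X i t) (\sum_(i <- s | Q i) r i).
Proof.
move=> H; elim: s => [|i s IH].
  by apply: has_integral_eq has_integral0 => [t|]; rewrite big_nil.
have [Qi|Qi] := boolP (Q i); last first.
  by apply: has_integral_eq IH => [t|]; rewrite big_cons (negbTE Qi).
have := has_integralD (H i Qi) IH.
by apply: has_integral_eq => [t|]; rewrite big_cons Qi.
Qed.

Lemma has_integral_uniq X r s : has_integral X r -> has_integral X s -> r = s.
Proof. by move=> [_ +] [_ +] => -> []. Qed.

Lemma has_integral_le X Y r s : has_integral X r -> has_integral Y s ->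
  (forall t, X t <= Y t) -> r <= s.
Proof.
move=> [iX eX] [iY eY] XY; rewrite -lee_fin -eX -eY.
by apply: le_integral => // t _; rewrite lee_fin.
Qed.

Lemma integrable_has_integral X : mu.-integrable [set: T] (EFin \o X) ->
  has_integral X (fine (\int[mu]_t (X t)%:E)).
Proof. by move=> iX; split => //; rewrite fineK// (integrable_fin_num _ iX). Qed.

Lemma has_integral_pos X r : has_integral X r ->
  exists s, has_integral (fun t => Num.max (X t) 0) s.
Proof.
move=> [iX eX]; exists (fine (\int[mu]_t (Num.max (X t) 0)%:E)).
have i1 : mu.-integrable [set: T] (fun t => (Num.max (X t) 0)%:E).
  apply: (le_integrable _ _ _ (integrable_abse iX)) => //.
    apply/measurable_EFinP; apply: measurable_maxr => //.
    exact/measurable_EFinP/(measurable_int _ iX).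
  move=> t _; rewrite /= lee_fin normr_id ger0_norm ?le_max ?lexx ?orbT//.
  by rewrite ge_max normr_ge0 ler_norm.
by split => //; rewrite fineK// integrable_fin_num.
Qed.

End HasExpectation.

Section IndependentProducts.
Context d (T : measurableType d) (R : realType) (P : probability T R).
Variables (I : finType) (F : I -> set (set T)).

(** Measurability relative to a system of events, the form in which independence is stated; labels
    and real variables are then treated alike. *)
Definition adapted (S : set (set T)) (g : T -> R) :=
  forall B, measurable B -> S (g @^-1` B).

Hypothesis Fm : forall i A, F i A -> measurable A.
Hypothesis indep : mutually_independent P F.

Lemma adapted_measurable i g : adapted (F i) g -> measurable_fun [set: T] g.
Proof. by move=> ag _ B mB; rewrite setTI; apply: (Fm (i := i)); exact: ag. Qed.

Let mixed (J : {set I}) (g : I -> T -> R) (A : I -> set T) i t :=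
  if i \in J then g i t else \1_(A i) t.

(* The indicators let the events of the definition of independence be traded
   for random variables one index at a time. *)
Lemma indep_mixed (g : I -> T -> R) (c : I -> R) :
  (forall i, adapted (F i) (g i)) -> (forall i t, 0 <= g i t) ->
  (forall i, has_integral P (g i) (c i)) ->
  forall (J : {set I}) (A : I -> set T), (forall i, i \notin J -> F i (A i)) ->
  (\int[P]_t (\prod_i mixed J g A i t)%:E =
   (\prod_i (if i \in J then c i else fine (P (A i))))%:E)%E.
Proof.
move=> ag g0 hg J.
have [n] := ubnP #|J|; elim: n J => // n IH J ltn A AF.
have [J0|/finset.set0Pn [i0 i0J]] := eqVneq J finset.set0.
  have {}AF i : F i (A i) by apply: AF; rewrite J0 inE.
  have := indep (J := [set: I]%SET) (A := A) (fun i _ => AF i).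
  set B := \bigcap_(i in _) _ => PB.
  have mB : measurable B.
    by apply: fin_bigcap_measurable => // i _; exact: Fm (AF i).
  transitivity (\int[P]_t (\1_B t)%:E)%E.
    apply: eq_integral => t _; congr EFin; rewrite indicE.
    rewrite (eq_bigr (fun i => (t \in A i)%:R)); last by move=> i _; rewrite /mixed J0 inE indicE.
    have [tB|tB] := boolP (t \in B).
      rewrite big1// => i _.
      by rewrite mem_set//; move/set_mem: tB => /(_ i); apply; rewrite /= inE.
    have [i tA] : exists i, t \notin A i.
      apply/existsP; move: tB; apply: contraNT => /existsPn tA.
      by rewrite inE => i _; have := tA i; rewrite negbK inE.
    by rewrite (bigD1 i)//= (negbTE tA) mul0r.
  rewrite integral_indic// setIT; etransitivity; first exact: PB.
  rewrite -prodEFin (eq_bigl xpredT); last by move=> i; rewrite inE.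
  by apply: eq_bigr => i _; rewrite J0 inE fineK// fin_num_measure//; exact: Fm (AF i).
pose J' := J :\ i0.
have i0J' : i0 \notin J' by rewrite !inE eqxx.
have J'E i : i != i0 -> (i \in J') = (i \in J) by move=> ii0; rewrite !inE ii0.
pose w t := \prod_(i | i != i0) mixed J g A i t.
have mmix i : measurable_fun [set: T] (mixed J g A i).
  rewrite /mixed; have [_|iJ] := boolP (i \in J).
    exact: adapted_measurable (ag i).
  by apply: measurable_indic; exact: Fm (AF _ iJ).
have mg0 := adapted_measurable (ag i0).
have mixE t : \prod_i mixed J g A i t = w t * g i0 t.
  by rewrite (bigD1 i0)//= mulrC; congr (_ * _); rewrite /mixed i0J.
pose c' := \prod_(i | i != i0) (if i \in J then c i else fine (P (A i))).
pose mfg0 : {mfun T >-> R} := HB.pack (g i0) (isMeasurableFun.Build _ _ _ _ _ mg0).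
have c'0 : 0 <= c'.
  apply: prodr_ge0 => i _; case: ifP => _; last by rewrite fine_ge0.
  by case: (hg i) => _ e; rewrite -lee_fin -e integral_ge0// => t _; rewrite lee_fin.
(* The transferred function has to be nonnegative on the whole line, hence the positive part, which
   changes nothing on the values of [g i0]. *)
have key : (\int[P]_t ((w t)%:E * (Num.max (g i0 t) 0)%:E) =
    c'%:E * \int[distribution P mfg0]_y (Num.max y 0)%:E)%E.
  apply: (@weighted_transfer _ _ _ _ _ _ _ w (g i0) c' (fun y => (Num.max y 0)%:E)) => //.
  - rewrite (_ : w = fun t => \prod_i (if i != i0 then mixed J g A i t else 1)).
      apply: measurable_prod => i _; case: (i != i0); last exact: measurable_cst.
      exact: mmix.
    by apply/funext => t; rewrite /w big_mkcond.
  - by move=> t; apply: prodr_ge0 => i _; rewrite /mixed; case: ifP.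
  - move=> B mB; pose A' i := if i == i0 then g i0 @^-1` B else A i.
    have := IH J' _ A' _; rewrite (bigD1 i0)//= (negbTE i0J') /A' eqxx.
    under eq_integral do rewrite (bigD1 i0)//= {1}/mixed (negbTE i0J') eqxx.
    rewrite mulrC EFinM fineK; last by rewrite fin_num_measure//; exact: Fm (ag i0 _ mB).
    rewrite (eq_bigr (fun i => if i \in J then c i else fine (P (A i)))); last first.
      by move=> i ii0; rewrite J'E// (negbTE ii0).
    move=> <-.
    + apply: eq_integral => t _; rewrite EFinM muleC; congr (_ * (_)%:E)%E.
      by apply: eq_bigr => i ii0; rewrite /mixed J'E// (negbTE ii0).
    + by move: ltn; rewrite (cardsD1 i0) i0J.
    + move=> i iJ'; case: eqP => [->|/eqP ii0]; first exact: ag.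
      by apply: AF; rewrite -J'E.
  - exact/measurable_EFinP/measurable_maxr.
  - by move=> y; rewrite lee_fin le_max lexx orbT.
transitivity (\int[P]_t ((w t)%:E * (Num.max (g i0 t) 0)%:E))%E.
  by apply: eq_integral => t _; rewrite mixE EFinM max_l.
rewrite key ge0_integral_distribution//; last 2 first.
- exact/measurable_EFinP/measurable_maxr.
- by move=> y; rewrite lee_fin le_max lexx orbT.
rewrite (bigD1 i0)//= i0J mulrC EFinM; congr (_ * _)%E.
case: (hg i0) => _ <-; apply: eq_integral => t _ /=.
by rewrite max_l.
Qed.

Lemma indep_nonneg (g : I -> T -> R) (c : I -> R) :
  (forall i, adapted (F i) (g i)) -> (forall i t, 0 <= g i t) ->
  (forall i, has_integral P (g i) (c i)) ->
  has_integral P (fun t => \prod_i g i t) (\prod_i c i).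
Proof.
move=> ag g0 hg.
have FA i : i \notin [set: I]%SET -> F i setT by rewrite inE.
have e := indep_mixed ag g0 hg FA.
have {}e : (\int[P]_t (\prod_i g i t)%:E = (\prod_i c i)%:E)%E.
  rewrite -[RHS](_ : (\prod_i (if i \in [set: I]%SET then c i else fine (P setT)))%:E = _).
    by rewrite -e; apply: eq_integral => t _; congr EFin; apply: eq_bigr => i _; rewrite /mixed inE.
  by congr EFin; apply: eq_bigr => i _; rewrite inE.
split => //; apply/integrableP; split.
  apply/measurable_EFinP; apply: measurable_prod => i _.
  exact: adapted_measurable (ag i).
under eq_integral do rewrite /= ger0_norm ?prodr_ge0//.
by rewrite e ltry.
Qed.

(** Induction on the number of factors that may change sign: one of them is written as the
    difference of its positive and negative parts, and the product is linear in it. *)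
Theorem indep_product (g : I -> T -> R) (c : I -> R) :
  (forall i, adapted (F i) (g i)) -> (forall i, has_integral P (g i) (c i)) ->
  has_integral P (fun t => \prod_i g i t) (\prod_i c i).
Proof.
move=> ag hg.
suff: forall (J : {set I}) g c, (forall i, adapted (F i) (g i)) ->
    (forall i, has_integral P (g i) (c i)) -> (forall i t, i \notin J -> 0 <= g i t) ->
    has_integral P (fun t => \prod_i g i t) (\prod_i c i).
  by move=> /(_ [set: I]%SET); apply => // i t; rewrite inE.
move=> {g c ag hg} J; have [n] := ubnP #|J|; elim: n J => // n IH J ltn g c ag hg g0.
have [J0|/finset.set0Pn [i0 i0J]] := eqVneq J finset.set0.
  by apply: indep_nonneg => // i t; apply: g0; rewrite J0 inE.
have lt' : (#|J :\ i0| < n)%N by move: ltn; rewrite (cardsD1 i0) i0J.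
have [cp hp] := has_integral_pos (hg i0).
have [cn hn] := has_integral_pos (has_integralZ (-1) (hg i0)).
have cE : c i0 = cp - cn.
  apply: has_integral_uniq (hg i0) _; apply: has_integral_eq (has_integralB hp hn) => // t.
  by rewrite mulN1r /Num.max; case: ltP => ?; case: ltP => ?; lra.
pose upd T' (h : I -> T') (x : T') i := if i == i0 then x else h i.
have step (s e : R) : has_integral P (fun t => Num.max (s * g i0 t) 0) e ->
    has_integral P (fun t => \prod_i upd _ g (fun t => Num.max (s * g i0 t) 0) i t)
      (\prod_i upd _ c e i).
  move=> he; apply: (IH _ lt') => [i|i|i t].
  - rewrite /upd; case: eqP => [->|_] // B mB.
    have m1 : measurable_fun [set: R] (fun y => Num.max (s * y) 0).
      by apply: measurable_maxr => //; exact: measurable_funM.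
    by have /ag := m1 measurableT _ mB; rewrite setTI.
  - by rewrite /upd; case: eqP => [_|_].
  - rewrite !inE /upd; case: eqP => [_|_] /= iJ; last exact: g0.
    by rewrite le_max lexx orbT.
have hp' : has_integral P (fun t => Num.max (1 * g i0 t) 0) cp.
  by apply: has_integral_eq hp => // t; rewrite mul1r.
have updE (h : I -> R) x : \prod_i upd _ h x i = x * \prod_(i | i != i0) h i.
  rewrite (bigD1 i0)//= /upd eqxx; congr (_ * _).
  by apply: eq_bigr => i /negbTE ->.
apply: has_integral_eq (has_integralB (step 1 cp hp') (step (-1) cn hn)) => [t|].
  have e s : \prod_i upd _ g (fun t => Num.max (s * g i0 t) 0) i t =
      \prod_i upd _ (g^~ t) (Num.max (s * g i0 t) 0) i.
    by apply: eq_bigr => i _; rewrite /upd; case: eqP.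
  rewrite !e !updE -mulrBl [RHS](bigD1 i0)//=; congr (_ * _).
  by rewrite mulN1r mul1r /Num.max; case: ltP => ?; case: ltP => ?; lra.
by rewrite !updE -mulrBl -cE [RHS](bigD1 i0).
Qed.

End IndependentProducts.

(** * Gaussian integration by parts *)

Section GaussianMoments.
Context (R : realType).
Local Notation mu := (@lebesgue_measure R).
Local Notation phi := (@normal_pdf R 0).
Implicit Types (s x : R) (p : {poly R}).

Lemma normal_pdf0E s x : s != 0 ->
  phi s x = normal_peak s * expR (((- (s ^+ 2 *+ 2)^-1) *: 'X^2).[x]).
Proof.
move=> s0; rewrite normal_pdfE// /normal_fun subr0 hornerZ hornerXn.
by rewrite !mulNr [x ^+ 2 * _]mulrC.
Qed.

(** With y = x^2 / (8 s^2) the two densities are multiples of exp(-4 y) and exp(-y), while a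
    monomial is at most a constant times exp(y). Domination by the wider density yields
    integrability and boundedness together. *)
Lemma monomial_normal_pdf_le s d : s != 0 ->
  exists2 C, 0 <= C & forall x, `|x| ^+ d * phi s x <= C * phi (2 * s) x.
Proof.
move=> s0; pose a : R := 8 * s ^+ 2.
have a0 : 0 < a by rewrite mulr_gt0// exprn_even_gt0.
pose C0 : R := 1 + a ^+ d.+1 * d.+1`!%:R.
have C00 : 0 <= C0 by rewrite addr_ge0// mulr_ge0// exprn_ge0// ltW.
have s20 : 2 * s != 0 :> R by rewrite mulf_neq0.
exists (normal_peak s / normal_peak (2 * s) * C0).
  by rewrite mulr_ge0// divr_ge0// normal_peak_ge0.
move=> x; rewrite !normal_pdf0E//.
have -> : normal_peak s / normal_peak (2 * s) * C0 *
    (normal_peak (2 * s) * expR (- ((2 * s) ^+ 2 *+ 2)^-1 *: 'X^2).[x]) =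
    normal_peak s * (C0 * expR (- ((2 * s) ^+ 2 *+ 2)^-1 *: 'X^2).[x]).
  have : normal_peak (2 * s) != 0 by rewrite gt_eqF// normal_peak_gt0.
  by move=> ?; field.
rewrite mulrCA ler_wpM2l ?normal_peak_ge0// !hornerZ !hornerXn.
set y := x ^+ 2 / a.
have y0 : 0 <= y by rewrite divr_ge0 ?sqr_ge0 ?ltW.
have -> : - (s ^+ 2 *+ 2)^-1 * x ^+ 2 = - y - y - y - y.
  by rewrite /y /a; field; rewrite s0.
have -> : - ((2 * s) ^+ 2 *+ 2)^-1 * x ^+ 2 = - y.
  by rewrite /y /a; field; rewrite s0.
have le1 : `|x| ^+ d <= C0 * expR y.
  have x2 : `|x| ^+ 2 = a * y by rewrite /y mulrC divfK ?gt_eqF// real_normK ?num_real.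
  apply: (@le_trans _ _ (1 + (`|x| ^+ 2) ^+ d.+1)).
    have [x1|x1] := leP `|x| 1.
      by rewrite -[leLHS]addr0 lerD ?exprn_ile1// exprn_ge0.
    rewrite -[leLHS]add0r lerD// -exprM ler_weXn2l ?ltW//; lia.
  rewrite x2 exprMn mulrDl mul1r lerD//.
    by rewrite -[leLHS]expR0 ler_expR.
  rewrite -mulrA ler_wpM2l ?exprn_ge0 ?(ltW a0)//.
  have := expR_ge1Dxn d y0; have d0 : 0 < d.+1`!%:R :> R by rewrite ltr0n fact_gt0.
  rewrite -ler_pdivrMl// mulrC => h; apply: le_trans h; lra.
rewrite !expRD; set e := expR (- y).
have e0 : 0 < e by exact: expR_gt0.
have e1 : e <= 1 by rewrite -[leRHS]expR0 ler_expR oppr_le0.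
have ee : expR y * e = 1 by rewrite /e expRN mulfV// gt_eqF// expR_gt0.
apply: (@le_trans _ _ ((C0 * expR y) * (e * e * e * e))).
  by rewrite ler_wpM2r// !mulr_ge0// ltW.
rewrite -mulrA ler_wpM2l//.
have -> : expR y * (e * e * e * e) = e * e * e * (expR y * e) by ring.
rewrite ee mulr1 -mulrA ler_piMr ?(ltW e0)//.
by rewrite mulr_ile1 ?(ltW e0).
Qed.

Lemma integrable_poly_normal s p : s != 0 ->
  mu.-integrable [set: R] (EFin \o (fun x => p.[x] * phi s x)).
Proof.
move=> s0; have mon d : mu.-integrable [set: R] (EFin \o (fun x => x ^+ d * phi s x)).
  have [C C0 HC] := monomial_normal_pdf_le d s0.
  have i2 : mu.-integrable [set: R] (fun x => C%:E * (phi (2 * s) x)%:E)%E.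
    by apply: integrableZl => //; exact: integrable_normal_pdf.
  apply: (le_integrable _ _ _ i2) => //.
    by apply/measurable_EFinP; apply: measurable_funM => //; exact: measurable_normal_pdf.
  move=> x _ /=; rewrite lee_fin normrM normrX (ger0_norm (normal_pdf_ge0 0 s x)).
  exact: le_trans (HC x) (ler_norm _).
have H d : has_integral mu (fun x => x ^+ d * phi s x)
    (fine (\int[mu]_x (x ^+ d * phi s x)%:E)).
  exact: integrable_has_integral (mon d).
have [] // := @has_integral_sum _ _ _ mu 'I_(size p) (index_enum _) xpredT
  (fun i x => p`_i * (x ^+ i * phi s x)) _ (fun i _ => has_integralZ p`_i (H i)).
move=> + _; apply: eq_integrable => // x _; congr EFin.
by rewrite horner_coef mulr_suml; apply: eq_bigr => i _; rewrite mulrA.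
Qed.

Lemma poly_normal_bounded s p : s != 0 ->
  exists C, forall x, `|p.[x] * phi s x| <= C.
Proof.
move=> s0; have s20 : 2 * s != 0 :> R by rewrite mulf_neq0.
elim/poly_ind: p => [|p c [C HC]]; first by exists 0 => x; rewrite horner0 mul0r normr0.
suff [C' HC'] : exists C, forall x, `|('X * p).[x] * phi s x| <= C.
  exists (C' + `|c| * normal_peak s) => x; rewrite (mulrC p) hornerD hornerC mulrDl.
  rewrite (le_trans (ler_normD _ _))// lerD// normrM (ger0_norm (normal_pdf_ge0 0 s x)).
  by rewrite ler_wpM2l// normal_pdf_ub.
have H d : exists C, forall x, `|x ^+ d * phi s x| <= C.
  have [C0 C00 h] := monomial_normal_pdf_le d s0.
  exists (C0 * normal_peak (2 * s)) => x.
  rewrite normrM normrX (ger0_norm (normal_pdf_ge0 0 s x)).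
  by apply: le_trans (h x) _; rewrite ler_wpM2l// normal_pdf_ub.
have [B HB] := choice H.
exists (\sum_(i < size ('X * p)) `|('X * p)`_i| * B i) => x.
rewrite horner_coef mulr_suml (le_trans (ler_norm_sum _ _ _))// ler_sum// => i _.
by rewrite -mulrA normrM ler_wpM2l.
Qed.

Lemma is_derive_poly_normal s p x : s != 0 ->
  is_derive x 1 (fun x => p.[x] * phi s x)
    ((p^`() - (s ^+ 2)^-1 *: ('X * p)).[x] * phi s x).
Proof.
move=> s0.
set q : {poly R} := - (s ^+ 2 *+ 2)^-1 *: 'X^2.
have -> : (fun x => p.[x] * phi s x) =
    (normal_peak s \*: (horner p * (expR \o horner q))).
  by apply/funext => y; rewrite normal_pdf0E//= /GRing.scale /= mulrCA.
apply: is_derive_eq.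
rewrite normal_pdf0E// -/q /GRing.scale /=.
have -> : q^`() = - (s ^+ 2)^-1 *: 'X.
  rewrite /q derivZ derivXn /= -scalerMnr scalerMnl; congr (_ *: _).
  by field.
rewrite !hornerE /=; ring.
Qed.

(** The integrand is the derivative of p phi. On [-a, a] the boundary values are at most C / a,
    because x p(x) phi(x) is bounded, and dominated convergence passes to the whole line. *)
Lemma integral_poly_normal_deriv s p : s != 0 ->
  has_integral mu (fun x => (p^`() - (s ^+ 2)^-1 *: ('X * p)).[x] * phi s x) 0.
Proof.
move=> s0; set f := fun x => _; pose F x := p.[x] * phi s x.
have iF : mu.-integrable [set: R] (EFin \o f) by exact: integrable_poly_normal.
split => //.
have dF x : is_derive x 1 F (f x) by exact: is_derive_poly_normal.
have [C HC] := poly_normal_bounded ('X * p) s0.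
have cf : continuous f.
  move=> x; apply: cvgM; last exact: continuous_normal_pdf.
  exact: continuous_horner.
have cF : continuous F.
  by move=> x; apply: differentiable_continuous; apply/derivable1_diffP; case: (dF x).
pose a n : R := n.+1%:R.
have u n : (\int[mu]_(x in `[(- a n)%R, a n]) (f x)%:E = (F (a n) - F (- a n))%R%:E)%E.
  have an : - a n < a n by rewrite -subr_gt0 opprK addr_gt0.
  rewrite (@continuous_FTC2 _ f F)//.
  - exact: continuous_subspaceT.
  - split.
    + by move=> x _; case: (dF x).
    + by apply: cvg_at_right_filter; exact: cF.
    + by apply: cvg_at_left_filter; exact: cF.
  - by move=> x _; rewrite derive1E; case: (dF x).
have u0 : (\int[mu]_(x in `[(- a n)%R, a n]) (f x)%:E @[n --> \oo] --> 0)%E.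
  under eq_fun do rewrite u.
  apply: cvg_EFin; first by near=> n.
  have H : (fun n => (2 * C) * n.+1%:R^-1) @ \oo --> (0 : R).
    rewrite -[X in _ --> X](mulr0 (2 * C)); apply: cvgMr.
    exact: cvg_harmonic.
  apply/norm_cvg0P; apply: (squeeze_cvgr _ (cvg_cst 0) H).
  near=> n; rewrite /= normr_ge0 /=.
  have b x : `|x| = a n -> `|F x| <= C / a n.
    move=> xa; rewrite ler_pdivlMr// -xa mulrC -normrM.
    by have := HC x; rewrite hornerM hornerX -mulrA.
  apply: (le_trans (ler_normB _ _)); rewrite -mulrA mulr_natl mulr2n lerD//.
    by apply: b; rewrite ger0_norm.
  by apply: b; rewrite normrN ger0_norm.
have v : (\int[mu]_(x in `[(- a n)%R, a n]) (f x)%:E @[n --> \oo] --> \int[mu]_x (f x)%:E)%E.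
  pose g n (x : R) : \bar R := ((EFin \o f) \_ [set` `[- a n, a n]%R]) x.
  have mf : measurable_fun [set: R] (EFin \o f) by exact: measurable_int iF.
  have gE n (x : R) : g n x = if x \in `[- a n, a n]%R then (f x)%:E else 0%E.
    by rewrite /g patchE mem_setE.
  have mg n : measurable_fun [set: R] (g n).
    apply/(measurable_restrictT _ _).1 => //; exact: measurable_funTS.
  have gf : {ae mu, forall x : R, setT x -> g ^~ x @ \oo --> (EFin \o f) x}.
    apply: aeW => x _; apply: cvg_near_cst; near=> n.
    rewrite gE ifT// in_itv/= -ler_norml.
    rewrite /a (@le_trans _ _ n%:R)// ?ler_nat//.
    by near: n; exact: nbhs_infty_ger.
  have gb : {ae mu, forall (x : R) n, setT x -> (`|g n x| <= (abse \o (EFin \o f)) x)%E}.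
    apply: aeW => x n _; rewrite gE /=; case: ifP => _ //.
    by rewrite abse0 lee_fin normr_ge0.
  have [_ _] := @dominated_convergence _ _ _ mu setT measurableT g (EFin \o f)
    (abse \o (EFin \o f)) mg mf gf (integrable_abse iF) gb.
  rewrite (_ : [sequence _]_n = (fun n => \int[mu]_(x in `[(- a n)%R, a n]) (f x)%:E)%E)//.
  by apply/funext => n; rewrite [in RHS]integral_mkcond.
exact: (cvg_unique _ v u0).
Unshelve. all: by end_near. Qed.

End GaussianMoments.

Section NormalVariables.
Context (R : realType).
Local Notation mu := (@lebesgue_measure R).
Local Notation phi := (@normal_pdf R 0).

Lemma monomial_normal_moment (s : R) d : s != 0 ->
  has_integral mu (fun x => x ^+ d * phi s x) (s ^+ d * (gauss_moment d)%:R).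
Proof.
move=> s0; have [n] := ubnP d; elim: n d => // n IH [|[|d]] ltd.
- have h : has_integral mu (phi s) 1.
    by split; [exact: integrable_normal_pdf|exact: integral_normal_pdf].
  by apply: has_integral_eq h => [x|]; rewrite ?mul1r ?expr0 ?mulr1.
- have := has_integralZ (- s ^+ 2) (integral_poly_normal_deriv 1 s0).
  apply: has_integral_eq => [x|]; last by rewrite !mulr0.
  by rewrite derivC sub0r mulr1 hornerN hornerZ hornerX; field.
- have h1 := has_integralZ (s ^+ 2 * d.+1%:R) (IH d (ltnW ltd)).
  have := has_integralB h1 (has_integralZ (s ^+ 2) (integral_poly_normal_deriv 'X^(d.+1) s0)).
  apply: has_integral_eq => [x|]; last first.
    by rewrite mulr0 subr0 /= natrM !exprS; ring.
  rewrite derivXn hornerD hornerN hornerZ hornerM hornerX hornerMn !hornerXn /= -mulr_natr !exprS; field.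
  by [].
Qed.

(** The expectation of [p] at a standard Gaussian, defined on coefficients so that the Hermite
    calculus is pure algebra; [normal_poly_expect] links it to integrals. *)
Definition gauss_expect (p : {poly R}) : R :=
  \sum_(i < size p) p`_i * (gauss_moment i)%:R.

Lemma gauss_expect_widen n (p : {poly R}) : (size p <= n)%N ->
  gauss_expect p = \sum_(i < n) p`_i * (gauss_moment i)%:R.
Proof.
move=> le; rewrite /gauss_expect (big_ord_widen _ (fun i => p`_i * (gauss_moment i)%:R) le).
rewrite big_mkcond; apply: eq_bigr => i _; case: ltnP => // h.
by rewrite nth_default// mul0r.
Qed.

Lemma gauss_expectD (p q : {poly R}) :
  gauss_expect (p + q) = gauss_expect p + gauss_expect q.
Proof.
have lp := leq_maxl (size p) (size q); have lq := leq_maxr (size p) (size q).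
rewrite (gauss_expect_widen (size_polyD p q)) (gauss_expect_widen lp).
rewrite (gauss_expect_widen lq) -big_split; apply: eq_bigr => i _ /=.
by rewrite coefD mulrDl.
Qed.

Lemma gauss_expectZ a (p : {poly R}) : gauss_expect (a *: p) = a * gauss_expect p.
Proof.
rewrite (gauss_expect_widen (size_scale_leq a p)) /gauss_expect mulr_sumr.
by apply: eq_bigr => i _; rewrite coefZ mulrA.
Qed.

Lemma gauss_expect_sum (I : Type) (r : seq I) (Q : pred I) (F : I -> {poly R}) :
  gauss_expect (\sum_(i <- r | Q i) F i) = \sum_(i <- r | Q i) gauss_expect (F i).
Proof.
elim/big_rec2: _ => [|i x p _ <-]; last exact: gauss_expectD.
by rewrite /gauss_expect size_poly0 big_ord0.
Qed.

Lemma gauss_expectXn d : gauss_expect 'X^d = (gauss_moment d)%:R.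
Proof.
rewrite /gauss_expect size_polyXn big_ord_recr /= coefXn eqxx mul1r big1 ?add0r// => i _.
by rewrite coefXn ltn_eqF// mul0r.
Qed.

Lemma gauss_expect_by_parts (p : {poly R}) :
  gauss_expect ('X * p) = gauss_expect p^`().
Proof.
rewrite -(coefK p) poly_def mulr_sumr linear_sum /= !gauss_expect_sum.
apply: eq_bigr => i _; rewrite -scalerAr derivZ !gauss_expectZ -exprS derivXn.
congr (_ * _); case: (nat_of_ord i) => [|j]; rewrite gauss_expectXn/=.
  by rewrite mulr0n /gauss_expect size_poly0 big_ord0.
have -> : 'X^j *+ j.+1 = (j.+1%:R : R) *: 'X^j by rewrite scaler_nat.
by rewrite gauss_expectZ gauss_expectXn natrM.
Qed.

Context d (T : measurableType d) (P : probability T R).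

(** The density is nonnegative, so multiplication by it commutes with positive parts, and a signed
    [g] reduces to nonnegative functions. *)
Lemma normal_transfer (V : {RV P >-> R}) (s : R) (g : R -> R) r :
  (forall B, measurable B -> distribution P V B = normal_prob 0 s B) ->
  measurable_fun [set: R] g ->
  has_integral mu (fun x => g x * phi s x) r -> has_integral P (fun w => g (V w)) r.
Proof.
move=> VE.
have nn (f : R -> \bar R) : measurable_fun [set: R] f -> (forall y, 0 <= f y)%E ->
    (\int[P]_w f (V w) = \int[mu]_x ((phi s x)%:E * f x))%E.
  move=> mf f0.
  rewrite (@weighted_transfer _ _ _ _ _ mu (distribution P V) (phi s) idfun 1)//.
  - by rewrite mul1e (ge0_integral_distribution V mf f0).
  - exact: measurable_normal_pdf.
  - by move=> x; exact: normal_pdf_ge0.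
  - exact: measurable_id.
  - move=> B mB; rewrite mul1e; etransitivity; last exact: (esym (VE B mB)).
    rewrite /normal_prob.
    rewrite [RHS]integral_mkcond; apply: eq_integral => x _.
    by rewrite preimage_id epatch_indic.
pose pos (g : R -> R) := forall r, measurable_fun [set: R] g -> (forall x, 0 <= g x) ->
  has_integral mu (fun x => g x * phi s x) r -> has_integral P (fun w => g (V w)) r.
have posg : forall g, pos g.
  move=> {}g {}r mg g0 [ig eg].
  have mgV : measurable_fun [set: T] (fun w => g (V w)) by exact: measurableT_comp.
  have mEg : measurable_fun [set: R] (EFin \o g) by exact/measurable_EFinP.
  have e : (\int[P]_w (g (V w))%:E = r%:E)%E.
    rewrite (nn (EFin \o g))// -eg; apply: eq_integral => x _.
    by rewrite /= -EFinM mulrC.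
  split => //; apply/integrableP; split; first exact/measurable_EFinP.
  by under eq_integral do rewrite /= ger0_norm//; rewrite e ltry.
move=> mg hg.
have [rp hp] := has_integral_pos hg.
have [rn hn] := has_integral_pos (has_integralZ (-1) hg).
have maxM (x y : R) : 0 <= y -> Num.max (x * y) 0 = Num.max x 0 * y.
  by move=> y0; rewrite maxr_pMl// mul0r.
have hp' : has_integral P (fun w => Num.max (g (V w)) 0) rp.
  apply: (posg (fun x => Num.max (g x) 0)) => [|x|].
  - by apply: measurable_maxr.
  - by rewrite le_max lexx orbT.
  - by apply: has_integral_eq hp => // x; rewrite maxM// normal_pdf_ge0.
have hn' : has_integral P (fun w => Num.max (- g (V w)) 0) rn.
  apply: (posg (fun x => Num.max (- g x) 0)) => [|x|].
  - by apply: measurable_maxr => //; exact: measurableT_comp.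
  - by rewrite le_max lexx orbT.
  - by apply: has_integral_eq hn => // x; rewrite mulN1r -mulNr maxM// normal_pdf_ge0.
have maxB (x : R) : Num.max x 0 - Num.max (- x) 0 = x.
  by rewrite /Num.max; case: ltP => ?; case: ltP => ?; lra.
apply: has_integral_eq (has_integralB hp' hn') => [w|]; first exact: maxB.
apply: has_integral_uniq (has_integralB hp hn) _.
by apply: has_integral_eq hg => // x; rewrite mulN1r maxB.
Qed.

Lemma normal_poly_expect (V : {RV P >-> R}) (s : R) (p : {poly R}) : s != 0 ->
  (forall B, measurable B -> distribution P V B = normal_prob 0 s B) ->
  has_integral P (fun w => p.[V w / s]) (gauss_expect p).
Proof.
move=> s0 VE.
have H i : has_integral P (fun w => (V w / s) ^+ i) (gauss_moment i)%:R.
  apply: (normal_transfer (g := fun x => (x / s) ^+ i) VE).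
    by apply: measurable_funX; exact: measurable_funM.
  have := has_integralZ (s ^- i) (monomial_normal_moment i s0).
  apply: has_integral_eq => [x|]; first by rewrite expr_div_n; ring.
  by rewrite mulKf// expf_neq0.
have := @has_integral_sum _ _ _ P _ (index_enum 'I_(size p)) xpredT _ _
  (fun i _ => has_integralZ p`_i (H i)).
apply: has_integral_eq => [w|//]; by rewrite horner_coef.
Qed.

End NormalVariables.

(** * The Hermite proxy of the target *)

Section PriorFacts.
Context (d : measure_display) (T : measurableType d) (R : realType).
Context (P : probability T R) (n p K : nat).
Variables (k : 'I_n -> T -> 'I_K) (z : 'I_p -> {RV P >-> bool}).
Variables (eps : 'I_n -> {RV P >-> R}) (nu : 'I_K -> 'I_p -> {RV P >-> R}).
Variable (E : 'I_n -> 'I_p -> {RV P >-> R}).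
Variables (rho lambda sigma : R).
Hypothesis prior : sparse_clustering_prior k z eps nu E rho lambda sigma.

Lemma adapted_comp d' (U : measurableType d') (V : T -> U) (f : U -> R) :
  measurable_fun [set: U] f ->
  adapted (preimage_set_system setT V measurable) (fun w => f (V w)).
Proof.
move=> mf B mB; exists (f @^-1` B); last by rewrite setTI.
by rewrite -[_ @^-1` _]setTI; exact: mf.
Qed.

Lemma label_event_measurable i (A : set 'I_K) : measurable (k i @^-1` A).
Proof.
rewrite (_ : _ @^-1` _ = \bigcup_(a in A) (k i @^-1` [set a])).
  by apply: fin_bigcup_measurable => // a _; exact: label_measurable prior _ _.
apply/seteqP; split => [w Aw|w [a Aa /= ka]]; first by exists (k i w).
by rewrite /preimage /= ka.
Qed.

Lemma prior_events_measurable v A : prior_events k z eps nu E v A -> measurable A.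
Proof.
case: v => [[[[i|j]|i]|[a j]]|[i j]] /= [B mB <-]; rewrite setTI.
- exact: label_event_measurable.
- by rewrite -[_ @^-1` _]setTI; exact: measurable_funP.
- by rewrite -[_ @^-1` _]setTI; exact: measurable_funP.
- by rewrite -[_ @^-1` _]setTI; exact: measurable_funP.
- by rewrite -[_ @^-1` _]setTI; exact: measurable_funP.
Qed.

Lemma has_integral_indic (A : set T) r : measurable A -> P A = r%:E ->
  has_integral P (fun w => \1_A w) r.
Proof.
move=> mA PA; split; first exact: integrable_indic.
by rewrite integral_indic// setIT.
Qed.

Lemma label_expect i a : has_integral P (fun w => (k i w == a)%:R : R) K%:R^-1.
Proof.
have := has_integral_indic (label_measurable prior i a) (label_uniform prior i a).
apply: has_integral_eq => // w; rewrite indicE; congr (_%:R); congr nat_of_bool.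
by apply/idP/eqP => [/set_mem|e]; [|exact: mem_set].
Qed.

Hypotheses (rho_ge0 : 0 <= rho) (rho_le1 : rho <= 1).

Lemma z_expect j c : has_integral P (fun w => (z j w)%:R ^+ c : R)
  (if (0 < c)%N then rho else 1).
Proof.
case: c => [|c] /=.
  have := has_integral_indic measurableT (probability_setT P).
  by apply: has_integral_eq => // w; rewrite indicE in_setT expr0.
have mt : measurable (z j @^-1` [set true]).
  by rewrite -[_ @^-1` _]setTI; exact: measurable_funP.
have Pz : P (z j @^-1` [set true]) = rho%:E.
  have := z_bernoulli prior j [set true]; rewrite /distribution /pushforward => ->.
  rewrite bernoulli_probE ?rho_ge0 ?rho_le1//= !diracE.
  rewrite mem_set// memNset//= mule0 mule1 adde0//.
apply: has_integral_eq (has_integral_indic mt Pz) => // w; rewrite indicE.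
have -> : (w \in z j @^-1` [set true]) = z j w.
  by apply/idP/idP => [/set_mem|h] //; apply: mem_set.
by case: (z j w); rewrite ?expr1n ?expr0n.
Qed.

(** Only the masses of 1 and -1 are prescribed. They add up to 1, so outside a null set the power
    equals the combination [Y] of two indicators. *)
Lemma eps_expect i c : has_integral P (fun w => eps i w ^+ c) (~~ odd c)%:R.
Proof.
have m1 x : measurable (eps i @^-1` [set x]).
  by rewrite -[_ @^-1` _]setTI; exact: measurable_funP.
have h1 := has_integral_indic (m1 1) (eps_plus prior i).
have h2 := has_integral_indic (m1 (-1)) (eps_minus prior i).
set A := eps i @^-1` [set 1] in h1 *; set B := eps i @^-1` [set -1] in h2 *.
have AB : A `&` B = set0.
  apply/seteqP; split => // w [Aw Bw].
  have e1 : eps i w = 1 := Aw; have : eps i w = -1 := Bw.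
  rewrite e1 => /eqP; rewrite -subr_eq0 opprK.
  by rewrite (_ : 1 + 1 = 2%:R)// pnatr_eq0.
have PAB : P (A `|` B) = 1%E.
  rewrite measureU//; [|exact: m1|exact: m1].
  transitivity ((2^-1)%:E + (2^-1)%:E : \bar R)%E.
    by congr (_ + _)%E; [exact: eps_plus prior i|exact: eps_minus prior i].
  by rewrite -EFinD; congr EFin; lra.
have mAB : measurable (A `|` B) by apply: measurableU; exact: m1.
have PN : P (~` (A `|` B)) = 0%E by rewrite probability_setC// PAB subee.
pose Y w : R := \1_A w + (-1) ^+ c * \1_B w.
have hY : has_integral P Y (~~ odd c)%:R.
  apply: has_integral_eq (has_integralD h1 (has_integralZ ((-1) ^+ c) h2)) => //.
  by rewrite -signr_odd; case: (odd c); rewrite /= ?expr1 ?expr0; lra.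
have mX : measurable_fun [set: T] (fun w => (eps i w ^+ c)%:E).
  by apply/measurable_EFinP; apply: measurable_funX; exact: measurable_funP.
have mY : measurable_fun [set: T] (EFin \o Y) by exact: measurable_int hY.1.
have ae : ae_eq P [set: T] (fun w => (eps i w ^+ c)%:E) (EFin \o Y).
  exists (~` (A `|` B)); split => //; first exact: measurableC.
  move=> w /= H AwBw; apply: H => _; rewrite /Y !indicE.
  case: AwBw => [Aw|Bw].
    rewrite (mem_set Aw) memNset ?mulr0 ?addr0; last first.
      by move=> Bw; have : (A `&` B) w by []; rewrite AB.
    have -> : eps i w = 1 := Aw.
    by rewrite expr1n.
  rewrite (mem_set Bw) memNset ?add0r ?mulr1; last first.
    by move=> Aw; have : (A `&` B) w by []; rewrite AB.
  by have -> : eps i w = -1 := Bw.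
split.
  apply/integrableP; split => //.
  have -> : (\int[P]_x `|(eps i x ^+ c)%:E| = \int[P]_x `|(EFin \o Y) x|)%E.
    apply: ae_eq_integral => //; [exact: measurableT_comp|exact: measurableT_comp|].
    by apply: filterS ae => w h /h ->.
  by have /integrableP[] := hY.1.
rewrite -hY.2; exact: ae_eq_integral.
Qed.

End PriorFacts.

Lemma prod_fiber (R : comNzRingType) (A Q : finType) (S : {set A}) (f : A -> Q) (y : Q -> R) :
  \prod_(s in S) y (f s) = \prod_q y q ^+ #|fiber S f q|.
Proof.
rewrite (partition_big f xpredT) //=; apply: eq_bigr => q _.
rewrite -prodr_const; apply: eq_big => s; first by rewrite inE.
by move=> /andP[_ /eqP ->].
Qed.

(** * Joint moments of labels, signal and noise *)

Section Master.
Context (d : measure_display) (T : measurableType d) (R : realType).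
Context (P : probability T R) (n p K : nat).
Variables (k : 'I_n -> T -> 'I_K.+1) (z : 'I_p -> {RV P >-> bool}).
Variables (eps : 'I_n -> {RV P >-> R}) (nu : 'I_K.+1 -> 'I_p -> {RV P >-> R}).
Variable (E : 'I_n -> 'I_p -> {RV P >-> R}).
Variables (rho lambda sigma : R).
Hypothesis prior : sparse_clustering_prior k z eps nu E rho lambda sigma.
Hypotheses (rho_ge0 : 0 <= rho) (rho_le1 : rho <= 1).
Hypotheses (lambda_gt0 : 0 < lambda) (sigma_gt0 : 0 < sigma).

Lemma nu_expect a j c : has_integral P (fun w => (nu a j w / sigma) ^+ c)
  ((lambda / sigma) ^+ c * (gauss_moment c)%:R).
Proof.
have l0 : lambda != 0 by rewrite gt_eqF.
have s0 : sigma != 0 by rewrite gt_eqF.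
have := has_integralZ ((lambda / sigma) ^+ c)
  (normal_poly_expect 'X^c l0 (nu_normal prior a j)).
apply: has_integral_eq => [w|]; last by rewrite gauss_expectXn.
by rewrite hornerXn -exprMn; congr (_ ^+ _); field; rewrite l0 s0.
Qed.

Variables (A : finType) (e : A -> 'I_n * 'I_p).
Let u s := (e s).1.
Let v s := (e s).2.

Definition std_signal w (i : 'I_n * 'I_p) : R := signal k z eps nu w i.1 i.2 / sigma.

(** With the labels fixed to [c], the monomial is a product with one factor for each independent
    variable of the prior; the label factors are the indicators of [c]. *)
Let g (S : {set A}) (q : 'I_n * 'I_p -> {poly R}) (c : {ffun 'I_n -> 'I_K.+1})
    (x : prior_index n p K.+1) (w : T) : R :=
  match x with
  | inl (inl (inl (inl i))) => (k i w == c i)%:R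
  | inl (inl (inl (inr j))) => (z j w)%:R ^+ #|fiber S v j|
  | inl (inl (inr i)) => eps i w ^+ #|fiber S u i|
  | inl (inr y) => (nu y.1 y.2 w / sigma) ^+ #|fiber S (fun s => (c (u s), v s)) y|
  | inr i => (q i).[E i.1 i.2 w / sigma]
  end.

Let ge (S : {set A}) (q : 'I_n * 'I_p -> {poly R}) (c : {ffun 'I_n -> 'I_K.+1})
    (x : prior_index n p K.+1) : R :=
  match x with
  | inl (inl (inl (inl i))) => K.+1%:R^-1
  | inl (inl (inl (inr j))) => if (0 < #|fiber S v j|)%N then rho else 1
  | inl (inl (inr i)) => (~~ odd #|fiber S u i|)%:R
  | inl (inr y) => (lambda / sigma) ^+ #|fiber S (fun s => (c (u s), v s)) y| *
       (gauss_moment #|fiber S (fun s => (c (u s), v s)) y|)%:R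
  | inr i => gauss_expect (q i)
  end.

Let prod_index (F : prior_index n p K.+1 -> R) : \prod_x F x =
  (\prod_i F (inl (inl (inl (inl i))))) * (\prod_j F (inl (inl (inl (inr j))))) *
  (\prod_i F (inl (inl (inr i)))) * (\prod_y F (inl (inr y))) * (\prod_i F (inr i)).
Proof. by rewrite !big_sumType. Qed.

Let g_expect S q c : has_integral P (fun w => \prod_x g S q c x w) (\prod_x ge S q c x).
Proof.
apply: (indep_product (prior_events_measurable prior) (prior_independent prior)).
  move=> [[[[i|j]|i]|[a j]]|[i j]] /=.
  - by move=> B mB; exists [set b | B (b == c i)%:R] => //; rewrite setTI.
  - exact: (adapted_comp (z j) (f := fun b : bool => b%:R ^+ _)).
  - apply: (adapted_comp (eps i) (f := fun x => x ^+ _)).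
    exact: measurable_funX.
  - apply: (adapted_comp (nu a j) (f := fun x => (x / sigma) ^+ _)).
    by apply: measurable_funX; exact: measurable_funM.
  - apply: (adapted_comp (E i j) (f := fun x => (q (i, j)).[x / sigma])).
    apply: measurableT_comp; last exact: measurable_funM.
    by apply: continuous_measurable_fun; exact: continuous_horner.
move=> [[[[i|j]|i]|[a j]]|[i j]] /=.
- exact: label_expect prior _ _.
- exact: (z_expect prior rho_ge0 rho_le1).
- exact: eps_expect prior _ _.
- exact: nu_expect.
- by apply: normal_poly_expect (E_normal prior i j); rewrite gt_eqF.
Qed.

(** The labels decide which [nu] enters an entry, so independent factors appear only after
    decomposing over the values [c] of all labels. *)
Lemma signal_poly_expect (S : {set A}) (phi : {ffun 'I_n -> 'I_K.+1} -> R)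
    (q : 'I_n * 'I_p -> {poly R}) :
  has_integral P (fun w => phi [ffun i => k i w] * \prod_(s in S) std_signal w (e s) *
      \prod_i (q i).[E i.1 i.2 w / sigma])
    (model_moment u v (lambda / sigma) rho phi S * \prod_i gauss_expect (q i)).
Proof.
have := @has_integral_sum _ _ _ P _ (index_enum {ffun 'I_n -> 'I_K.+1}) xpredT _ _
  (fun c _ => has_integralZ (phi c) (g_expect S q c)).
apply: has_integral_eq => [w|].
  rewrite (bigD1 [ffun i => k i w])//= [X in _ + X]big1 ?addr0; last first.
    move=> c ck; rewrite (prod_index (fun x => g S q c x w)) /=.
    have [i ki] : exists i, k i w != c i.
      apply/existsP; apply: contraNT ck => /existsPn H; apply/eqP/ffunP => i.
      by rewrite ffunE; apply/eqP; rewrite eq_sym; have := H i; rewrite negbK.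
    by rewrite (bigD1 i)//= (negbTE ki) !mul0r mulr0.
  rewrite (prod_index (fun x => g S q _ x w)) /=.
  have -> : \prod_i (k i w == [ffun i => k i w] i)%:R = 1 :> R.
    by rewrite big1// => i _; rewrite ffunE eqxx.
  rewrite mul1r !mulrA; congr (_ * _); rewrite -!mulrA; congr (_ * _).
  rewrite -(prod_fiber S u (fun i => eps i w)) -(prod_fiber S v (fun j => (z j w)%:R)).
  rewrite -(prod_fiber S (fun s => ([ffun i => k i w] (u s), v s))
     (fun y => nu y.1 y.2 w / sigma)) -!big_split /=.
  by apply: eq_bigr => s _; rewrite /std_signal mxE ffunE /= !mulrA.
have geE c : \prod_x ge S q c x =
    (lambda / sigma) ^+ #|S| * rho ^+ #|v @: S| * [forall i, ~~ odd #|fiber S u i|]%:R *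
    (#|{ffun 'I_n -> 'I_K.+1}|%:R^-1 * label_weight R u v S c) * \prod_i gauss_expect (q i).
  rewrite (prod_index (fun x => ge S q c x)) /=; congr (_ * _).
  have -> : \prod_(i < n) K.+1%:R^-1 = #|{ffun 'I_n -> 'I_K.+1}|%:R^-1 :> R.
    by rewrite prodr_const card_ffun !card_ord natrX exprVn.
  have -> : \prod_(j < p) (if (0 < #|fiber S v j|)%N then rho else 1) = rho ^+ #|v @: S|.
    rewrite -big_mkcond /= -prodr_const; apply: eq_bigl => j.
    apply/card_gt0P/imsetP => [[s]|[s sS ->]].
      by rewrite inE => /andP[sS /eqP vs]; exists s.
    by exists s; rewrite inE sS eqxx.
  have -> : \prod_(i < n) (~~ odd #|fiber S u i|)%:R = [forall i, ~~ odd #|fiber S u i|]%:R :> R.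
    have [/forallP H|/forallPn [i oi]] := boolP [forall i, ~~ odd #|fiber S u i|].
      by rewrite big1// => i _; rewrite H.
    by rewrite (bigD1 i)//= (negbTE oi) mul0r.
  rewrite big_split /= -expr_sum (sum_card_fiber (fun s => (c (u s), v s))).
  rewrite -natr_prod /label_weight /fiber_moment; ring.
rewrite mulrC /model_moment !mulr_sumr; apply: eq_bigr => c _.
transitivity (phi c * ((lambda / sigma) ^+ #|S| * rho ^+ #|v @: S| *
    [forall i, ~~ odd #|fiber S u i|]%:R *
    (#|{ffun 'I_n -> 'I_K.+1}|%:R^-1 * label_weight R u v S c) * \prod_i gauss_expect (q i))).
  by congr (_ * _); exact: geE.
by ring.
Qed.

End Master.

(** * Hermite polynomials *)

Section Hermite.
Variable R : realType.

(** Probabilists' normalisation: leading coefficient 1 and square norm a! under the standard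
    Gaussian. *)
Fixpoint hermite (a : nat) : {poly R} :=
  if a is a'.+1 then 'X * hermite a' - (hermite a')^`() else 1.

Lemma hermite_deriv a : (hermite a.+1)^`() = a.+1%:R *: hermite a.
Proof.
elim: a => [|a IH]; first by rewrite /= mulr1 derivC subr0 derivX scale1r.
rewrite [hermite a.+2]/= -/(hermite a.+1) derivB derivM derivX mul1r IH.
by rewrite derivZ -scalerAr -addrA -scalerBr -[a.+2%:R]nat1r scalerDl scale1r.
Qed.

Lemma hermite_derivn a b : (hermite b)^`(a) = (b ^_ a)%:R *: hermite (b - a).
Proof.
elim: a b => [|a IH] [|b]; rewrite ?ffactn0 ?subn0 ?derivn0 ?scale1r//.
  by rewrite ffact0n scale0r; apply: derivn_poly0; rewrite [hermite 0]/= size_poly1.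
rewrite derivSn hermite_deriv derivnZ IH scalerA subSS ffactSS.
by rewrite natrM.
Qed.

(** Repeated integration by parts: multiplication by [hermite a] is adjoint to the a-th
    derivative. *)
Lemma gauss_expect_hermite a (q : {poly R}) :
  gauss_expect (hermite a * q) = gauss_expect q^`(a).
Proof.
elim: a q => [|a IH] q; first by rewrite mul1r derivn0.
rewrite [hermite _]/= -/(hermite a) mulrBl -mulrA -scaleN1r gauss_expectD gauss_expectZ.
rewrite gauss_expect_by_parts derivM gauss_expectD.
by rewrite mulN1r addrAC subrr add0r IH derivSn.
Qed.

(** Against a noise monomial, the factorial cancels the denominator of the proxy and leaves the
    binomial coefficient of the cumulant recursion. *)
Lemma gauss_expect_hermiteXn a c :
  gauss_expect (hermite a * 'X^c) = ('C(c, a) * a`! * gauss_moment (c - a))%:R.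
Proof.
rewrite gauss_expect_hermite derivnXn bin_ffact -mulr_natl.
have -> : (c ^_ a)%:R * 'X^(c - a) = (c ^_ a)%:R *: 'X^(c - a) :> {poly R}.
  by rewrite scaler_nat mulr_natl.
by rewrite gauss_expectZ gauss_expectXn natrM.
Qed.

Lemma gauss_expect_hermiteM a b :
  gauss_expect (hermite a * hermite b) = (a == b)%:R * a`!%:R.
Proof.
rewrite gauss_expect_hermite hermite_derivn gauss_expectZ.
have H0 c : gauss_expect (hermite c) = (c == 0)%N%:R.
  rewrite -[hermite c]mulr1 gauss_expect_hermite; case: c => [|c].
    by rewrite derivn0 -[1]/('X^0) gauss_expectXn.
  by rewrite derivSn derivC derivnC -polyC0 /= if_same /gauss_expect size_poly0 big_ord0.
rewrite H0; case: (ltngtP a b) => [ab|ab|->].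
- by rewrite subn_eq0 leqNgt ab mulr0 mul0r.
- by rewrite ffact_small// !mul0r.
- by rewrite subnn ffactnn mulr1 mul1r.
Qed.

End Hermite.

(** * Orthogonality of the residual and the lower bound *)

Section Orthogonality.
Context (d : measure_display) (T : measurableType d) (R : realType).
Context (P : probability T R) (n p K D : nat).
Variables (k : 'I_n -> T -> 'I_K.+1) (z : 'I_p -> {RV P >-> bool}).
Variables (eps : 'I_n -> {RV P >-> R}) (nu : 'I_K.+1 -> 'I_p -> {RV P >-> R}).
Variable (E : 'I_n -> 'I_p -> {RV P >-> R}).
Variables (rho lambda sigma : R) (i1 i2 : 'I_n).
Hypothesis prior : sparse_clustering_prior k z eps nu E rho lambda sigma.
Hypotheses (rho_ge0 : 0 <= rho) (rho_le1 : rho <= 1).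
Hypotheses (lambda_gt0 : 0 < lambda) (sigma_gt0 : 0 < sigma) (i12 : i1 != i2).

Local Notation I := ('I_n * 'I_p)%type.
Local Notation lam := (lambda / sigma).
Local Notation labels := {ffun 'I_n -> 'I_K.+1}.
Local Notation same := (@same_label R 'I_n 'I_K.+1 i1 i2).
Local Notation one := (fun _ : labels => 1 : R).

Definition std_noise w (i : I) : R := E i.1 i.2 w / sigma.
Local Notation X := (std_signal k z eps nu sigma).
Definition std_obs w (i : I) : R := X w i + std_noise w i.
Definition target w : R := (k i1 w == k i2 w)%:R.

Let sameE w : same [ffun i => k i w] = target w.
Proof. by rewrite /same_label !ffunE. Qed.

Lemma signal_noise_expect (A : finType) (e : A -> I) (S : {set A}) (phi : labels -> R)
    (q : I -> {poly R}) :
  has_integral P (fun w => phi [ffun i => k i w] * \prod_(s in S) X w (e s) *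
      \prod_i (q i).[std_noise w i])
    (model_moment (fun s => (e s).1) (fun s => (e s).2) lam rho phi S *
     \prod_i gauss_expect (q i)).
Proof. exact: (signal_poly_expect prior). Qed.

Definition moment (phi : labels -> R) (a : {ffun I -> nat}) : R :=
  fine (\int[P]_w (phi [ffun i => k i w] * \prod_i X w i ^+ a i)%:E).

(** Both sides compute one expectation, which depends on the multiplicities of the family only.
    Cumulants can therefore be defined on multi-indices and estimated on edge families. *)
Lemma moment_counts (A : finType) (e : A -> I) (S : {set A}) phi :
  moment phi (counts e S) =
  model_moment (fun s => (e s).1) (fun s => (e s).2) lam rho phi S.
Proof.
have [_] := signal_noise_expect e S phi (fun=> 'X^0).
under eq_integral do rewrite (prod_fiber _ _ (X _)).
rewrite (_ : \prod_i gauss_expect _ = 1) ?mulr1; last first.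
  by rewrite big1// => i _; rewrite gauss_expectXn.
move=> h; rewrite /moment.
rewrite (_ : (\int[P]_w _)%E = (model_moment (fun s => (e s).1) (fun s => (e s).2) lam rho phi S)%:E)//.
rewrite -h; apply: eq_integral => w _; congr EFin.
rewrite [X in _ = _ * X]big1 ?mulr1; last by move=> i _; rewrite hornerXn.
by congr (_ * _); apply: eq_bigr => i _; rewrite ffunE.
Qed.

Let void_edge (x : void) : I := match x with end.

Lemma moment0 : moment one [ffun=> 0%N] = 1.
Proof.
rewrite (_ : [ffun=> 0%N] = counts void_edge finset.set0).
  by rewrite moment_counts; exact: mom_set0.
by apply/ffunP => i; rewrite !ffunE; apply/esym/eqP; rewrite cards_eq0; apply/eqP/setP => -[].
Qed.

Variable kap : {ffun I -> nat} -> R.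
Hypothesis kapE : forall a : {ffun I -> nat}, (\sum_i a i <= D)%N ->
  moment same a = \sum_(b : {ffun I -> 'I_D.+1}) (\prod_i 'C(a i, b i))%:R *
      (kap (mi_val b) * moment one [ffun i => (a i - b i)%N]).

(** The binomial coefficient of a multi-index counts the subfamilies of [S] that realise it, so the
    recursion loses its coefficients when summed over subfamilies. *)
Lemma kap_set (A : finType) (e : A -> I) (S : {set A}) : (#|A| <= D)%N ->
  model_moment (fun s => (e s).1) (fun s => (e s).2) lam rho same S =
  \sum_(U : {set A} | U \subset S) kap (counts e U) *
     model_moment (fun s => (e s).1) (fun s => (e s).2) lam rho one (S :\: U).
Proof.
move=> AD; have SD : (#|S| <= D)%N by rewrite (leq_trans (max_card _)).
rewrite -moment_counts kapE; last first.
  by under eq_bigr do rewrite ffunE; rewrite sum_card_fiber.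
rewrite (eq_bigr (fun U : {set A} => kap (counts e U) *
    moment one [ffun i => (counts e S i - counts e U i)%N])); last first.
  move=> U US; congr (_ * _); rewrite -moment_counts; congr moment.
  by apply/ffunP => i; rewrite [RHS]ffunE countsB.
rewrite (sum_subsets_counts e (fun a => kap a * moment one [ffun i => (counts e S i - a i)%N]) SD).
apply: eq_bigr => b _; congr (_ * (_ * moment _ _)); apply/ffunP => i.
by rewrite !ffunE.
Qed.

Let small (b : {ffun I -> 'I_D.+1}) := (\sum_i b i <= D)%N.
Let coef (b : {ffun I -> 'I_D.+1}) : R := kap (mi_val b) / (\prod_i (b i)`!)%:R.

Definition proxy w : R :=
  \sum_(b : {ffun I -> 'I_D.+1} | small b)
    coef b * \prod_i (hermite R (b i)).[std_noise w i].

Lemma signal_const_expect (phi : labels -> R) (q : I -> {poly R}) :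
  has_integral P (fun w => phi [ffun i => k i w] * \prod_i (q i).[std_noise w i])
   ((#|labels|%:R^-1 * \sum_c phi c) * \prod_i gauss_expect (q i)).
Proof.
have := signal_noise_expect void_edge finset.set0 phi q.
rewrite model_moment_set0; apply: has_integral_eq => // w.
by rewrite big_set0 mulr1.
Qed.

Lemma target_expect : has_integral P (fun w => target w ^+ 2) K.+1%:R^-1.
Proof.
have := signal_const_expect same (fun=> 'X^0).
apply: has_integral_eq => [w|].
  rewrite sameE big1 ?mulr1; last by move=> i _; rewrite hornerXn.
  by rewrite /target; case: (_ == _); rewrite ?expr1n ?expr0n.
rewrite [X in _ * X = _]big1 ?mulr1; last by move=> i _; rewrite gauss_expectXn.
rewrite mean_same_label// mulKf ?card_ord//.
by rewrite pnatr_eq0 -lt0n; apply/card_gt0P; exists [ffun=> ord0].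
Qed.

Lemma proxy_sqr_expect : has_integral P (fun w => proxy w ^+ 2)
  (\sum_(b : {ffun I -> 'I_D.+1} | small b)
     kap (mi_val b) ^+ 2 / (\prod_i (b i)`!)%:R).
Proof.
have h b c := signal_const_expect one (fun i => hermite R (b i : 'I_D.+1) * hermite R (c i : 'I_D.+1)).
have := @has_integral_sum _ _ _ P _ (index_enum {ffun I -> 'I_D.+1}) small _ _
  (fun b _ => @has_integral_sum _ _ _ P _ (index_enum {ffun I -> 'I_D.+1}) small _ _
    (fun c _ => has_integralZ (coef b * coef c) (h b c))).
apply: has_integral_eq => [w|].
  rewrite expr2 {1}/proxy mulr_suml; apply: eq_bigr => b _.
  rewrite /proxy mulr_sumr; apply: eq_bigr => c _.
  rewrite mul1r; under eq_bigr do rewrite hornerM.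
  by rewrite big_split /=; ring.
apply: eq_bigr => b sb; rewrite (bigD1 b)//= [X in _ + X]big1 ?addr0; last first.
  move=> c /andP[_ cb]; have [i bi] : exists i, b i != c i.
    apply/existsP; apply: contraNT cb => /existsPn H; apply/eqP/ffunP => i.
    by have := H i; rewrite negbK => /eqP.
  rewrite [X in _ * (_ * X)](bigD1 i)//= gauss_expect_hermiteM -val_eqE in bi *.
  by rewrite (negbTE bi) !mul0r !mulr0.
rewrite (eq_bigr (fun i => (b i)`!%:R)); last first.
  by move=> i _; rewrite gauss_expect_hermiteM eqxx mul1r.
rewrite sumr_const mulVf ?mul1r; last first.
  by rewrite pnatr_eq0 -lt0n; apply/card_gt0P; exists [ffun=> ord0].
rewrite -natr_prod /coef; field.
by rewrite pnatr_eq0 -lt0n prodn_gt0// => i; rewrite fact_gt0.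
Qed.

Lemma std_obs_prod (A : finType) (e : A -> I) w :
  \prod_s std_obs w (e s) = \sum_(S : {set A})
    \prod_(s in S) X w (e s) * \prod_i std_noise w i ^+ counts e (~: S) i.
Proof.
rewrite bigA_distr; apply: eq_bigr => S _.
rewrite (bigID (mem S)) /=; congr (_ * _).
  by apply: eq_bigr => s ->.
under [RHS]eq_bigr do rewrite ffunE; rewrite -prod_fiber.
by apply: eq_big => s; [rewrite !inE|move=> /negbTE ->].
Qed.

(** In the expanded product the edges of [S] carry the signal and the others the noise. The Hermite
    terms of the proxy pick a subfamily [U] of the noise edges, weighted by its cumulant, and leave
    the noise moment of the rest; [convolution_swap] then rebuilds the moments of the target. *)
Lemma orthogonal (A : finType) (e : A -> I) : (#|A| <= D)%N ->
  has_integral P (fun w => (target w - proxy w) * \prod_s std_obs w (e s)) 0.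
Proof.
move=> AD; pose a (S : {set A}) := model_moment (fun s => (e s).1) (fun s => (e s).2) lam rho one S.
pose b (S : {set A}) := model_moment (fun s => (e s).1) (fun s => (e s).2) lam rho same S.
pose kk (S : {set A}) := kap (counts e S).
pose gg (S : {set A}) : R := \prod_i (gauss_moment (counts e S i))%:R.
have hx : has_integral P (fun w => target w * \prod_s std_obs w (e s))
    (\sum_(S : {set A}) b S * gg (~: S)).
  have := @has_integral_sum _ _ _ P _ (index_enum {set A}) xpredT _ _
    (fun S _ => signal_noise_expect e S same (fun i => 'X^(counts e (~: S) i))).
  apply: has_integral_eq => [w|].
    rewrite std_obs_prod mulr_sumr; apply: eq_bigr => S _; rewrite sameE mulrA.
    by congr (_ * _); apply: eq_bigr => i _; rewrite hornerXn.
  apply: eq_bigr => S _; congr (_ * _); apply: eq_bigr => i _.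
  by rewrite gauss_expectXn.
have hp : has_integral P (fun w => proxy w * \prod_s std_obs w (e s))
    (\sum_(S : {set A}) a S * \sum_(U : {set A} | U \subset ~: S) kk U * gg (~: S :\: U)).
  have h S c := signal_noise_expect e S one (fun i => hermite R (c i : 'I_D.+1) * 'X^(counts e (~: S) i)).
  have := @has_integral_sum _ _ _ P _ (index_enum {set A}) xpredT _ _
    (fun S _ => @has_integral_sum _ _ _ P _ (index_enum {ffun I -> 'I_D.+1}) small _ _
      (fun c _ => has_integralZ (coef c) (h S c))).
  apply: has_integral_eq => [w|].
    rewrite std_obs_prod mulr_sumr; apply: eq_bigr => S _; rewrite /proxy mulr_suml.
    apply: eq_bigr => c _; rewrite [X in _ * (_ * X) = _](eq_bigr (fun i =>
      (hermite R (c i)).[std_noise w i] * std_noise w i ^+ counts e (~: S) i)); last first.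
      by move=> i _; rewrite hornerM hornerXn.
    by rewrite [X in _ * (_ * X) = _]big_split /= mul1r; ring.
  apply: eq_bigr => S _; rewrite -/(a S).
  pose cS := counts e (~: S).
  rewrite (eq_bigr (fun U : {set A} => kap (counts e U) *
      \prod_i (gauss_moment (cS i - counts e U i))%:R)); last first.
    move=> U US; rewrite /kk /gg; congr (_ * _); apply: eq_bigr => i _.
    by rewrite countsB.
  have SD : (#|~: S| <= D)%N by rewrite (leq_trans (max_card _)).
  rewrite (sum_subsets_counts e (fun al => kap al * \prod_i (gauss_moment (cS i - al i))%:R) SD).
  rewrite mulr_sumr big_mkcond /=; apply: eq_bigr => c _.
  have fc : (\prod_i (c i)`!)%:R != 0 :> R.
    by rewrite pnatr_eq0 -lt0n prodn_gt0// => i; rewrite fact_gt0.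
  have [sc|sc] := boolP (small c).
    rewrite (eq_bigr (fun i => ('C(cS i, c i))%:R * (c i)`!%:R * (gauss_moment (cS i - c i))%:R)); last first.
      by move=> i _; rewrite gauss_expect_hermiteXn !natrM.
    rewrite !big_split /= -!natr_prod.
    rewrite [X in _ = _ * (_ * (_ * X))](_ : _ = (\prod_i gauss_moment (cS i - c i))%:R); last first.
      by congr (_ *+ _); apply: eq_bigr => i _; rewrite [mi_val c i]ffunE.
    rewrite -/cS /coef; field.
    by [].
  (* A multi-index of degree above [D] does not fit into the noise edges: its binomial coefficient
     vanishes, so its absence from the proxy costs nothing. *)
  have [i lt] : exists i, (cS i < c i)%N.
    apply/existsP; apply: contraNT sc => /existsPn H; rewrite /small.
    apply: leq_trans SD; rewrite -(sum_card_fiber e); apply: leq_sum => i _.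
    by have := H i; rewrite -leqNgt /cS ffunE.
  by rewrite [X in _ = _ * (X%:R * _)](bigD1 i)//= bin_small// !mul0r mulr0.
apply: has_integral_eq (has_integralB hx hp) => [w|]; first by rewrite mulrBl.
apply/eqP; rewrite subr_eq0; apply/eqP/esym/convolution_swap => S.
exact: kap_set.
Qed.

Lemma obs_integrable (A : finType) (e : A -> I) :
  exists r, has_integral P (fun w => \prod_s std_obs w (e s)) r.
Proof.
exists (\sum_(S : {set A}) model_moment (fun s => (e s).1) (fun s => (e s).2) lam rho one S *
   \prod_i gauss_expect 'X^(counts e (~: S) i)).
have := @has_integral_sum _ _ _ P _ (index_enum {set A}) xpredT _ _
    (fun S _ => signal_noise_expect e S one (fun i => 'X^(counts e (~: S) i))).
apply: has_integral_eq => // w; rewrite std_obs_prod; apply: eq_bigr => S _.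
by rewrite mul1r; congr (_ * _); apply: eq_bigr => i _; rewrite hornerXn.
Qed.

Let edge_of (q : 'I_(n * p)) : I := enum_val (cast_ord (esym (mxvec_cast n p)) q).

Lemma mxvec_observation w q :
  mxvec (observation k z eps nu E w) 0 q = sigma * std_obs w (edge_of q).
Proof.
case/mxvec_indexP: q => i j; rewrite mxvecE /edge_of /mxvec_index cast_ordK enum_rankK.
rewrite /std_obs /std_signal /std_noise /observation !mxE /=.
by field; rewrite gt_eqF.
Qed.

(** The family lists each variable as many times as its exponent, by a type of dependent pairs. *)
Lemma monomial_observation (m : multinom (n * p)) : (mdeg m <= D)%N ->
  exists (A : finType) (e : A -> I), (#|A| <= D)%N /\
    forall w, \prod_q (mxvec (observation k z eps nu E w) 0 q) ^+ m q =
      sigma ^+ mdeg m * \prod_s std_obs w (e s).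
Proof.
move=> mD; exists {q : 'I_(n * p) & 'I_(m q)}, (fun s => edge_of (tag s)); split.
  apply: leq_trans mD; rewrite card_tagged sumnE big_map big_enum mdegE /=.
  by apply: eq_leq; apply: eq_bigr => q _; rewrite card_ord.
move=> w; rewrite mdegE expr_sum.
have := @sig_big_dep _ _ *%R _ (fun q => 'I_(m q)) xpredT (fun _ => xpredT)
  (fun q _ => std_obs w (edge_of q)).
rewrite (eq_bigl xpredT)// => <-; rewrite -big_split /=; apply: eq_bigr => q _.
by rewrite prodr_const card_ord -exprMn mxvec_observation.
Qed.

Lemma poly_eval_orthogonal (f : mpoly (n * p) R) : (msize f <= D.+1)%N ->
  has_integral P (fun w => (target w - proxy w) * poly_eval f (observation k z eps nu E w)) 0
  /\ exists r, has_integral P (fun w => poly_eval f (observation k z eps nu E w)) r.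
Proof.
move=> fD; pose mon (m : multinom (n * p)) w :=
  \prod_q (mxvec (observation k z eps nu E w) 0 q) ^+ m q.
have mf w : poly_eval f (observation k z eps nu E w) = \sum_(m <- msupp f) mcoeff m f * mon m w.
  exact: mevalE.
have mD m : m \in msupp f -> (mdeg m <= D)%N.
  by move=> /msize_mdeg_lt lt; have := leq_trans lt fD.
have h1 m : m \in msupp f -> has_integral P (fun w => (target w - proxy w) * mon m w) 0.
  move=> /mD /monomial_observation [A [e [AD me]]].
  apply: has_integral_eq (has_integralZ (sigma ^+ mdeg m) (orthogonal e AD)) => [w|].
    by rewrite /mon me; ring.
  by rewrite mulr0.
have h2 m : exists r, m \in msupp f -> has_integral P (mon m) r.
  have [/mD /monomial_observation [A [e [AD me]]]|] := boolP (m \in msupp f); last by exists 0.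
  have [r hr] := obs_integrable e; exists (sigma ^+ mdeg m * r) => _.
  by apply: has_integral_eq (has_integralZ (sigma ^+ mdeg m) hr) => [w|//]; rewrite /mon me.
have [r hr] := choice h2; split; last first.
  exists (\sum_(m <- msupp f | m \in msupp f) mcoeff m f * r m).
  have := @has_integral_sum _ _ _ P _ (msupp f) (mem (msupp f)) _ _
    (fun m fm => has_integralZ (mcoeff m f) (hr m fm)).
  by apply: has_integral_eq => [w|//]; rewrite mf -big_seq.
have := @has_integral_sum _ _ _ P _ (msupp f) (mem (msupp f)) _ _
    (fun m fm => has_integralZ (mcoeff m f) (h1 m fm)).
apply: has_integral_eq => [w|]; last by rewrite big1// => m _; rewrite mulr0.
rewrite mf mulr_sumr -big_seq; apply: eq_bigr => m _; ring.
Qed.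

(** Pointwise (f - x)^2 = (f - h)^2 - 2 (x - h) f + x^2 - h^2, where the term in (x - h) f has
    expectation zero. Dropping the first square gives the bound without integrability of the square
    of f. *)
Lemma mmse_ge h2 : has_integral P (fun w => proxy w ^+ 2) h2 ->
  ((K.+1%:R^-1 - h2)%:E <= mmse P D (observation k z eps nu E) target)%E.
Proof.
move=> hh; apply: le_ereal_inf_tmp => _ [f /= fD <-].
have [h0 [r [fint _]]] := poly_eval_orthogonal fD.
set F := fun w => poly_eval f (observation k z eps nu E w) in h0 fint *.
have [tint _] := target_expect.
have tE w : target w ^+ 2 = target w.
  by rewrite /target; case: (_ == _); rewrite ?expr1n ?expr0n.
have mF : measurable_fun [set: T] (fun w => (F w - target w) ^+ 2).
  apply: measurable_funX; apply: measurable_funB.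
    exact/measurable_EFinP/(measurable_int _ fint).
  have := measurable_int _ tint; rewrite (_ : _ \o _ = EFin \o target).
    by move/measurable_EFinP.
  by apply/funext => w /=; rewrite tE.
rewrite expectation.unlock.
have hg := has_integralB (has_integralD (has_integralZ (- 2) h0) target_expect) hh.
(* The positive part allows a comparison with a nonnegative function that is only known to be
   measurable. *)
have [s hm] := has_integral_pos hg.
apply: (@le_trans _ _ s%:E).
  rewrite lee_fin; have := has_integral_le hg hm; rewrite mulr0 add0r; apply => w.
  by rewrite le_max lexx.
case: hm => hi <-; apply: ge0_le_integral => //.
- by move=> w _; rewrite lee_fin le_max lexx orbT.
- exact: measurable_int _ hi.
- exact/measurable_EFinP.
- move=> w _; rewrite lee_fin ge_max sqr_ge0 andbT -/(F w).
  have := sqr_ge0 (F w - proxy w); rewrite !expr2; nra.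
Qed.

Variable ze : R.
Hypotheses (ze1 : lam ^+ 4 * D%:R ^+ 14 <= ze) (ze2 : lam ^+ 4 * (D%:R ^+ 7 * n%:R) <= ze)
  (ze3 : lam ^+ 4 * (D%:R ^+ 7 * rho ^+ 2 * p%:R) <= ze)
  (ze4 : lam ^+ 4 * (rho ^+ 2 * p%:R * (n%:R / K.+1%:R ^+ 2)) <= ze) (ze_lt1 : ze < 1).

(** Multi-indices are grouped by degree: degree 0 gives the squared mean of the target, odd degrees
    give nothing, and the other degrees are bounded through sums over edge tuples. *)
Lemma proxy_sqr_le :
  \sum_(b : {ffun I -> 'I_D.+1} | small b) kap (mi_val b) ^+ 2 / (\prod_i (b i)`!)%:R <=
  K.+1%:R ^- 2 * (1 + ze / (1 - Num.sqrt ze) ^+ 3).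
Proof.
pose f L : R := (L`!)%:R^-1 *
  \sum_(t : L.-tuple I) kap (counts (tnth t) [set: 'I_L]%SET) ^+ 2.
have ze_ge0 : 0 <= ze.
  by apply: le_trans ze1; rewrite mulr_ge0 ?exprn_ge0// divr_ge0// ltW.
have lam_ge0 : 0 <= lam by rewrite divr_ge0// ltW.
rewrite (partition_big (fun b : {ffun I -> 'I_D.+1} => inord (\sum_i b i) : 'I_D.+1) xpredT)//=.
rewrite (eq_bigr (fun L : 'I_D.+1 => f L)); last first.
  move=> L _; rewrite /f -(sum_tuples_counts (fun a => kap a ^+ 2) (leq_ord L)).
  apply: eq_bigl => b; rewrite /small; apply/andP/eqP => [[bD /eqP <-]|bL].
    by rewrite inordK.
  by rewrite bL leq_ord; split=> //; apply/eqP/val_inj; rewrite /= inordK.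
have kE L (LD : (L <= D)%N) (t : L.-tuple I) (S : {set 'I_L}) :
    model_moment (row_of t) (col_of t) lam rho same S =
    \sum_(U : {set 'I_L} | U \subset S) kap (counts (tnth t) U) *
      model_moment (row_of t) (col_of t) lam rho one (S :\: U).
  by apply: kap_set; rewrite card_ord.
apply: even_geometric_sum => //.
- rewrite /f (eq_bigr (fun=> K.+1%:R ^- 2)) => [|t _].
    by rewrite sumr_const card_tuple expn0 mulr1n fact0 invr1 mul1r.
  rewrite -exprVn; congr (_ ^+ 2).
  have -> : [set: 'I_0]%SET = finset.set0 by apply/setP => -[].
  have := @kap_set _ (tnth t) finset.set0.
  rewrite card_ord => /(_ (leq0n D)).
  rewrite (big_pred1 finset.set0) => [|U]; last by rewrite finset.subset0.
  rewrite finset.setD0 mom_set0 mulr1 model_moment_set0 mean_same_label// card_ord mulKf//.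
  by rewrite pnatr_eq0 -lt0n; apply/card_gt0P; exists [ffun=> ord0].
- move=> [//|L] oL LD; rewrite /f.
  by rewrite (odd_level_sum rho_ge0 rho_le1 lam_ge0 i12 (ltn0Sn L) (kE _ LD) oL) mulr0.
- move=> l l0 lD; rewrite -(card_ord K.+1).
  by apply: (level_sum_le rho_ge0 rho_le1 lam_ge0 i12 _ _ _ _ _ lD (kE _ lD) erefl);
    rewrite ?card_ord ?double_gt0.
Qed.

End Orthogonality.

Theorem theorem4p1 (d : measure_display) (T : measurableType d) (R : realType)
    (P : probability T R) (n p K D : nat) (sigma Delta s : R)
    (n_ge2 : (2 <= n)%N) (p_ge1 : (1 <= p)%N) (K_ge1 : (1 <= K)%N)
    (sigma_gt0 : 0 < sigma) (Delta_gt0 : 0 < Delta)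
    (s_gt0 : 0 < s) (s_le : s <= p%:R)
    (k : 'I_n -> T -> 'I_K) (z : 'I_p -> {RV P >-> bool})
    (eps : 'I_n -> {RV P >-> R}) (nu : 'I_K -> 'I_p -> {RV P >-> R})
    (E : 'I_n -> 'I_p -> {RV P >-> R}) :
  let rho := s / p%:R in
  let lambda := Num.sqrt (Delta ^+ 2 * sigma ^+ 2 / (rho * p%:R)) in
  let i1 : 'I_n := Ordinal (ltnW n_ge2) in
  let i2 : 'I_n := Ordinal n_ge2 in
  let x := fun w : T => (k i1 w == k i2 w)%:R : R in
  let ze := zeta n p K D Delta rho in
  sparse_clustering_prior k z eps nu E rho lambda sigma ->
  ze < 1 ->
  ((K%:R^-1 - (K%:R ^+ 2)^-1 * (1 + ze / (1 - Num.sqrt ze) ^+ 3))%:E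
     <= mmse P D (observation k z eps nu E) x)%E.
Proof.
(* With a successor as number of labels, the label type is a cyclic group, whose translations drive
   the counting. *)
case: K K_ge1 k nu => // K _ k nu rho lambda i1 i2 x ze prior ze_lt1.
have p_gt0 : 0 < p%:R :> R by rewrite ltr0n.
have rho_gt0 : 0 < rho by rewrite divr_gt0.
have rho_le1 : rho <= 1 by rewrite ler_pdivrMr// mul1r.
have rhop_gt0 : 0 < rho * p%:R by rewrite mulr_gt0.
have var_gt0 : 0 < Delta ^+ 2 * sigma ^+ 2 / (rho * p%:R).
  by rewrite divr_gt0// mulr_gt0// exprn_gt0.
have lambda_gt0 : 0 < lambda by rewrite sqrtr_gt0.
have i12 : i1 != i2 by [].
(* The prefactor of [zeta] is the fourth power of the signal scale relative to the noise. *)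
have lam4 : (lambda / sigma) ^+ 4 = Delta ^+ 4 / (rho ^+ 2 * p%:R ^+ 2).
  rewrite expr_div_n (exprM lambda 2 2) /lambda sqr_sqrtr ?(ltW var_gt0)//.
  by field; rewrite !gt_eqF.
have zeE m : m <= Num.max (D%:R ^+ 14) (Num.max (D%:R ^+ 7 * n%:R)
      (Num.max (D%:R ^+ 7 * rho ^+ 2 * p%:R)
               (rho ^+ 2 * p%:R * (n%:R / K.+1%:R ^+ 2)))) ->
    (lambda / sigma) ^+ 4 * m <= ze.
  move=> h; rewrite /ze /zeta lam4; apply: ler_wpM2l => //.
  by rewrite divr_ge0// ?mulr_ge0 ?exprn_ge0// ltW.
have [kap kapE] := cumulant_exists D
  (moment k z eps nu sigma (same_label R i1 i2))
  (moment0 prior (ltW rho_gt0) rho_le1 lambda_gt0 sigma_gt0).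
have h2 := proxy_sqr_expect D prior (ltW rho_gt0) rho_le1 lambda_gt0 sigma_gt0 kap.
apply: le_trans (mmse_ge prior (ltW rho_gt0) rho_le1 lambda_gt0 sigma_gt0 i12 kapE h2).
rewrite lee_fin lerD2l lerN2.
apply: (proxy_sqr_le prior (ltW rho_gt0) rho_le1 lambda_gt0 sigma_gt0 i12 kapE) => //;
  by apply: zeE; rewrite !le_max lexx ?orbT.
Qed.
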